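(* Let $K, L$ be two totally ramified tame Galois number fields (Galois over $\mathbb{Q}$). Suppose that both $K$ and $L$ have odd degree over $\mathbb{Q}$. Then the forms $q_K$ and $q_L$ belong to the same spinor genus if and only if $\mathrm{disc}(K)=\mathrm{disc}(L)$.
   Context: For a number field $F$ with ring of integers $O_F$, the integral trace form $q_F$ is the integral quadratic form $q_F(x)=\mathrm{Tr}_{F/\mathbb{Q}}(x^2)$ on the free $\mathbb{Z}$-module $O_F$, associated with the bilinear pairing $(x,y)\mapsto \mathrm{Tr}_{F/\mathbb{Q}}(xy)$. A number field is tame if no finite prime is wildly ramified in it. A number field is called totally ramified here if every prime number that ramifies in it is totally ramified (its ramification degree equals the degree of the field). Spinor genus: two $\mathbb{Z}$-lattices $M,N$ on the same nondegenerate quadratic space $V$ over $\mathbb{Q}$ are in the same spinor genus if there are $\sigma\in O(V)$ and, for every finite prime $p$, an element $\Sigma_p\in SO(V_p)$ of trivial spinor norm, such that $N_p=\sigma\Sigma_p M_p$ for all $p$ (where $V_p=V\otimes\mathbb{Q}_p$, $M_p=M\otimes\mathbb{Z}_p$, and similarly for $N$). Two integral quadratic forms belong to the same spinor genus if they can be realized by two such lattices on a common quadratic space. *)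

(* Defs.v *)
From HB Require Import structures.
From mathcomp Require Import all_boot all_order all_algebra all_field.
From mathcomp Require Import mathcomp_extra boolp classical_sets.

Set Implicit Arguments.
Unset Strict Implicit.
Unset Printing Implicit Defensive.

Import GRing.Theory Num.Theory.
Local Open Scope ring_scope.

(* The p-adic integers, as the inverse limit of the Z/p^n: a coherent sequence
   is represented by its least non-negative residues. The proof of primality is
   a parameter of the type so that it can be made an integral domain. *)
Record padic_int (p : nat) (p_pr : prime p) := PadicInt {
  padic_res :> nat -> int;
  padic_resP : forall n, padic_res n = (padic_res n.+1 %% (p ^ n)%N)%Z
}.

Lemma modz_modMr (d e a : int) : ((a %% (d * e))%Z %% d)%Z = (a %% d)%Z.
Proof.
rewrite [in RHS](divz_eq a (d * e)).
by rewrite [_ * (d * e)]mulrCA [d * (_ * e)]mulrC modzMDl.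
Qed.

Section PadicInt.
Variables (p : nat) (p_pr : prime p).
Local Notation Zp := (padic_int p_pr).
Implicit Types (x y z : Zp) (f g : nat -> int).

HB.instance Definition _ := gen_eqMixin Zp.
HB.instance Definition _ := gen_choiceMixin Zp.

Lemma padicP x y : x =1 y -> x = y.
Proof.
case: x y => [x xP] [y yP] /= /funext exy; subst y.
by congr (PadicInt p_pr); exact: Prop_irrelevance.
Qed.

Lemma padic_res_mod x n : (x n %% (p ^ n)%N)%Z = x n.
Proof. by rewrite padic_resP modz_mod. Qed.

Definition coherent f :=
  forall n, (f n.+1 %% (p ^ n)%N)%Z = (f n %% (p ^ n)%N)%Z.

Lemma padic_coherent x : coherent x.
Proof. by move=> n; rewrite -padic_resP padic_res_mod. Qed.

Fact mk_padic_subproof f (fP : coherent f) n :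
  (f n %% (p ^ n)%N)%Z = ((f n.+1 %% (p ^ n.+1)%N)%Z %% (p ^ n)%N)%Z.
Proof. by rewrite expnSr PoszM modz_modMr fP. Qed.

Definition mk_padic f (fP : coherent f) : Zp :=
  PadicInt p_pr (mk_padic_subproof fP).

Fact coherent_cst (a : int) : coherent (fun=> a). Proof. by []. Qed.

Fact coherentD x y : coherent (fun n => x n + y n).
Proof. by move=> n; rewrite -modzDm !padic_coherent modzDm. Qed.

Fact coherentN x : coherent (fun n => - x n).
Proof. by move=> n; rewrite -modzNm padic_coherent modzNm. Qed.

Fact coherentM x y : coherent (fun n => x n * y n).
Proof. by move=> n; rewrite -modzMm !padic_coherent modzMm. Qed.

Definition padic0 := mk_padic (coherent_cst 0).
Definition padic1 := mk_padic (coherent_cst 1).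
Definition padicD x y := mk_padic (coherentD x y).
Definition padicN x := mk_padic (coherentN x).
Definition padicM x y := mk_padic (coherentM x y).

Fact padicDA : associative padicD.
Proof.
by move=> x y z; apply: padicP => n /=; rewrite modzDml modzDmr addrA.
Qed.
Fact padicDC : commutative padicD.
Proof. by move=> x y; apply: padicP => n /=; rewrite addrC. Qed.
Fact padic0D : left_id padic0 padicD.
Proof.
by move=> x; apply: padicP => n /=; rewrite modzDml add0r padic_res_mod.
Qed.
Fact padicND : left_inverse padic0 padicN padicD.
Proof. by move=> x; apply: padicP => n /=; rewrite modzDml addNr. Qed.
Fact padicMA : associative padicM.
Proof.
by move=> x y z; apply: padicP => n /=; rewrite modzMml modzMmr mulrA.
Qed.
Fact padicMC : commutative padicM.
Proof. by move=> x y; apply: padicP => n /=; rewrite mulrC. Qed.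
Fact padic1M : left_id padic1 padicM.
Proof.
by move=> x; apply: padicP => n /=; rewrite modzMml mul1r padic_res_mod.
Qed.
Fact padicMDl : left_distributive padicM padicD.
Proof.
by move=> x y z; apply: padicP => n /=; rewrite modzMml modzDm mulrDl.
Qed.
Fact padic1_neq0 : padic1 != padic0.
Proof.
apply/eqP => /(congr1 (fun x : Zp => x 1%N))/=.
by rewrite expn1 mod0z modz_small// ltz_nat prime_gt1.
Qed.

HB.instance Definition _ := GRing.isZmodule.Build Zp
  padicDA padicDC padic0D padicND.
HB.instance Definition _ := GRing.Zmodule_isComNzRing.Build Zp
  padicMA padicMC padic1M padicMDl padic1_neq0.

Definition padic_unit : {pred Zp} := fun x => `[< exists y, y * x = 1 >].
Definition padic_inv x : Zp :=
  if pselect (exists y, y * x = 1) is left e then sval (cid e) else x.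

Fact padic_mulVr : {in padic_unit, left_inverse 1 padic_inv *%R}.
Proof.
move=> x /asboolP ex; rewrite /padic_inv.
by case: pselect => // e; case: cid.
Qed.

Fact padic_unitPl x y : y * x = 1 -> padic_unit x.
Proof. by move=> yx1; apply/asboolP; exists y. Qed.

Fact padic_inv_out : {in [predC padic_unit], padic_inv =1 id}.
Proof.
by move=> x /asboolP nex; rewrite /padic_inv; case: pselect.
Qed.

HB.instance Definition _ := GRing.ComNzRing_hasMulInverse.Build Zp
  padic_mulVr padic_unitPl padic_inv_out.

Lemma padic_dvdz x m k : ((p ^ m)%N %| x (m + k)%N)%Z = (x m == 0).
Proof.
have -> : x m = (x (m + k)%N %% (p ^ m)%N)%Z.
  elim: k => [|k IHk]; first by rewrite addn0 padic_res_mod.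
  by rewrite IHk addnS (padic_resP x (m + k)) expnD PoszM modz_modMr.
by apply/dvdz_mod0P/eqP.
Qed.

Lemma padic_neq0 x : x != 0 -> exists n, x n != 0.
Proof.
move=> x0; apply: contrapT => nx; case/eqP: x0; apply: padicP => n /=.
by rewrite mod0z; apply/eqP/negPn/negP => xn0; apply: nx; exists n.
Qed.

Fact padic_idomain : GRing.integral_domain_axiom Zp.
Proof.
move=> x y xy0; apply: contrapT => /negP.
rewrite negb_or => /andP[/padic_neq0[m xm] /padic_neq0[n yn]].
have /dvdz_mod0P : (x (m + n)%N * y (m + n)%N %% (p ^ (m + n))%N)%Z = 0.
  by rewrite -[LHS]/((x * y) (m + n)%N) xy0 /= mod0z.
move: xm yn; rewrite -(padic_dvdz x m n) -(padic_dvdz y n m) [(n + m)%N]addnC.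
rewrite !dvdzE abszM !absz_nat; set a := `|x _|%N; set b := `|y _|%N => am bn.
have a0 : (0 < a)%N by case: posnP am => // ->; rewrite dvdn0.
have b0 : (0 < b)%N by case: posnP bn => // ->; rewrite dvdn0.
move: am bn; rewrite !pfactor_dvdn ?muln_gt0 ?a0// lognM// -!ltnNge => am bn.
by rewrite leqNgt -addnS leq_add// ltnW.
Qed.

HB.instance Definition _ :=
  GRing.ComUnitRing_isIntegral.Build Zp padic_idomain.

End PadicInt.

Definition padic (p : nat) (p_pr : prime p) := {fraction padic_int p_pr}.

Lemma padic_res_natr p (p_pr : prime p) a n :
  padic_res (a%:R : padic_int p_pr) n = (a%:Z %% (p ^ n)%N)%Z.
Proof.
elim: a => [|a IHa] //; rewrite mulrS /= IHa.
by rewrite modzDm -PoszD.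
Qed.

(* Hence ratr : rat -> Q_p is the inclusion. *)
Lemma padic_pchar p (p_pr : prime p) : [pchar padic p_pr] =i pred0.
Proof.
apply/pcharf0P => a; rewrite -(rmorph_nat (@FracField.tofrac (padic_int p_pr))).
rewrite tofrac_eq0; apply/eqP/eqP => [a0|->//]; apply/eqP.
have := @padic_res_natr p p_pr a a; rewrite a0 /= mod0z modz_small.
  by move=> a0z; rewrite -eqz_nat -a0z.
by rewrite lez_nat ltz_nat ltn_expl// prime_gt1.
Qed.

Section RingOfIntegers.
Variable F : fieldExtType rat.

Definition integral_closure : {pred F} :=
  fun x => `[< integralOver (intr : int -> F) x >].

Fact integral_closure_subring : subring_closed integral_closure.
Proof.
split=> [|x y /asboolP xI /asboolP yI|x y /asboolP xI /asboolP yI];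
  apply/asboolP.
- exact: integral1.
- exact: integral_sub.
- exact: integral_mul.
Qed.

HB.instance Definition _ :=
  GRing.isSubringClosed.Build F integral_closure integral_closure_subring.

Record ring_of_integers := RingOfIntegers {
  ring_of_integers_val :> F;
  _ : ring_of_integers_val \in integral_closure
}.

HB.instance Definition _ := [isSub for ring_of_integers_val].
HB.instance Definition _ := [Choice of ring_of_integers by <:].
HB.instance Definition _ :=
  [SubChoice_isSubComNzRing of ring_of_integers by <:].

Local Notation OF := ring_of_integers.

(* Tr_{F/Q}(x) is the trace of the Q-linear map y |-> x * y. *)
Definition field_trace (x : F) : rat :=
  \tr (passmx.mxof (vbasis {:F}) (vbasis {:F}) (amull x)).

Definition trace_form (x : OF) : rat := field_trace (val x ^+ 2).

Definition integral_basis n (b : 'I_n -> OF) : Prop :=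
  forall x : OF, exists! c : {ffun 'I_n -> int}, x = \sum_i b i *~ c i.

Definition trace_gram n (b : 'I_n -> OF) : 'M[rat]_n :=
  \matrix_(i, j) field_trace (val (b i) * val (b j)).

(* The default value 0 is never used: an integral basis always exists, and
   the determinant does not depend on its choice. *)
Definition disc : rat :=
  xget 0 [set d | exists (n : nat) (b : 'I_n -> OF),
    integral_basis b /\ d = \det (trace_gram b)]%classic.

End RingOfIntegers.

Definition ideal_power (R : comNzRingType) (P : {pred R}) (e : nat) : set R :=
  [set x | exists (m : nat) (c : 'I_m -> R) (t : 'I_m -> 'I_e -> R),
    (forall i j, t i j \in P) /\ x = \sum_i c i * \prod_j t i j]%classic.

Section Ramification.
Variable F : fieldExtType rat.
Local Notation OF := (ring_of_integers F).

Definition prime_above (p : nat) (P : {pred OF}) : Prop :=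
  [/\ idealr_closed P, prime_idealr_closed P & p%:R \in P].

(* e is the exponent of P in the factorization of p O_F: in a Dedekind domain
   P^e divides p O_F exactly when p is in P^e. *)
Definition ramification_degree (p : nat) (P : {pred OF}) (e : nat) : Prop :=
  ideal_power P e p%:R /\ ~ ideal_power P e.+1 p%:R.

Definition ramifies (p : nat) : Prop :=
  exists P e, [/\ prime_above p P, ramification_degree p P e & (1 < e)%N].

(* The residue fields are finite, so inseparability of the residue extension
   plays no role in wildness. *)
Definition tame : Prop :=
  forall p P e, prime p -> prime_above p P -> ramification_degree p P e ->
    ~~ (p %| e)%N.

Definition totally_ramified : Prop :=
  forall p, prime p -> ramifies p ->
    forall P, prime_above p P -> ramification_degree p P (\dim {:F}).

End Ramification.

Section QuadraticSpace.
Variables (k : fieldType) (n : nat).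
(* The quadratic space k^n of row vectors with Gram matrix B; linear maps act
   on the right. *)
Variable B : 'M[k]_n.

Definition bform (x y : 'rV[k]_n) : k := (x *m B *m y^T) 0 0.

Definition qform (x : 'rV[k]_n) : k := bform x x.

Definition quadratic_space : Prop := B^T = B /\ B \in unitmx.

Definition orthogonal_group (S : 'M[k]_n) : Prop :=
  S \in unitmx /\ forall x y, bform (x *m S) (y *m S) = bform x y.

Definition special_orthogonal_group (S : 'M[k]_n) : Prop :=
  orthogonal_group S /\ \det S = 1.

(* x |-> x - 2 B(x, v) / Q(v) v *)
Definition reflection (v : 'rV[k]_n) : 'M[k]_n :=
  1%:M - (2 / qform v) *: (B *m v^T *m v).

(* a represents the spinor norm of S, which is a class in k^* / (k^* )^2. *)
Definition spinor_norm (S : 'M[k]_n) (a : k) : Prop :=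
  exists (vs : seq 'rV[k]_n) (c : k),
    [/\ all (fun v => qform v != 0) vs, c != 0,
        S = \big[mulmx/1%:M]_(v <- vs) reflection v
      & a = c ^+ 2 * \prod_(v <- vs) qform v].

Definition trivial_spinor_norm (S : 'M[k]_n) : Prop := spinor_norm S 1.

End QuadraticSpace.

Local Open Scope classical_set_scope.

(* A Z-lattice on Q^n is given by the rows of an invertible matrix M. *)
Definition lattice n (M : 'M[rat]_n) : set 'rV[rat]_n :=
  [set map_mx intr c *m M | c in [set: 'rV[int]_n]].

Definition lattice_at (p : nat) (p_pr : prime p) n (M : 'M[rat]_n) :
    set 'rV[padic p_pr]_n :=
  [set map_mx (@FracField.tofrac _) c *m map_mx ratr M
    | c in [set: 'rV[padic_int p_pr]_n]].
Arguments lattice_at {p} p_pr {n} M.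

Definition lattice_same_spinor_genus n (B M N : 'M[rat]_n) : Prop :=
  exists2 s : 'M[rat]_n, orthogonal_group B s &
    forall (p : nat) (p_pr : prime p),
      let Bp : 'M[padic p_pr]_n := map_mx ratr B in
      exists S : 'M[padic p_pr]_n,
        [/\ special_orthogonal_group Bp S, trivial_spinor_norm Bp S
          & lattice_at p_pr N =
            [set x *m S *m map_mx ratr s | x in lattice_at p_pr M]].

(* (G, q) is isometric to the lattice spanned by M in the space (Q^n, B). *)
Definition realizes (G : zmodType) (q : G -> rat) n (B M : 'M[rat]_n) : Prop :=
  exists f : {additive G -> 'rV[rat]_n},
    [/\ injective f, range f = lattice M & forall x, qform B (f x) = q x].

Definition same_spinor_genus (G H : zmodType) (q : G -> rat) (r : H -> rat) :
    Prop :=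
  exists (n : nat) (B M N : 'M[rat]_n),
    [/\ quadratic_space B, M \in unitmx /\ N \in unitmx,
        realizes q B M, realizes r B N & lattice_same_spinor_genus B M N].

(* Main.v *)
Require Import Defs.
From HB Require Import structures.
From mathcomp Require Import all_boot all_order fingroup all_algebra all_field.
From mathcomp Require Import boolp classical_sets.
From mathcomp Require Import polyrcf realalg.
From mathcomp Require Import ring zify.

(** The discriminant is an invariant of the spinor genus: a local isometry between
    the two lattices and the rational isometry have determinant [1] or [-1], so
    that the determinant of a base change is a unit at every prime
    ([same_spinor_genus_disc]).

    Conversely, let the discriminants of [K] and [L] agree.  At a ramified prime
    [p] of a tame totally ramified field of degree [n], the discriminant has
    valuation [n - 1], and a field without ramified primes is the rational one by
    Minkowski; hence the degrees agree ([dim_of_disc]), and so do the ramified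
    primes.  Over [K] the conjugates turn the trace form into a sum of [n] squares.
    As [n] is odd, Springer's theorem makes it a sum of squares over the rationals
    ([trace_form_orthonormal]).  So the two quadratic spaces are isometric, by an
    isometry that identifies the elements [1] of [K] and [L], both of length [n]
    ([matching_isometry]).

    Consider a prime [p] not dividing [n].  Then [1] splits off the trace form, and
    its orthogonal complement is unimodular, or [p] times unimodular if [p]
    ramifies, and even if [p = 2] ([local_gram]).  Rescaling the complement makes
    the two lattices self-dual; they contain the common vector [1], and are even on
    its complement.  Such lattices are carried to each other by reflections in
    vectors orthogonal to [1] ([selfdual_transport], [model_transport]), and these
    are reflections for the trace form as well.  If [p] divides [n], then [p] is
    unramified by tameness, and odd, and the same argument applies to the whole
    lattices.

    It remains to make the spinor norms of the local transports trivial.  The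
    complement of [1] has rank at least two when [n > 1], and represents all units
    after the rescaling ([represents_units]), so that every unit is the spinor norm
    of a local stabilizer ([model_units]).  As the rationals have class number one
    and a sum of at least three squares has reflections of all positive spinor
    norms ([spinor_norm_values]), one rational isometry corrects all primes at once
    ([same_spinor_genus_of_local]).  Determinants are adjusted by [-1], which has
    determinant [-1] and trivial spinor norm because [n] is odd. *)

Set Implicit Arguments.
Unset Strict Implicit.
Unset Printing Implicit Defensive.

Import Order.TTheory GRing.Theory Num.Theory.
Local Open Scope ring_scope.

(** * Reflections and spinor norms over a field *)

Section Reflections.
Variables (k : fieldType) (n : nat) (B : 'M[k]_n).
Hypothesis symB : B^T = B.
Implicit Types (x y v : 'rV[k]_n) (S : 'M[k]_n) (vs : seq 'rV[k]_n).

Lemma bformDl x y v : bform B (x + y) v = bform B x v + bform B y v.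
Proof. by rewrite /bform !mulmxDl mxE. Qed.

Lemma bformZl a x v : bform B (a *: x) v = a * bform B x v.
Proof. by rewrite /bform -!scalemxAl mxE. Qed.

Lemma bformC x y : bform B x y = bform B y x.
Proof.
have -> : bform B x y = (x *m B *m y^T)^T 0 0 by rewrite mxE.
by rewrite !trmx_mul trmxK symB mulmxA.
Qed.

Lemma bformDr x y v : bform B v (x + y) = bform B v x + bform B v y.
Proof. by rewrite !(bformC v) bformDl. Qed.

Lemma bformZr a x v : bform B v (a *: x) = a * bform B v x.
Proof. by rewrite !(bformC v) bformZl. Qed.

Lemma bformNl x v : bform B (- x) v = - bform B x v.
Proof. by rewrite -scaleN1r bformZl mulN1r. Qed.

Lemma bformNr x v : bform B v (- x) = - bform B v x.
Proof. by rewrite !(bformC v) bformNl. Qed.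

Lemma bform0l v : bform B 0 v = 0.
Proof. by rewrite /bform !mul0mx mxE. Qed.

Lemma bform0r v : bform B v 0 = 0.
Proof. by rewrite bformC bform0l. Qed.

Definition bformE := (bformDl, bformDr, bformNl, bformNr, bformZl, bformZr).

Lemma qformD x y : qform B (x + y) = qform B x + 2 * bform B x y + qform B y.
Proof. by rewrite /qform !bformE (bformC y x); ring. Qed.

Lemma reflectionE v x :
  x *m reflection B v = x - (2 * bform B x v / qform B v) *: v.
Proof.
rewrite /reflection mulmxBr mulmx1 -scalemxAr !mulmxA.
rewrite [x *m B *m v^T]mx11_scalar -/(bform B x v) mul_scalar_mx scalerA.
by congr (_ - _ *: _); rewrite mulrAC.
Qed.

Lemma reflection_fix v x : bform B x v = 0 -> x *m reflection B v = x.
Proof. by move=> xv0; rewrite reflectionE xv0 mulr0 mul0r scale0r subr0. Qed.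

Lemma reflection_bform v x y : qform B v != 0 ->
  bform B (x *m reflection B v) (y *m reflection B v) = bform B x y.
Proof.
move=> v0; rewrite !reflectionE !bformE (bformC v y) -/(qform B v).
by field.
Qed.

Lemma reflectionK v : qform B v != 0 ->
  reflection B v *m reflection B v = 1%:M.
Proof.
move=> v0; apply/row_matrixP => i; rewrite !rowE !mulmxA.
rewrite !reflectionE mulmx1; set e := delta_mx _ _.
rewrite !bformE -/(qform B v) -addrA -opprD -scalerDl.
rewrite [X in X *: v](_ : _ = 0) ?scale0r ?subr0//.
by field.
Qed.

Lemma reflection_swap x y : qform B x = qform B y -> qform B (x - y) != 0 ->
  x *m reflection B (x - y) = y.
Proof.
move=> xy v0; rewrite reflectionE.
suff -> : 2 * bform B x (x - y) / qform B (x - y) = 1.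
  by rewrite scale1r opprB addrC subrK.
have e : 2 * bform B x (x - y) = qform B (x - y).
  by move: xy; rewrite /qform !bformE (bformC y x) => xy; ring: xy.
by rewrite e divff.
Qed.

Definition reflections vs : 'M[k]_n := \big[mulmx/1%:M]_(v <- vs) reflection B v.

Lemma reflections_cat vs ws :
  reflections (vs ++ ws) = reflections vs *m reflections ws.
Proof.
rewrite /reflections; elim: vs => [|v vs IH]; first by rewrite big_nil mul1mx.
by rewrite cat_cons !big_cons IH mulmxA.
Qed.

Lemma reflections_bform vs x y : all (fun v => qform B v != 0) vs ->
  bform B (x *m reflections vs) (y *m reflections vs) = bform B x y.
Proof.
elim: vs x y => [|v vs IH] x y /=; first by rewrite /reflections big_nil !mulmx1.
by case/andP=> v0 /IH {}IH; rewrite /reflections big_cons !mulmxA IH reflection_bform.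
Qed.

Lemma reflections_rev vs : all (fun v => qform B v != 0) vs ->
  reflections vs *m reflections (rev vs) = 1%:M.
Proof.
elim: vs => [|v vs IH] /=; first by rewrite /reflections /rev /= big_nil mulmx1.
case/andP=> v0 /IH {}IH; rewrite rev_cons -cats1 reflections_cat.
rewrite {1}/reflections big_cons -/(reflections vs) -mulmxA (mulmxA (reflections vs)).
by rewrite IH mul1mx /reflections big_cons big_nil mulmx1 reflectionK.
Qed.

Lemma orthogonal_reflections vs : all (fun v => qform B v != 0) vs ->
  orthogonal_group B (reflections vs).
Proof.
move=> vs0; split; last by move=> x y; apply: reflections_bform.
exact: (mulmx1_unit (reflections_rev vs0)).1.
Qed.

(** Evaluate the invariance of the form on the standard basis. *)
Lemma orthogonal_gram S : orthogonal_group B S -> S *m B *m S^T = B.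
Proof.
move=> [_ SB]; apply/matrixP => i j.
have E (A : 'M[k]_n) :
    A i j = ((delta_mx 0 i : 'rV[k]_n) *m A *m (delta_mx 0 j : 'rV[k]_n)^T) 0 0.
  by rewrite -rowE trmx_delta -colE !mxE.
have := SB (delta_mx 0 i) (delta_mx 0 j); rewrite /bform -E => <-.
by rewrite E trmx_mul !mulmxA.
Qed.

Lemma orthogonal_det S : B \in unitmx -> orthogonal_group B S ->
  \det S = 1 \/ \det S = -1.
Proof.
move=> Bu /orthogonal_gram /(congr1 determinant); rewrite !det_mulmx det_tr.
rewrite unitmxE in Bu; rewrite mulrAC -[RHS]mul1r => /(mulIr Bu)/eqP.
by rewrite -expr2 sqrf_eq1 => /orP[]/eqP; [left|right].
Qed.

End Reflections.

(** * Quadratic forms over extensions of odd degree *)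

Section SpringerPoly.
Variables (k : fieldType) (N : nat) (B : 'M[k]_N).
Hypothesis anisoB : forall x : 'rV[k]_N, qform B x = 0 -> x = 0.
Implicit Types (f d : {poly k}) (g r s : 'I_N -> {poly k}).

(** The form [B] with values in [k[X]], on vectors of polynomials. *)
Definition poly_qform g : {poly k} := \sum_i \sum_j B i j *: (g i * g j).

Lemma qform_sum (x : 'rV[k]_N) :
  qform B x = \sum_i \sum_j B i j * (x 0 i * x 0 j).
Proof.
rewrite /qform /bform mxE exchange_big; apply: eq_bigr => j _ /=.
rewrite mxE mulr_suml; apply: eq_bigr => i _; rewrite mxE; ring.
Qed.

(** If the entries have degree at most [m], the coefficient in degree [2 m] only
    sees their leading terms. *)
Lemma poly_qform_coef g m : (forall i, (size (g i) <= m.+1)%N) ->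
  (poly_qform g)`_(m + m) = qform B (\row_i (g i)`_m).
Proof.
move=> gm; rewrite qform_sum coef_sum; apply: eq_bigr => i _.
rewrite coef_sum; apply: eq_bigr => j _; rewrite coefZ !mxE; congr (_ * _).
rewrite coefM (bigD1 (inord m)) //= inordK ?ltnS ?leq_addr// addnK.
rewrite big1 ?addr0// => l; rewrite -val_eqE /= inordK ?ltnS ?leq_addr// => lm.
case: (ltngtP l m) lm => // lm _.
  rewrite [X in _ * X]nth_default ?mulr0// (leq_trans (gm j))//; lia.
by rewrite [X in X * _]nth_default ?mul0r// (leq_trans (gm i)).
Qed.

Lemma poly_qform_size g m : (forall i, (size (g i) <= m.+1)%N) ->
  (size (poly_qform g) <= (m + m).+1)%N.
Proof.
move=> gm; apply: (leq_trans (size_sum _ _ _)); apply/bigop.bigmax_leqP => i _.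
apply: (leq_trans (size_sum _ _ _)); apply/bigop.bigmax_leqP => j _.
apply: (leq_trans (size_scale_leq _ _)); apply: (leq_trans (size_polyMleq _ _)).
have := gm i; have := gm j; lia.
Qed.

(** Both factors of [g i * g j] may be reduced one after the other. *)
Lemma poly_qform_mod f g : f %| poly_qform g ->
  f %| poly_qform (fun i => g i %% f).
Proof.
move=> fg; rewrite -(dvdp_subr _ fg) /poly_qform -sumrB.
have fr i : f %| g i - g i %% f.
  by rewrite {1}(divp_eq (g i) f) addrK dvdp_mull.
apply: (big_ind (fun p => f %| p)) => [|p q|i _]; rewrite ?dvdp0//.
  by move=> *; apply: dvdp_add.
rewrite -sumrB.
apply: (big_ind (fun p => f %| p)) => [|p q|j _]; rewrite ?dvdp0//.
  by move=> *; apply: dvdp_add.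
rewrite -scalerBr -mul_polyC dvdp_mull//.
rewrite (_ : _ - _ = (g i - g i %% f) * g j + (g i %% f) * (g j - g j %% f)).
  by apply: dvdp_add; [apply: dvdp_mulr|apply: dvdp_mull]; apply: fr.
by ring.
Qed.

Lemma common_gcdp (rs : seq {poly k}) : exists2 c, all (dvdp c) rs &
  forall d, all (dvdp d) rs -> d %| c.
Proof.
elim: rs => [|r rs [c crs cP]]; first by exists 0 => // d _; rewrite dvdp0.
exists (gcdp r c) => [|d /andP[dr /cP dc]] /=; last by rewrite dvdp_gcd dr.
rewrite dvdp_gcdl; apply: sub_all crs => q; exact: (dvdp_trans (dvdp_gcdr _ _)).
Qed.

(** Reducing [g] modulo [f] and removing its content keeps the hypotheses and
    bounds the degree of [poly_qform g]; as [B] is anisotropic the leading terms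
    cannot cancel and this degree is even, so that the cofactor of [f] has odd
    degree again, now smaller. *)
Lemma springer_poly f g : ~~ odd (size f) -> f != 0 -> f %| poly_qform g ->
  (forall d, d %| f -> (forall i, d %| g i) -> size d = 1%N) -> False.
Proof.
have [m] := ubnP (size f); elim: m f g => // m IH f g fm f_odd f0 fg cop.
pose r i := g i %% f.
have fr : f %| poly_qform r by apply: poly_qform_mod.
have cop_r d : d %| f -> (forall i, d %| r i) -> size d = 1%N.
  move=> df dr; apply: cop => // i; rewrite (divp_eq (g i) f).
  by rewrite dvdp_add ?dr// dvdp_mull.
have [c0 c0r c0P] := common_gcdp [seq r i | i : 'I_N].
have {c0r}cr i : c0 %| r i.
  by move/allP: c0r; apply; apply: map_f; rewrite mem_enum.
have {c0P}cP d : (forall i, d %| r i) -> d %| c0.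
  by move=> dr; apply: c0P; apply/allP => _ /mapP[i _ ->].
have [i0 ri0] : exists i, r i != 0.
  apply: contrapT => nr; have : size f = 1%N.
    apply: cop_r => // i; suff /eqP -> : r i == 0 by rewrite dvdp0.
    by apply/negPn/negP => ri; apply: nr; exists i.
  by move=> f1; rewrite f1 in f_odd.
have c00 : c0 != 0 by apply: contraNneq ri0 => c00; have := cr i0; rewrite c00 dvd0p.
pose s i := r i %/ c0.
have rs i : r i = c0 * s i by rewrite mulrC divpK.
have cfc : coprimep f c0.
  rewrite coprimep_def; apply/eqP/cop_r; first exact: dvdp_gcdl.
  by move=> i; apply: dvdp_trans (cr i); apply: dvdp_gcdr.
have phi_r : poly_qform r = c0 ^+ 2 * poly_qform s.
  rewrite /poly_qform mulr_sumr; apply: eq_bigr => i _.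
  rewrite mulr_sumr; apply: eq_bigr => j _; rewrite !rs -scalerAr; congr (_ *: _).
  by ring.
have fs : f %| poly_qform s.
  by move: fr; rewrite phi_r Gauss_dvdpr // expr2 coprimepMr cfc.
have cop_s d : (forall i, d %| s i) -> size d = 1%N.
  move=> ds; have : c0 * d %| c0.
    by apply: cP => i; rewrite rs dvdp_mul2l.
  rewrite -[X in _ %| X]mulr1 dvdp_mul2l// dvdp1 => /eqP //.
pose M := \big[maxn/0%N]_(i < N) size (s i).
have s0 : s i0 != 0 by apply: contraNneq ri0 => s00; rewrite rs s00 mulr0.
have MsS i : (size (s i) <= M)%N by apply: (@bigop.leq_bigmax _ (fun i => size (s i)) i).
have Mgt0 : (0 < M)%N.
  by apply: leq_trans (MsS i0); rewrite lt0n size_poly_eq0.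
have [i1 Mi1] : exists i, size (s i) = M.
  have [|i iP] := @bigop.eq_bigmax _ (fun i => size (s i)); last by exists i.
  by apply/card_gt0P; exists i0.
have Mf : (M < size f)%N.
  rewrite -Mi1; have si1 : s i1 != 0 by rewrite -size_poly_eq0 Mi1 -lt0n.
  apply: leq_ltn_trans (_ : size (r i1) < _)%N; last by rewrite ltn_modp.
  rewrite rs size_mul// Mi1; have := size_poly_gt0 c0; rewrite c00; clear; lia.
have sizephi : size (poly_qform s) = (M.-1 + M.-1).+1.
  apply/eqP; rewrite eqn_leq poly_qform_size => [/=|i]; last by rewrite prednK.
  rewrite ltnNge; apply/negP => small.
  have q0 : qform B (\row_i (s i)`_M.-1) = 0.
    rewrite -poly_qform_coef; last by move=> i; rewrite prednK.
    by rewrite nth_default.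
  have /rowP/(_ i1) := anisoB q0.
  rewrite !mxE -Mi1 -lead_coefE => /eqP; rewrite lead_coef_eq0 => /eqP si10.
  by move: Mgt0; rewrite -Mi1 si10 size_poly0.
have phi0 : poly_qform s != 0 by rewrite -size_poly_eq0 sizephi.
pose h := poly_qform s %/ f.
have hf : poly_qform s = h * f by rewrite divpK.
have h0 : h != 0 by apply: contraNneq phi0 => h0; rewrite hf h0 mul0r.
have sh : (size h + size f = M + M)%N.
  have := size_mul h0 f0; rewrite -hf sizephi.
  have : (0 < size h)%N by rewrite size_poly_gt0.
  by move: Mgt0; move: (size h) (size f) (M : nat) => a b c; clear; lia.
have fm' : (size h < m)%N by clear -fm Mf sh; lia.
have h_odd : ~~ odd (size h) by rewrite -(addKn (size f) (size h)) addnC sh oddB ?addnn ?odd_double//; clear -sh; lia.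
apply: (IH h s) => //; first by rewrite hf dvdp_mulr.
by move=> d _; apply: cop_s.
Qed.

End SpringerPoly.

(** Primitive elements give polynomial coordinates on [L], of degree less than the
    degree of [L]. *)
Lemma rat_generator (L : fieldExtType rat) :
  exists (t : L) (f : {poly rat}),
    [/\ map_poly (in_alg L) f = minPoly 1 t, size f = (\dim {:L}).+1 &
      forall y, exists2 g : {poly rat}, (map_poly (in_alg L) g).[t] = y &
        (size g <= \dim {:L})%N].
Proof.
have sepL : separable 1%VS {:L}%AS.
  apply/separableP => y _; apply: pcharf0_separable; apply/pcharf0P => m.
  by rewrite -(rmorph_nat (in_alg L)) fmorph_eq0 pnatr_eq0.
have genL := eq_adjoin_separable_generator sepL (sub1v _).
set t := separable_generator _ _ in genL.
have gent (y : L) : y \in <<1; t>>%VS.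
  by rewrite -(congr1 (fun V : {vspace L} => y \in V) genL) memvf.
have degt : adjoin_degree 1%AS t = \dim {:L}.
  by rewrite /adjoin_degree -(congr1 (fun V : {vspace L} => \dim V) genL) dimv1
     divn1 prednK ?adim_gt0.
have [f fE] := polyOver1P (minPolyOver 1%AS t).
exists t, f; split=> // [|y].
  by rewrite -(size_map_poly (in_alg L)) -fE size_minPoly degt.
have [g gE] := polyOver1P (Fadjoin_polyOver 1%AS t y).
exists g; first by rewrite -gE Fadjoin_poly_eq.
by rewrite -(size_map_poly (in_alg L)) -gE -degt size_Fadjoin_poly.
Qed.

(** Springer's theorem: an isotropic vector over [L] is a vector of polynomials in
    a generator of [L] on which the form vanishes modulo its minimal polynomial,
    and [springer_poly] descends on the degree of that modulus. *)
Lemma springer (L : fieldExtType rat) N (B : 'M[rat]_N) : odd (\dim {:L}) ->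
  (forall x : 'rV[rat]_N, qform B x = 0 -> x = 0) ->
  forall x : 'rV[L]_N, qform (map_mx (in_alg L) B) x = 0 -> x = 0.
Proof.
move=> oddL anisoB x qx0; apply/eqP/negPn/negP => x0.
have [t [f [fE sf gP]]] := rat_generator L.
have f0 : f != 0 by rewrite -size_poly_eq0 sf.
have G i : exists g : {poly rat}, (map_poly (in_alg L) g).[t] = x 0 i /\
    (size g <= \dim {:L})%N by have [g ? ?] := gP (x 0 i); exists g.
have [g gE] := choice G.
apply: (@springer_poly _ _ B anisoB f g) => //.
- by rewrite sf /= oddL.
- rewrite -(dvdp_map (in_alg L)) fE; apply: minPoly_dvdp.
    by apply/polyOver1P; exists (poly_qform B g).
  apply/rootP; rewrite -[RHS]qx0 qform_sum /poly_qform rmorph_sum horner_sum.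
  apply: eq_bigr => i _; rewrite rmorph_sum horner_sum; apply: eq_bigr => j _ /=.
  by rewrite linearZ /= hornerZ rmorphM hornerM !(gE _).1 !mxE mulr_algl.
- move=> d df dg; have : map_poly (in_alg L) d %| minPoly 1 t by rewrite -fE dvdp_map.
  case/minPoly_irr/orP; first by apply/polyOver1P; exists d.
  + rewrite -fE eqp_map => /eqp_size; rewrite sf => sd; case/eqP: x0.
    apply/rowP => i; rewrite mxE -(gE i).1; suff -> : g i = 0 by rewrite rmorph0 horner0.
    apply/eqP/negPn/negP => gi0; have := dvdp_leq gi0 (dg i).
    by rewrite sd leqNgt ltnS (gE i).2.
  + by rewrite -size_poly_eq1 size_map_poly => /eqP.
Qed.

(** * Traces, Galois conjugates and integral bases *)

(** The integers of [rat] are known through algebraic integers in [algC]. *)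
Lemma int_of_integral (F : fieldExtType rat) (a : rat) :
  a%:A \in @integral_closure F -> exists m : int, a = m%:~R.
Proof.
move=> /asboolP[p p_mon rt].
have rta : root (map_poly intr p) a.
  rewrite -(fmorph_root (in_alg F)) -map_poly_comp.
  rewrite (eq_map_poly (g := intr)) // => c /=.
  exact: (rmorph_int (in_alg F)).
have : (ratr a : algC) \in Num.int.
  apply: Cint_rat_Aint; first exact: Crat_rat.
  apply: (@root_monic_Aint (map_poly intr p)).
  - have -> : map_poly intr p = map_poly (ratr : rat -> algC) (map_poly intr p).
      rewrite -map_poly_comp; apply: eq_map_poly => c /=; by rewrite rmorph_int.
    by rewrite fmorph_root.
  - exact: monic_map.
  - by apply/polyOverP => i; rewrite coef_map /= intr_int.
case/intrP => m am; exists m; apply: (fmorph_inj (ratr : {rmorphism rat -> algC})).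
by rewrite /= am rmorph_int.
Qed.

(** Such relations make [x] an eigenvalue of an integer matrix, hence a root of
    its monic characteristic polynomial. *)
Lemma integral_of_int_mx (F : fieldExtType rat) m (x : F) (l : 'I_m -> F)
    (A : 'M[int]_m) (i0 : 'I_m) : l i0 != 0 ->
  (forall i, x * l i = \sum_j (A i j)%:~R * l j) -> x \in @integral_closure F.
Proof.
move=> li0 xl; apply/asboolP; exists (char_poly A^T); first exact: char_poly_monic.
have -> : map_poly intr (char_poly A^T) = char_poly (map_mx (intr : int -> F) A^T).
  exact: (map_char_poly (intr : {rmorphism int -> F})).
rewrite -eigenvalue_root_char; apply/eigenvalueP; exists (\row_i l i).
  apply/rowP => i; rewrite !mxE xl; apply: eq_bigr => j _.
  by rewrite !mxE mulrC.
by apply: contraNneq li0 => /rowP/(_ i0); rewrite !mxE => ->.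
Qed.

Section GaloisTrace.
Variables (K : splittingFieldType rat) (galK : galois 1 {:K}).
Local Notation n := (\dim {:K}).
Local Notation T := (gal_of {:K}).
Local Notation OK := (@integral_closure K).
Implicit Types (x y z : K) (a : rat).

Lemma card_gal : #|(T : predArgType)| = n.
Proof.
have := galois_dim galK; rewrite dimv1 divn1 => ->.
apply: eq_card => s; rewrite inE; apply/esym.
by rewrite gal_kHom ?sub1v// k1AHom ?gal_AEnd.
Qed.

(** A numbering of the Galois group, so that conjugates can index matrices. *)
Definition sg (i : 'I_n) : T := enum_val (cast_ord (esym card_gal) i).
Definition sg_index (s : T) : 'I_n := cast_ord card_gal (enum_rank s).

Lemma sg_indexK : cancel sg_index sg.
Proof. by move=> s; rewrite /sg /sg_index cast_ordK enum_rankK. Qed.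

Lemma sgK : cancel sg sg_index.
Proof. by move=> s; rewrite /sg /sg_index enum_valK cast_ordKV. Qed.

Lemma sum_sg (f : T -> K) : \sum_s f s = \sum_i f (sg i).
Proof.
by rewrite (reindex sg) //; exists sg_index => s _; rewrite ?sgK ?sg_indexK.
Qed.

Lemma gal_scale (s : T) (a : rat) x : s (a *: x) = a *: s x.
Proof. exact: linearZ. Qed.

Definition rat_free m (b : 'I_m -> K) := forall c : 'I_m -> rat,
  \sum_i c i *: b i = 0 -> forall i, c i = 0.

Lemma rat_free_span (b : 'I_n -> K) x : rat_free b ->
  exists c : 'I_n -> rat, x = \sum_i c i *: b i.
Proof.
move=> fb; pose X := [tuple b i | i < n].
have Xi (i : 'I_n) : X`_i = b i by rewrite -tnth_nth tnth_mktuple.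
have frX : free X.
  apply/freeP => c c0; apply: fb; rewrite -[RHS]c0.
  by apply: eq_bigr => i _; rewrite Xi.
have bX : basis_of {:K} X by rewrite basisEfree frX subvf size_tuple leqnn.
exists (fun i => coord X i x); rewrite {1}(coord_basis bX (memvf x)).
by apply: eq_bigr => i _; rewrite Xi.
Qed.

Definition conj_mx (b : 'I_n -> K) : 'M[K]_n := \matrix_(i, j) sg j (b i).

(** Distinct automorphisms are linearly independent. *)
Lemma conj_mx_unit b : rat_free b -> conj_mx b \in unitmx.
Proof.
move=> fb; rewrite -unitmx_tr unitmxE unitfE; apply/negP => /det0P[w w0 wC].
case/eqP: w0; apply/rowP => j; rewrite mxE.
have := @gal_independent _ _ {:K}%AS predT (fun s => w 0 (sg_index s)).
move=> /(_ _ (sg j) isT); rewrite sgK; apply => x _.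
have [c ->] := rat_free_span x fb.
rewrite (sum_sg (fun s => w 0 (sg_index s) * s _)).
under eq_bigr do rewrite linear_sum mulr_sumr.
rewrite exchange_big big1// => i _ /=.
have /rowP/(_ i) := wC; rewrite !mxE => wi.
rewrite -[RHS](scaler0 _ (c i)) -[in RHS]wi scaler_sumr; apply: eq_bigr => l _.
by rewrite !mxE gal_scale sgK scalerAr.
Qed.

(** The matrix of conjugates diagonalizes multiplication by [x]. *)
Lemma field_traceE x : (field_trace x)%:A = \sum_(s : T) s x.
Proof.
pose X := vbasis {:K}; pose b (i : 'I_n) : K := X`_i.
pose A := passmx.mxof X X (amull x).
have bX : basis_of {:K} X by apply: vbasisP.
have xb i : x * b i = \sum_j A i j *: b j.
  have := passmx.hom_vecof X bX (amull x) (delta_mx 0 i).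
  rewrite passmx.vecof_delta lfunE /= => ->; rewrite -rowE /passmx.vecof.
  by apply: eq_bigr => j _; rewrite !mxE.
have /freeP fX := basis_free bX.
have fb : rat_free b by move=> c c0 i; apply: fX.
have Cu := conj_mx_unit fb; set C := conj_mx b in Cu.
pose D := diag_mx (\row_j sg j x).
have CD : C *m D = map_mx (in_alg K) A *m C.
  apply/matrixP => i j; rewrite mul_mx_diag !mxE mulrC.
  have -> : sg j x * sg j (b i) = sg j (x * b i) by rewrite rmorphM.
  rewrite xb linear_sum.
  by apply: eq_bigr => l _ /=; rewrite linearZ !mxE mulr_algl.
rewrite /field_trace -/A -[LHS]/(in_alg K (\tr A)) -trace_map_mx.
have -> : map_mx (in_alg K) A = C *m D *m invmx C by rewrite CD mulmxK.
rewrite mxtrace_mulC mulmxA mulVmx// mul1mx mxtrace_diag sum_sg.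
by apply: eq_bigr => i _; rewrite mxE.
Qed.

Lemma alg_inj : injective (fun a : rat => a%:A : K).
Proof. exact: (fmorph_inj (in_alg K)). Qed.

Lemma field_traceD x y : field_trace (x + y) = field_trace x + field_trace y.
Proof.
apply: alg_inj; rewrite /= scalerDl !field_traceE -big_split /=.
by apply: eq_bigr => s _; rewrite rmorphD.
Qed.

Lemma field_traceZ a x : field_trace (a *: x) = a * field_trace x.
Proof.
apply: alg_inj; rewrite /= -scalerA !field_traceE scaler_sumr.
by apply: eq_bigr => s _; rewrite gal_scale.
Qed.

Lemma field_trace0 : field_trace (0 : K) = 0.
Proof. by rewrite -(scale0r 0) field_traceZ mul0r. Qed.

Lemma field_trace_sum I (r : seq I) P (f : I -> K) :
  field_trace (\sum_(i <- r | P i) f i) = \sum_(i <- r | P i) field_trace (f i).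
Proof. exact: (big_morph _ field_traceD field_trace0). Qed.

Lemma field_trace1 : field_trace (1 : K) = n%:R.
Proof.
apply: alg_inj; rewrite /= field_traceE; under eq_bigr do rewrite rmorph1.
by rewrite sumr_const card_gal scaler_nat.
Qed.

Lemma gal_integral (s : T) x : x \in OK -> s x \in OK.
Proof.
move=> /asboolP[p pm rt]; apply/asboolP; exists p => //.
have -> : map_poly intr p = map_poly s (map_poly (intr : int -> K) p).
  by rewrite -map_poly_comp; apply: eq_map_poly => c /=; rewrite rmorph_int.
by rewrite fmorph_root.
Qed.

Lemma trace_int x : x \in OK -> exists m : int, field_trace x = m%:~R.
Proof.
move=> xO; apply: (@int_of_integral K); rewrite field_traceE.
by apply: rpred_sum => s _; apply: gal_integral.
Qed.

End GaloisTrace.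

(** Compare two triangular factorizations of one block matrix. *)
Lemma det_add_rank_one (R : comNzRingType) m (u : 'cV[R]_m) (v : 'rV[R]_m) :
  \det (1%:M + u *m v) = 1 + (v *m u) 0 0.
Proof.
have e1 : block_mx (1%:M : 'M[R]_1) 0 u 1%:M *m block_mx 1%:M (- v) 0 (1%:M + u *m v)
        = block_mx 1%:M (- v) u 1%:M.
  rewrite mulmx_block !mul1mx !mulmx1 !mul0mx !addr0 mulmxN.
  by rewrite [- _ + _]addrC addrK.
have e2 : block_mx (1%:M : 'M[R]_1) (- v) 0 1%:M *m block_mx (1%:M + v *m u) 0 u 1%:M
        = block_mx 1%:M (- v) u 1%:M.
  rewrite mulmx_block !mul1mx !mulmx1 !mul0mx !add0r mulNmx.
  by rewrite addrK.
have := congr1 determinant (etrans e1 (esym e2)).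
rewrite !det_mulmx !det_lblock !det_ublock !det1 !mul1r !mulr1 => ->.
by rewrite det_mx11 !mxE.
Qed.

Lemma common_denominator (I : finType) (c : I -> rat) :
  exists2 D : int, 0 < D & forall i, exists m : int, D%:~R * c i = m%:~R.
Proof.
exists (\prod_i denq (c i)) => [|i]; first by apply: prodr_gt0 => i _.
exists (numq (c i) * \prod_(j | j != i) denq (c j)).
rewrite (bigD1 i) //= !rmorphM /= -{2}(divq_num_den (c i)).
by field; rewrite intr_eq0 denq_neq0.
Qed.

Section IntegralBasis.
Variables (K : splittingFieldType rat) (galK : galois 1 {:K}).
Local Notation n := (\dim {:K}).
Local Notation OF := (ring_of_integers K).
Local Notation OK := (@integral_closure K).
Implicit Types (x y : OF).

Lemma OF_integral x : val x \in OK. Proof. exact: valP. Qed.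

Lemma OF_sumE (I : finType) (b : I -> OF) (c : I -> int) :
  val (\sum_i b i *~ c i) = \sum_i (c i)%:~R * val (b i).
Proof.
rewrite raddf_sum; apply: eq_bigr => i _.
by rewrite raddfMz -mulrzl.
Qed.

Lemma ratz_alg (m : int) : (m%:~R : rat)%:A = m%:~R :> K.
Proof. by rewrite -(rmorph_int (in_alg K)). Qed.

(** Clear the denominators of the matrix of multiplication by [z]. *)
Lemma integral_denominator (z : K) :
  exists2 D : int, D != 0 & D%:~R * z \in OK.
Proof.
pose X := vbasis {:K}; pose A := passmx.mxof X X (amull z).
have [D D0 DA] := common_denominator (fun ij : 'I_n * 'I_n => A ij.1 ij.2).
have [Z ZE] := choice DA.
exists D; first by rewrite gt_eqF.
have n0 : (0 < n)%N by rewrite adim_gt0.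
apply: (@integral_of_int_mx _ _ _ (fun i : 'I_n => X`_i)
  (\matrix_(i, j) Z (i, j)) (Ordinal n0)).
  have: basis_of {:K} X by apply: vbasisP.
  by move/basis_not0 => X0; apply: X0; rewrite mem_nth // size_tuple.
move=> i; rewrite -mulrA.
have -> : z * X`_i = \sum_j A i j *: X`_j.
  have := passmx.hom_vecof X (vbasisP _) (amull z) (delta_mx 0 i).
  rewrite passmx.vecof_delta lfunE /= => ->; rewrite -rowE /passmx.vecof.
  by apply: eq_bigr => j _; rewrite !mxE.
rewrite mulr_sumr; apply: eq_bigr => j _; rewrite mxE -[(Z _)%:~R]ratz_alg -(ZE (i, j)) /=.
by rewrite -[D%:~R]ratz_alg !mulr_algl scalerA.
Qed.

Lemma trace_gram_int m (b : 'I_m -> OF) :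
  exists A : 'M[int]_m, trace_gram b = map_mx intr A.
Proof.
have H (ij : 'I_m * 'I_m) :
    exists z : int, field_trace (val (b ij.1) * val (b ij.2)) = z%:~R.
  by apply: (trace_int galK); rewrite rpredM ?OF_integral.
have [Z ZE] := choice H; exists (\matrix_(i, j) Z (i, j)).
by apply/matrixP => i j; rewrite !mxE -ZE.
Qed.

Lemma trace_gram_sym m (b : 'I_m -> OF) : (trace_gram b)^T = trace_gram b.
Proof. by apply/matrixP => i j; rewrite !mxE mulrC. Qed.

Lemma trace_gram_change m (b b' : 'I_m -> OF) (W : 'M[rat]_m) :
  (forall i, val (b' i) = \sum_j W i j *: val (b j)) ->
  trace_gram b' = W *m trace_gram b *m W^T.
Proof.
move=> bW; apply/matrixP => i j; rewrite !mxE !bW mulr_suml (field_trace_sum galK).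
under eq_bigr => l _ do rewrite mulr_sumr (field_trace_sum galK).
rewrite exchange_big; apply: eq_bigr => l _ /=; rewrite !mxE mulr_suml.
apply: eq_bigr => k _; rewrite !mxE -scalerAl -scalerAr !(field_traceZ galK).
by rewrite [RHS]mulrAC mulrA.
Qed.

Lemma bform_trace_gram m (b : 'I_m -> OF) (c d : 'rV[rat]_m) :
  bform (trace_gram b) c d =
  field_trace ((\sum_i c 0 i *: val (b i)) * (\sum_i d 0 i *: val (b i))).
Proof.
rewrite mulr_suml (field_trace_sum galK) /bform mxE.
under [RHS]eq_bigr => l _ do rewrite mulr_sumr (field_trace_sum galK).
rewrite [RHS]exchange_big; apply: eq_bigr => l _ /=; rewrite !mxE mulr_suml.
apply: eq_bigr => k _; rewrite !mxE -scalerAl -scalerAr !(field_traceZ galK).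
by ring.
Qed.

Lemma trace_gram_unit_free m (b : 'I_m -> OF) :
  \det (trace_gram b) != 0 -> rat_free (fun i => val (b i)).
Proof.
move=> d0 c cb i.
have u : trace_gram b \in unitmx by rewrite unitmxE unitfE.
suff /rowP/(_ i) : (\row_j c j) = 0 by rewrite !mxE.
apply: (can_inj (mulmxK u)); rewrite mul0mx; apply/rowP => j; rewrite !mxE.
transitivity (field_trace ((\sum_i c i *: val (b i)) * val (b j))); last first.
  by rewrite cb mul0r (field_trace0 galK).
rewrite mulr_suml (field_trace_sum galK); apply: eq_bigr => l _.
by rewrite !mxE -scalerAl (field_traceZ galK).
Qed.

(** Over [K] the trace form is the standard form of rank [n] in the conjugates. *)
Lemma trace_gram_conj (b : 'I_n -> OF) :
  map_mx (in_alg K) (trace_gram b) =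
  conj_mx galK (fun i => val (b i)) *m (conj_mx galK (fun i => val (b i)))^T.
Proof.
apply/matrixP => i j; rewrite !mxE /= (field_traceE galK) (sum_sg galK).
by apply: eq_bigr => l _; rewrite !mxE rmorphM.
Qed.

Lemma trace_gram_unit (b : 'I_n -> OF) :
  rat_free (fun i => val (b i)) -> \det (trace_gram b) != 0.
Proof.
move=> /(conj_mx_unit galK) u; rewrite -(fmorph_eq0 (in_alg K)) -det_map_mx.
rewrite trace_gram_conj det_mulmx det_tr mulf_neq0// -unitfE -unitmxE//.
Qed.

Lemma integral_basis_free m (b : 'I_m -> OF) :
  integral_basis b -> rat_free (fun i => val (b i)).
Proof.
move=> bP c cb i; have [D D0 DA] := common_denominator c.
have [Z ZE] := choice DA.
have [e [_ euniq]] := bP 0.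
have e0 : e = [ffun _ => 0].
  by apply: euniq; rewrite big1// => j _; rewrite ffunE.
have eZ : e = [ffun j => Z j].
  apply: euniq; apply: val_inj; rewrite OF_sumE.
  under eq_bigr => j _ do rewrite ffunE -ratz_alg -ZE mulr_algl -scalerA.
  by rewrite -scaler_sumr cb scaler0.
have : D%:~R * c i = 0.
  by rewrite ZE; move/ffunP/(_ i): (etrans (esym e0) eZ); rewrite !ffunE => <-.
by move/eqP; rewrite mulf_eq0 intr_eq0 gt_eqF//= => /eqP.
Qed.

(** Every element has an integral multiple, so that an integral basis also spans
    the field. *)
Lemma integral_basis_size m (b : 'I_m -> OF) : integral_basis b -> m = n.
Proof.
move=> bP; have fb := integral_basis_free bP.
pose X := [tuple val (b i) | i < m].
have Xi (i : 'I_m) : X`_i = val (b i) by rewrite -tnth_nth tnth_mktuple.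
have frX : free X.
  apply/freeP => c c0; apply: fb; rewrite -[RHS]c0.
  by apply: eq_bigr => i _; rewrite Xi.
have bX : basis_of {:K} X.
  rewrite basisEdim; apply/andP; split; last first.
    by move: frX; rewrite /free => /eqP <-; rewrite dimvS ?subvf.
  apply/subvP => z _; have [D D0 zO] := integral_denominator z.
  have [c [cz _]] := bP (RingOfIntegers zO).
  have /(congr1 (fun t : K => D%:~R^-1 *: t)) := congr1 val cz.
  rewrite OF_sumE /= -ratz_alg mulr_algl scalerA mulVf ?intr_eq0// scale1r => ->.
  apply: memvZ; apply: memv_suml => i _; rewrite -ratz_alg mulr_algl.
  by apply: memvZ; rewrite memv_span// -Xi mem_nth// size_tuple.
by rewrite -(size_basis bX).
Qed.

(** The base change matrices are integral and inverse to each other, hence have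
    determinant [1] or [-1]. *)
Lemma integral_basis_change m (b b' : 'I_m -> OF) :
  integral_basis b -> integral_basis b' ->
  \det (trace_gram b') = \det (trace_gram b).
Proof.
move=> bP b'P.
have ch (e e' : 'I_m -> OF) : integral_basis e ->
    exists W : 'M[int]_m, forall i, e' i = \sum_j e j *~ W i j.
  move=> eP; have H i : exists c : {ffun 'I_m -> int}, e' i = \sum_j e j *~ c j.
    by have [c [-> _]] := eP (e' i); exists c.
  have [c cP] := choice H; exists (\matrix_(i, j) c i j) => i.
  by rewrite {1}cP; apply: eq_bigr => j _; rewrite mxE.
have [W WP] := ch b b' bP; have [V VP] := ch b' b b'P.
have VW : V *m W = 1%:M.
  apply/matrixP => i j; have [c [_ cu]] := bP (b i).
  rewrite !mxE -[LHS](ffunE (fun j => \sum_k V i k * W k j)).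
  rewrite -[RHS](ffunE (fun j => (i == j)%:R)).
  congr ((_ : {ffun _ -> _}) j); rewrite -(cu [ffun j => (i == j)%:R]).
    apply/esym/cu; rewrite {1}VP.
    under eq_bigr => k _ do rewrite WP mulrz_suml.
    rewrite exchange_big; apply: eq_bigr => k _ /=; rewrite ffunE.
    by rewrite mulrz_sumr; apply: eq_bigr => l _; rewrite -mulrzA mulrC.
  rewrite (bigD1 i) //= big1 ?addr0 ?ffunE ?eqxx// => k ki.
  by rewrite ffunE eq_sym (negPf ki).
have dW : (\det W) ^+ 2 = 1.
  have := congr1 determinant VW; rewrite det_mulmx det1 => dd.
  have : \det W \is a GRing.unit by apply/unitrP; exists (\det V); rewrite dd mulrC dd.
  by rewrite qualifE /= => /orP[]/eqP ->.
rewrite (@trace_gram_change _ b b' (map_mx intr W)); last first.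
  move=> i; rewrite WP OF_sumE; apply: eq_bigr => j _.
  by rewrite mxE -ratz_alg mulr_algl.
rewrite !det_mulmx det_tr mulrAC det_map_mx -expr2 -rmorphXn dW.
by rewrite mul1r.
Qed.

Lemma discE m (b : 'I_m -> OF) : integral_basis b -> disc K = \det (trace_gram b).
Proof.
move=> bP; rewrite /disc; case: xgetP => [d _ [m' [b' [b'P ->]]]|/(_ (\det (trace_gram b)))].
  have mn := integral_basis_size bP; have m'n := integral_basis_size b'P.
  have e : m = m' by rewrite mn m'n.
  by clear mn m'n; subst m'; apply: (integral_basis_change bP b'P).
by case; exists m, b.
Qed.

(** A family of [n] independent integers whose discriminant has minimal
    absolute value is an integral basis: replacing a basis vector by an
    integer with a non-integral coordinate there multiplies the discriminant
    by the square of the fractional part of that coordinate. *)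
Lemma integral_basis_exists : exists b : 'I_n -> OF, integral_basis b.
Proof.
pose P := [pred d : nat | `[< exists b : 'I_n -> OF,
  \det (trace_gram b) != 0 /\ `|\det (trace_gram b)| = d%:R >]].
have detN (b : 'I_n -> OF) : exists d : nat, `|\det (trace_gram b)| = d%:R.
  have [A ->] := trace_gram_int b; exists `|\det A|%N.
  by rewrite det_map_mx /= -intr_norm -abszE.
have exP : exists d, P d.
  have H i : exists D : int, D != 0 /\ D%:~R * (vbasis {:K})`_i \in OK.
    by have [D] := integral_denominator (vbasis {:K})`_i; exists D.
  have [D DP] := choice H.
  pose b (i : 'I_n) := RingOfIntegers (DP i).2.
  have [d dE] := detN b; exists d; apply/asboolP; exists b; split => //.
  apply: trace_gram_unit => c cb i.
  have /freeP fX := basis_free (vbasisP {:K}).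
  have /eqP : c i * (D i)%:~R = 0.
    apply: (fX (fun i => c i * (D i)%:~R)); rewrite -[RHS]cb; apply: eq_bigr => j _ /=.
    by rewrite -scalerA -[in RHS]ratz_alg mulr_algl.
  by rewrite mulf_eq0 intr_eq0 (negPf (DP i).1) orbF => /eqP.
case: (ex_minnP exP) => d /asboolP[b [b0 bd]] dmin; exists b => x.
have fb := trace_gram_unit_free b0.
have [c cx] := rat_free_span (val x) fb.
have cint i : exists m : int, c i = m%:~R.
  exists (Num.floor (c i)); apply/eqP; rewrite -subr_eq0; apply/negPn/negP => f0.
  set m := Num.floor (c i) in f0; set f := c i - m%:~R in f0.
  have fge : 0 <= f by rewrite subr_ge0 floor_le.
  have f1 : f < 1 by rewrite ltrBlDl -[X in _ < _ + X]/(1%:~R) -intrD floorD1_gt.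
  pose b' j := if j == i then x - b i *~ m else b j.
  pose e : 'cV[rat]_n := delta_mx i 0.
  pose v : 'rV[rat]_n := \row_j c j - m%:~R *: delta_mx 0 i - delta_mx 0 i.
  pose W : 'M[rat]_n := 1%:M + e *m v.
  have bW j : val (b' j) = \sum_k W j k *: val (b k).
    have WE k : W j k = (j == k)%:R + (j == i)%:R * v 0 k.
      by rewrite !mxE big_ord1 !mxE eqxx andbT.
    under eq_bigr => k _ do rewrite WE scalerDl -scalerA.
    rewrite big_split -scaler_sumr /=.
    rewrite [X in X + _](_ : _ = val (b j)); last first.
      rewrite (bigD1 j) //= eqxx scale1r big1 ?addr0// => k kj.
      by rewrite eq_sym (negPf kj) scale0r.
    rewrite /b'; case: eqP => [->|_]; last by rewrite scale0r addr0.
    rewrite scale1r.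
    have -> : \sum_k v 0 k *: val (b k) = val x - m%:~R *: val (b i) - val (b i).
      rewrite cx; under eq_bigr => k _ do rewrite !mxE !eqxx andTb !scalerDl !scaleNr -scalerA.
      rewrite !big_split /= !sumrN; congr (_ - _ - _).
        rewrite (bigD1 i) //= eqxx scale1r big1 ?addr0// => k ki.
        by rewrite (negPf ki) scale0r scaler0.
      rewrite (bigD1 i) //= eqxx scale1r big1 ?addr0// => k ki.
      by rewrite (negPf ki) scale0r.
    rewrite [RHS]addrC subrK -[LHS]/(val (x - b i *~ m)) raddfB; congr (_ - _);
     by rewrite raddfMz /= -mulrzl -ratz_alg mulr_algl.
  have dW : \det W = f.
    rewrite det_add_rank_one -colE !mxE !eqxx mulr1 /f /=.
    exact: (etrans (addrC _ _) (subrK _ _)).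
  have db' : \det (trace_gram b') = f ^+ 2 * \det (trace_gram b).
    by rewrite (trace_gram_change bW) !det_mulmx det_tr dW; ring.
  have [d' d'E] := detN b'.
  have : P d'.
    by apply/asboolP; exists b'; split=> //; rewrite db' mulf_neq0 ?expf_neq0.
  move/dmin; rewrite -(ler_nat rat) -d'E -bd db' normrM leNgt => /negP; apply.
  rewrite gtr_pMl ?normr_gt0// normrX ger0_norm// expr_lt1//.
have [Z ZE] := choice cint.
exists [ffun i => Z i]; split.
  apply: val_inj; rewrite /= OF_sumE cx; apply: eq_bigr => i _.
  by rewrite ffunE ZE -ratz_alg mulr_algl.
move=> c' xc'; apply/ffunP => i; rewrite ffunE.
have /eqP : (Z i)%:~R - (c' i)%:~R = 0 :> rat.
  apply: (fb (fun i => (Z i)%:~R - (c' i)%:~R)).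
  under eq_bigr => j _ do rewrite scalerBl.
  rewrite sumrB; apply/eqP; rewrite subr_eq0; apply/eqP.
  transitivity (val x); first by rewrite cx; apply: eq_bigr => j _; rewrite ZE.
  rewrite xc' OF_sumE; apply: eq_bigr => j _.
  by rewrite -ratz_alg mulr_algl.
by rewrite subr_eq0 eqr_int => /eqP.
Qed.

End IntegralBasis.

(** * The trace form is rationally a sum of squares *)

Lemma qform_block (k : fieldType) m (A : 'M[k]_m) (c : k) (x : 'rV[k]_m) (t : 'rV[k]_1) :
  qform (block_mx A 0 0 c%:M) (row_mx x t) = qform A x + c * t 0 0 ^+ 2.
Proof.
rewrite /qform /bform mul_row_block tr_row_mx mul_row_col !mulmx0 addr0 add0r.
by rewrite mul_mx_scalar -scalemxAl !mxE big_ord1 !mxE.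
Qed.

Lemma qform_map (k k' : fieldType) (f : {rmorphism k -> k'}) m (A : 'M[k]_m) x :
  qform (map_mx f A) (map_mx f x) = f (qform A x).
Proof. by rewrite /qform /bform matrix.map_trmx -!map_mxM mxE. Qed.

Lemma bform_map (k k' : fieldType) (f : {rmorphism k -> k'}) m (A : 'M[k]_m) x y :
  bform (map_mx f A) (map_mx f x) (map_mx f y) = f (bform A x y).
Proof. by rewrite /bform matrix.map_trmx -!map_mxM mxE. Qed.

Lemma bform_mx (k : fieldType) m (X B : 'M[k]_m) i j :
  (X *m B *m X^T) i j = bform B (row i X) (row j X).
Proof.
rewrite /bform -row_mul !mxE; apply: eq_bigr => l _; by rewrite !mxE.
Qed.

Lemma qform_pullback (k : fieldType) r m (W : 'M[k]_(r, m)) B x :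
  qform (W *m B *m W^T) x = qform B (x *m W).
Proof. by rewrite /qform /bform trmx_mul !mulmxA. Qed.

Lemma qform1_sum (k : fieldType) m (x : 'rV[k]_m) :
  qform 1%:M x = \sum_i x 0 i ^+ 2.
Proof.
by rewrite /qform /bform mulmx1 mxE; apply: eq_bigr => i _; rewrite mxE expr2.
Qed.

(** Rational squares are nonnegative. *)
Lemma qform1_rat_aniso m (x : 'rV[rat]_m) : qform 1%:M x = 0 -> x = 0.
Proof.
rewrite qform1_sum => /eqP; rewrite psumr_eq0 => [/allP x0|i _]; last exact: sqr_ge0.
apply/rowP => i; rewrite mxE; apply/eqP.
by have := x0 i (mem_index_enum i); rewrite sqrf_eq0.
Qed.

(** The orthonormal basis [X] over [L] is made rational one row at a time:
    Springer's theorem for the form [B] on the orthogonal complement of the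
    rational rows, plus a summand [-1], yields a rational unit vector there, and
    a reflection moves the next row to it. *)
Lemma orthonormal_descent (L : fieldExtType rat) m (B : 'M[rat]_m) (X : 'M[L]_m) :
  odd (\dim {:L}) -> B^T = B -> X *m map_mx (in_alg L) B *m X^T = 1%:M ->
  exists Y : 'M[rat]_m, Y *m B *m Y^T = 1%:M.
Proof.
move=> oddL symB XB; set f := in_alg L; set BL := map_mx f B in XB *.
have symBL : BL^T = BL by rewrite /BL matrix.map_trmx symB.
have Xu : X \in unitmx.
  by have := mulmx1_unit (etrans (mulmxA _ _ _) XB) => -[].
have aniso1 (x : 'rV[L]_m) : qform 1%:M x = 0 -> x = 0.
  rewrite -(map_mx1 f); apply: springer => //; exact: qform1_rat_aniso.
have anisoL (x : 'rV[L]_m) : qform BL x = 0 -> x = 0.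
  move=> qx; suff : x *m invmx X = 0.
    by move=> /(congr1 (mulmx^~ X)); rewrite mulmxKV// mul0mx.
  apply: aniso1; rewrite -XB -[RHS]qx /qform /bform trmx_mul !mulmxA mulmxKV//.
  by rewrite -(mulmxA _ X^T) -trmx_mul mulVmx// trmx1 mulmx1.
have anisoB (x : 'rV[rat]_m) : qform B x = 0 -> x = 0.
  move=> qx; apply: (@map_mx_inj _ _ f); rewrite map_mx0; apply: anisoL.
  by rewrite qform_map qx rmorph0.
suff P r : (r <= m)%N -> exists (X' : 'M[L]_m) (E : 'M[rat]_m),
    X' *m BL *m X'^T = 1%:M /\ forall i : 'I_m, (i < r)%N -> row i X' = map_mx f (row i E).
  have [X' [E [X'B XE]]] := P m (leqnn m).
  have X'E : X' = map_mx f E by apply/row_matrixP => i; rewrite XE// map_row.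
  exists E; apply: (@map_mx_inj _ _ f).
  by rewrite !map_mxM -matrix.map_trmx map_mx1 -X'E.
elim: r => [|r IH] rm; first by exists X, 0; split.
have [X' [E [X'B XE]]] := IH (ltnW rm).
pose i0 := Ordinal rm; pose u := row i0 X'.
pose Er : 'M[rat]_m := \matrix_(i < m) if (i < r)%N then row i E else 0.
have uu : qform BL u = 1 by rewrite /qform -bform_mx X'B !mxE eqxx.
have uX (i : 'I_m) : (i < r)%N -> bform BL (row i X') u = 0.
  by move=> ir; rewrite -bform_mx X'B !mxE -val_eqE /= ltn_eqF.
have [r' [W [W_free WP uW]]] : exists (r' : nat) (W : 'M[rat]_(r', m)),
    [/\ row_free W, forall x : 'rV[rat]_m, (x <= W)%MS ->
       forall i : 'I_m, (i < r)%N -> bform B x (row i E) = 0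
     & (u <= map_mx f W)%MS].
  exists _, (row_base (kermx (B *m Er^T))); split; first exact: row_base_free.
    move=> x; rewrite eq_row_base => /sub_kermxP xE i ir.
    have /rowP/(_ i) := xE; rewrite mulmxA /bform !mxE => xEi; rewrite -[RHS]xEi.
    by apply: eq_bigr => l _; rewrite !mxE ir !mxE.
  have /(map_eqmx f) -> := eq_row_base (kermx (B *m Er^T)).
  rewrite map_kermx; apply/sub_kermxP.
  rewrite map_mxM mulmxA; apply/rowP => i; rewrite !mxE.
  case: (ltnP i r) => ir; last first.
    by rewrite big1// => l _; rewrite !mxE ltnNge ir /= mxE scale0r mulr0.
  rewrite -[RHS](uX i ir) bformC// (XE i ir) /bform !mxE; apply: eq_bigr => l _.
  by rewrite !mxE ir mxE.
have [e [eW ee]] : exists e : 'rV[rat]_m, (e <= W)%MS /\ qform B e = 1.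
  apply: contrapT => ne.
  have [y uy] := submxP uW.
  pose A := block_mx (W *m B *m W^T) 0 0 ((-1)%:M : 'M[rat]_1).
  have anisoA (z : 'rV[rat]_(r' + 1)) : qform A z = 0 -> z = 0.
    rewrite -(hsubmxK z) qform_block; set z1 := lsubmx z; set t := rsubmx z.
    rewrite qform_pullback.
    move=> /eqP; rewrite mulN1r subr_eq0 => /eqP zt.
    have t0 : t 0 0 = 0.
      apply/eqP/negPn/negP => t0; apply: ne; exists ((t 0 0)^-1 *: (z1 *m W)).
      rewrite scalemx_sub ?submxMl//; split=> //.
      rewrite /qform bformZl bformZr// -/(qform B (z1 *m W)) zt; by field.
    have /anisoB zW : qform B (z1 *m W) = 0 by rewrite zt t0 expr0n.
    have -> : z1 = 0.
      by apply: (row_free_inj W_free); rewrite zW mul0mx.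
    have -> : t = 0 by apply/rowP => j; rewrite [j]ord1 t0 mxE.
    by rewrite row_mx0.
  have := @springer _ _ A oddL anisoA (row_mx y 1%:M : 'rV[L]__).
  rewrite map_block_mx !map_mx0 map_scalar_mx qform_block => H.
  have /H : qform (map_mx f (W *m B *m W^T)) y + f (-1) * (1%:M : 'M[L]_1) 0 0 ^+ 2 = 0.
    rewrite mxE eqxx expr1n mulr1 [f (-1)](rmorphN1 (in_alg L)).
    have -> : qform (map_mx f (W *m B *m W^T)) y = qform BL u.
      by rewrite uy !map_mxM -matrix.map_trmx qform_pullback.
    by rewrite uu subrr.
  rewrite -row_mx0 => /eq_row_mx[_ /matrixP/(_ 0 0)]; rewrite !mxE eqxx => /eqP.
  by rewrite oner_eq0.
pose d := u - map_mx f e.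
have dX (i : 'I_m) : (i < r)%N -> bform BL (row i X') d = 0.
  by move=> ir; rewrite bformDr// bformNr// uX// (XE i ir) bform_map bformC// WP// rmorph0 subrr.
pose E' : 'M[rat]_m := \matrix_(i < m) if (i < r)%N then row i E else e.
have E'r (i : 'I_m) : (i < r)%N -> row i E' = row i E by move=> ir; rewrite rowK ir.
have E'i0 : row i0 E' = e by rewrite rowK /= ltnn.
have i0P (i : 'I_m) : (i < r.+1)%N -> ~~ (i < r)%N -> i = i0.
  by move=> ir nir; apply: val_inj => /=; lia.
have [d0|d0] := eqVneq d 0.
  exists X', E'; split=> // i ir; case: (boolP (i < r)%N) => ir'.
    by rewrite E'r// XE.
  by rewrite (i0P i ir ir') E'i0; apply/subr0_eq.
have qd0 : qform BL d != 0 by apply: contraNneq d0 => /anisoL ->.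
have Rorth : orthogonal_group BL (reflection BL d).
  have := @orthogonal_reflections _ _ _ symBL [:: d].
  by rewrite /reflections big_cons big_nil mulmx1 /= qd0; apply.
exists (X' *m reflection BL d), E'; split.
  rewrite trmx_mul !mulmxA -(mulmxA X') -(mulmxA X') (orthogonal_gram Rorth)//.
move=> i ir; rewrite row_mul; case: (boolP (i < r)%N) => ir'.
  by rewrite reflection_fix ?dX// E'r// XE.
rewrite (i0P i ir ir') E'i0 reflection_swap//.
by rewrite uu qform_map ee rmorph1.
Qed.

(** Over the field itself the conjugates turn the trace form into a sum of
    squares; the degree is odd, so that this descends to the rationals. *)
Lemma trace_form_orthonormal (K : splittingFieldType rat) m
    (b : 'I_m -> ring_of_integers K) :
  galois 1 {:K} -> odd (\dim {:K}) -> integral_basis b ->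
  exists Y : 'M[rat]_m, Y *m trace_gram b *m Y^T = 1%:M.
Proof.
move=> galK oddK bP; have e := integral_basis_size bP; subst m.
have fb := integral_basis_free bP.
have Cu := conj_mx_unit galK fb.
apply: (@orthonormal_descent K _ _ (invmx (conj_mx galK (fun i => val (b i))))) => //.
  exact: trace_gram_sym.
rewrite (trace_gram_conj galK) trmx_inv !mulmxA mulVmx// mul1mx.
by rewrite -trmx_inv -trmx_mul mulVmx// trmx1.
Qed.

(** Both forms are isometric to the standard form; a reflection then moves the
    image of [b] to [a]. *)
Lemma isometry_matching_vectors m (A B YA YB : 'M[rat]_m) (a b : 'rV[rat]_m) :
  A^T = A -> YA *m A *m YA^T = 1%:M -> YB *m B *m YB^T = 1%:M ->
  qform A a = qform B b ->
  exists X : 'M[rat]_m, [/\ X \in unitmx, X *m A *m X^T = B & b *m X = a].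
Proof.
move=> symA YAE YBE ab.
have YAu : YA \in unitmx by have := mulmx1_unit (etrans (mulmxA _ _ _) YAE) => -[].
have YBu : YB \in unitmx by have := mulmx1_unit (etrans (mulmxA _ _ _) YBE) => -[].
pose X0 := invmx YB *m YA.
have X0A : X0 *m A *m X0^T = B.
  rewrite /X0 trmx_mul trmx_inv !mulmxA -(mulmxA (invmx YB)) -(mulmxA (invmx YB)) YAE.
  have YBtu : YB^T \in unitmx by rewrite unitmx_tr.
  rewrite mulmx1; apply: (can_inj (mulKmx YBu)); apply: (can_inj (mulmxK YBtu)).
  by rewrite YBE mulKVmx// mulVmx.
have X0u : X0 \in unitmx by rewrite unitmx_mul unitmx_inv YBu.
have bX0 : qform A (b *m X0) = qform B b by rewrite -X0A qform_pullback.
clearbody X0.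
have posA x : qform A x = 0 -> x = 0.
  move=> qx; suff : x *m invmx YA = 0.
    by move=> /(congr1 (mulmx^~ YA)); rewrite mulmxKV// mul0mx.
  by apply: qform1_rat_aniso; rewrite -YAE qform_pullback mulmxKV.
have [bX0a|bX0a] := eqVneq (b *m X0 - a) 0.
  by exists X0; split=> //; apply: subr0_eq.
have q0 : qform A (b *m X0 - a) != 0 by apply: contraNneq bX0a => /posA ->.
have Rorth : orthogonal_group A (reflection A (b *m X0 - a)).
  have := @orthogonal_reflections _ _ _ symA [:: b *m X0 - a].
  by rewrite /reflections big_cons big_nil mulmx1 /= q0; apply.
exists (X0 *m reflection A (b *m X0 - a)); split.
- by rewrite unitmx_mul X0u Rorth.1.
- by rewrite trmx_mul !mulmxA -(mulmxA X0) -(mulmxA X0) (orthogonal_gram Rorth).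
- by rewrite mulmxA reflection_swap// bX0 ab.
Qed.

(** * Minkowski's theorem: a nontrivial field has a nontrivial discriminant *)

Section RealEmbedding.
Variables (K : fieldExtType rat) (oddK : odd (\dim {:K})).

(** A polynomial of odd degree has a real root. *)
Lemma real_embedding : inhabited {rmorphism K -> realalg}.
Proof.
have [t [f [fE sf gP]]] := rat_generator K.
pose R : rcfType := realalg.
have [r rt] : {r : R | root (map_poly ratr f) r}.
  by apply: odd_poly_root; rewrite size_map_poly sf /= oddK.
have H y : exists g : {poly rat}, (map_poly (in_alg K) g).[t] = y.
  by have [g gy _] := gP y; exists g.
have [g gE] := choice H.
pose iota x : realalg := (map_poly ratr (g x)).[r].
have iotaE (p : {poly rat}) : iota (map_poly (in_alg K) p).[t] = (map_poly ratr p).[r].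
  apply/eqP; rewrite -subr_eq0 /iota -hornerN -hornerD -rmorphN -rmorphD /=.
  set q := _ - p; suff /dvdpP[h ->] : f %| q.
    by rewrite rmorphM hornerM (rootP rt) mulr0.
  rewrite -(dvdp_map (in_alg K)) fE; apply: minPoly_dvdp.
    by apply/polyOver1P; exists q.
  by apply/rootP; rewrite rmorphB hornerD hornerN gE subrr.
have iotaB : zmod_morphism iota.
  move=> x y; rewrite -{1}(gE x) -{1}(gE y) -hornerN -hornerD -rmorphN -rmorphD.
  by rewrite iotaE rmorphB hornerD hornerN.
have iotaM : monoid_morphism iota.
  split; first by have := iotaE 1; rewrite !rmorph1 !hornerC.
  move=> x y; rewrite -{1}(gE x) -{1}(gE y) -hornerM -rmorphM.
  by rewrite iotaE rmorphM hornerM.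
pose A := GRing.isZmodMorphism.Build K realalg iota iotaB.
pose M := GRing.isMonoidMorphism.Build K realalg iota iotaM.
pose h : {rmorphism K -> realalg} := HB.pack iota A M.
exact: (inhabits h).
Qed.

End RealEmbedding.

Section TraceBound.
Variables (K : splittingFieldType rat) (galK : galois 1 {:K}).
Hypothesis oddK : odd (\dim {:K}).
Local Notation n := (\dim {:K}).
Local Notation T := (gal_of {:K}).
Local Notation OK := (@integral_closure K).
Implicit Types (x y z : K).

Lemma norm_int x : x \in OK -> x != 0 ->
  exists2 m : int, m != 0 & \prod_(s : T) s x = m%:~R.
Proof.
move=> xO x0; have : \prod_(s : T) s x \in 1%VS.
  have := mem_galNorm galK (memvf x); rewrite /galNorm.
  rewrite (eq_bigl predT)// => s; rewrite inE gal_kHom ?sub1v//.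
  by rewrite k1AHom ?gal_AEnd.
case/vlineP => a aE.
have [m am] : exists m : int, a = m%:~R.
  apply: (@int_of_integral K); rewrite -aE.
  by apply: rpred_prod => s _; apply: gal_integral.
exists m; last by rewrite aE am ratz_alg.
apply: contraNneq x0 => m0; move: aE; rewrite am m0 scale0r => /eqP.
by rewrite prodf_seq_eq0 => /hasP[s _ /=]; rewrite fmorph_eq0.
Qed.

(** Arithmetic-geometric mean inequality for the squares of the conjugates,
    whose product is the square of the norm. *)
Lemma trace_sq_ge x : x \in OK -> x != 0 -> n%:R <= field_trace (x ^+ 2).
Proof.
move=> xO x0; have [iota] := real_embedding oddK.
have n0 : (0 < n)%N by rewrite adim_gt0.
have [N N0 NE] := norm_int xO x0.
have sumE : \sum_(s in (T : predArgType)) iota (s x) ^+ 2 = ratr (field_trace (x ^+ 2)).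
  transitivity (iota (field_trace (x ^+ 2))%:A); last first.
    by rewrite -[LHS]/((iota \o in_alg K) _) [LHS]fmorph_eq_rat.
  rewrite (field_traceE galK) rmorph_sum; apply: eq_bigr => s _.
  by rewrite !rmorphXn.
have [] := @leif_AGM realalg _ (T : predArgType) (fun s : T => iota (s x) ^+ 2).
  by move=> s _; rewrite sqr_ge0.
rewrite sumE card_gal// => le _; rewrite leNgt; apply/negP => ltn.
have: 1 <= \prod_(s in (T : predArgType)) iota (s x) ^+ 2.
  rewrite (eq_bigl predT)// prodrXl -rmorph_prod NE rmorph_int -rmorphXn.
  by rewrite -[1]/(1%:~R) ler_int; lia.
move=> /le_trans/(_ le); rewrite leNgt expr_lt1//; last first.
  by rewrite -sumE divr_ge0// sumr_ge0// => s _; rewrite sqr_ge0.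
by rewrite ltr_pdivrMr ?ltr0n// mul1r -(ratr_nat _ n) ltr_rat ltn.
Qed.

End TraceBound.

(** By the Smith normal form the rows of [A] span a sublattice of index [|det A|]. *)
Lemma lattice_pigeonhole m (A : 'M[int]_m) (I : finType) (f : I -> 'rV[int]_m) :
  \det A != 0 -> (`|\det A| < #|(I : predArgType)|)%N ->
  exists i j, i != j /\ exists c, f i - f j = c *m A.
Proof.
move=> A0 cI; have [L Lu [R Ru [d _ AE]]] := int_Smith_normal_form A.
set D := \matrix_(i, j) _ in AE.
have Du : D = diag_mx (\row_i d`_i).
  by apply/matrixP => i j; rewrite !mxE.
have detu (U : 'M[int]_m) : U \in unitmx -> `|\det U|%N = 1%N.
  by rewrite unitmxE qualifE /= => /orP[]/eqP ->.
pose q (i : 'I_m) : nat := absz d`_i.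
have dA : `|\det A|%N = (\prod_(i < m) q i)%N.
  rewrite AE !det_mulmx !abszM (detu L)// (detu R)// muln1 mul1n Du det_diag.
  rewrite (big_morph _ abszM (erefl : `|1 : int|%N = 1%N)).
  by apply: eq_bigr => i _; rewrite mxE.
have dpos (i : 'I_m) : (0 < q i)%N.
  rewrite lt0n; apply: contraNneq A0 => di; rewrite -absz_eq0 dA.
  by rewrite (bigD1 i) //= di mul0n.
pose y k (i : 'I_m) : int := (f k *m invmx R) 0 i.
have ltm k (i : 'I_m) : (`|(y k i %% d`_i)%Z| < q i)%N.
  have di0 : d`_i != 0 by rewrite -absz_eq0 -lt0n; apply: dpos.
  by rewrite -ltz_nat gez0_abs ?modz_ge0// /q abszE ltz_mod.
pose g k : {dffun forall i : 'I_m, 'I_(q i)} := finfun (fun i => Ordinal (ltm k i)).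
have ninj : ~ injective g.
  move=> /leq_card; rewrite leqNgt => /negP; apply.
  apply: leq_ltn_trans cI; rewrite card_dep_ffun dA foldrE big_map big_enum /=.
  by apply/eq_leq/eq_bigr => i _; rewrite card_ord.
have [i [j [gij ij]]] : exists i j, g i = g j /\ i != j.
  apply: contrapT => nex; apply: ninj => i j gij; apply/eqP/negPn/negP => ij.
  by apply: nex; exists i, j.
exists i, j; split=> //.
have H l : exists e : int, y i l - y j l = e * d`_l.
  apply/dvdzP; rewrite -eqz_mod_dvd.
  have /ffunP/(_ l) := gij; rewrite !ffunE => /(congr1 val) /= e.
  have di0 : d`_l != 0 by rewrite -absz_eq0 -lt0n; apply: dpos.
  by apply/eqP; rewrite -[LHS]gez0_abs ?modz_ge0// -[RHS]gez0_abs ?modz_ge0// e.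
have [e eP] := choice H.
exists ((\row_l e l) *m invmx L).
have yE : (f i - f j) *m invmx R = (\row_l e l) *m D.
  apply/rowP => l; transitivity (y i l - y j l).
    by rewrite mulmxBl /y mxE [X in _ + X]mxE.
  by rewrite eP Du mul_mx_diag !mxE.
by rewrite AE !mulmxA mulmxKV// -yE mulmxKV.
Qed.

Lemma sqr_sub_lt (a b c : int) : 0 <= a < c -> 0 <= b < c -> (a - b) ^+ 2 < c ^+ 2.
Proof.
move=> /andP[a0 ac] /andP[b0 bc]; rewrite -subr_gt0 subr_sqr.
by apply: mulr_gt0; lia.
Qed.

Lemma sqr_sub_le (a b c : int) : 0 <= a <= c -> 0 <= b <= c -> (a - b) ^+ 2 <= c ^+ 2.
Proof.
move=> /andP[a0 ac] /andP[b0 bc]; rewrite -subr_ge0 subr_sqr.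
by apply: mulr_ge0; lia.
Qed.

(** Minkowski's argument.  In orthonormal coordinates the integers form a lattice
    of determinant [1] inside [1 / m] times the standard one.  The points of the
    half-open unit cube and one further vertex outnumber the cosets, and two of
    them in one coset differ by a nonzero integer whose square has trace less
    than [n], against [trace_sq_ge]. *)
Lemma unimodular_trivial (K : splittingFieldType rat) :
  galois 1 {:K} -> odd (\dim {:K}) -> disc K = 1 -> \dim {:K} = 1%N.
Proof.
move=> galK oddK disc1; apply/eqP/negPn/negP => n1.
have [b bP] := integral_basis_exists galK.
have [Y YB] := trace_form_orthonormal galK oddK bP.
move: n1 b bP Y YB; set n := \dim _ => n1 b bP Y YB.
have n2 : (1 < n)%N by rewrite ltn_neqAle eq_sym n1 /n adim_gt0.
set B := trace_gram b in YB.
have detB : \det B = 1 by rewrite -disc1; apply/esym/discE.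
have Yu : Y \in unitmx by have := mulmx1_unit (etrans (mulmxA _ _ _) YB) => -[].
pose P := invmx Y.
have detP2 : (\det P) ^+ 2 = 1.
  rewrite det_inv exprVn; have := congr1 determinant YB.
  by rewrite !det_mulmx det_tr detB det1 mulr1 -expr2 => ->; rewrite invr1.
have [m m0 mP] := common_denominator (fun ij : 'I_n * 'I_n => P ij.1 ij.2).
have [Z ZE] := choice mP.
pose A : 'M[int]_n := \matrix_(i, j) Z (i, j).
have AE : map_mx intr A = m%:~R *: P.
  by apply/matrixP => i j; rewrite !mxE -(ZE (i, j)).
have detA : (`|\det A| = `|m| ^ n)%N.
  have dA : (\det A)%:~R = m%:~R ^+ n * \det P :> rat by rewrite -det_map_mx AE detZ.
  have dA2 : (\det A) ^+ 2 = (m ^+ n) ^+ 2.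
    apply/eqP; rewrite -(eqr_int rat) !rmorphXn /= dA.
    by rewrite exprMn detP2 mulr1.
  have := congr1 absz dA2; rewrite !abszX => /eqP.
  by rewrite eqn_exp2r// => /eqP.
pose M := `|m|%N; have mM : m = M%:Z by rewrite /M gez0_abs// ltW.
have M0 : (0 < M)%N by rewrite -ltz_nat -mM.
pose i0 : 'I_n := Ordinal (ltnW n2); pose i1 : 'I_n := Ordinal n2.
pose f (o : option {ffun 'I_n -> 'I_M}) : 'rV[int]_n :=
  if o is Some g then \row_i (g i : nat)%:Z else \row_i (if i == i0 then m else 0).
have cI : (`|\det A| < #|(option {ffun 'I_n -> 'I_M} : predArgType)|)%N.
  by rewrite card_option card_ffun !card_ord detA ltnS.
have A0 : \det A != 0 by rewrite -absz_eq0 detA -lt0n expn_gt0 M0.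
have [i [j [ij [c cA]]]] := lattice_pigeonhole f A0 cI.
have fij : f i != f j.
  move: i j ij {c cA} => [g|] [h|] //.
  - apply: contraNneq => gh; suff -> : g = h by [].
    apply/ffunP => l; apply: val_inj => /=.
    by have /rowP/(_ l) := gh; rewrite !mxE => -[].
  - move=> _; apply/eqP => /rowP/(_ i0); rewrite !mxE eqxx mM => -[] e.
    by have := ltn_ord (g i0); rewrite e ltnn.
  - move=> _; apply/eqP => /rowP/(_ i0); rewrite !mxE eqxx mM => -[] e.
    by have := ltn_ord (h i0); rewrite -e ltnn.
have lt1 : (f i - f j) 0 i1 ^+ 2 < m ^+ 2.
  have f1 o : 0 <= f o 0 i1 < m.
    by case: o => [g|]; rewrite mxE //= mM ltz_nat ltn_ord.
  by rewrite mxE [X in _ + X]mxE; apply: sqr_sub_lt.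
have le1 l : (f i - f j) 0 l ^+ 2 <= m ^+ 2.
  have fl o : 0 <= f o 0 l <= m.
    case: o => [g|]; rewrite mxE; first by rewrite mM lez_nat ltnW// ltn_ord.
    by case: ifP => _; rewrite ?lexx ltW.
  by rewrite mxE [X in _ + X]mxE; apply: sqr_sub_le.
pose x : ring_of_integers K := \sum_l b l *~ c 0 l.
have c0 : c != 0.
  apply: contraNneq fij => c0; move/eqP: cA; rewrite c0 mul0mx subr_eq0 => /eqP ->//.
have x0 : val x != 0.
  apply: contraNneq c0 => x0; apply/eqP/rowP => l; rewrite mxE.
  have := integral_basis_free bP (c := fun l => (c 0 l)%:~R); move=> /(_ _ l) cl.
  apply/eqP; rewrite -(intr_eq0 rat); apply/eqP/cl; rewrite -[RHS]x0 OF_sumE.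
  by apply: eq_bigr => k _; rewrite -[in RHS]ratz_alg mulr_algl.
have := trace_sq_ge galK oddK (OF_integral x) x0.
have -> : field_trace (val x ^+ 2) = qform B (map_mx intr c).
  rewrite /qform (bform_trace_gram galK) expr2; congr (field_trace (_ * _));
  by rewrite OF_sumE; apply: eq_bigr => l _; rewrite mxE -ratz_alg mulr_algl.
have -> : qform B (map_mx intr c) = qform 1%:M (map_mx intr c *m P).
  by rewrite -YB qform_pullback mulmxKV.
have -> : map_mx intr c *m P = m%:~R^-1 *: map_mx intr (f i - f j).
  rewrite cA map_mxM AE -scalemxAr scalerA mulVf ?scale1r//.
  by rewrite intr_eq0 gt_eqF.
rewrite qform1_sum leNgt => /negP; apply.
have -> : n%:R = \sum_(l < n) 1 :> rat by rewrite sumr_const card_ord.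
have m2 : 0 < (m%:~R ^+ 2 : rat) by rewrite exprn_gt0// ltr0z.
have E l : (m%:~R^-1 *: map_mx intr (f i - f j)) 0 l ^+ 2 =
    ((f i - f j) 0 l ^+ 2)%:~R / m%:~R ^+ 2 :> rat.
  rewrite [X in X ^+ 2]mxE [X in _ * X]mxE exprMn exprVn mulrC rmorphXn//.
under eq_bigr => l _ do rewrite E.
rewrite (bigD1 i1) //= [X in _ < X](bigD1 i1) //= ltr_leD//.
  by rewrite ltr_pdivrMr// mul1r -rmorphXn ltr_int.
by apply: ler_sum => l _; rewrite ler_pdivrMr// mul1r -rmorphXn ler_int.
Qed.

(** * Integers modulo a prime *)

Definition dvdO (F : fieldExtType rat) (m : nat) (x : ring_of_integers F) :=
  exists v, x = m%:R * v.

Section PrimesAbove.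
Variables (K : splittingFieldType rat) (galK : galois 1 {:K}).
Local Notation n := (\dim {:K}).
Local Notation T := (gal_of {:K}).
Local Notation OF := (ring_of_integers K).
Variables (p : nat) (p_pr : prime p).
Implicit Types (x y z u v w : OF) (P : {pred OF}).

Lemma OFM_eq0 x y : x * y = 0 -> x = 0 \/ y = 0.
Proof.
move=> /(congr1 val); rewrite rmorphM rmorph0 => /eqP.
by rewrite mulf_eq0 => /orP[]/eqP e; [left|right]; apply: val_inj; rewrite e rmorph0.
Qed.

Lemma OF_natr_neq0 m : (0 < m)%N -> (m%:R : OF) <> 0.
Proof.
move=> m0 /(congr1 val); rewrite rmorph_nat rmorph0 -(rmorph_nat (in_alg K)) => /eqP.
by rewrite fmorph_eq0 pnatr_eq0 eqn0Ngt m0.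
Qed.

Lemma OF_natrI m x y : (0 < m)%N -> m%:R * x = m%:R * y -> x = y.
Proof.
move=> m0 /eqP; rewrite -subr_eq0 -mulrBr => /eqP/OFM_eq0[/OF_natr_neq0 //|].
by move=> /eqP; rewrite subr_eq0 => /eqP.
Qed.

Lemma dvdO0 m : dvdO m (0 : OF). Proof. by exists 0; rewrite mulr0. Qed.
Lemma dvdOD m x y : dvdO m x -> dvdO m y -> dvdO m (x + y).
Proof. by move=> [a ->] [c ->]; exists (a + c); rewrite mulrDr. Qed.
Lemma dvdON m x : dvdO m x -> dvdO m (- x).
Proof. by move=> [a ->]; exists (- a); rewrite mulrN. Qed.
Lemma dvdOB m x y : dvdO m x -> dvdO m y -> dvdO m (x - y).
Proof. by move=> dx dy; apply/dvdOD/dvdON. Qed.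
Lemma dvdOMl m x y : dvdO m x -> dvdO m (y * x).
Proof. by move=> [a ->]; exists (y * a); ring. Qed.
Lemma dvdOMr m x y : dvdO m x -> dvdO m (x * y).
Proof. by rewrite mulrC; apply: dvdOMl. Qed.
Lemma dvdO_sum m (I : finType) (Q : pred I) (f : I -> OF) :
  (forall i, Q i -> dvdO m (f i)) -> dvdO m (\sum_(i | Q i) f i).
Proof. by move=> H; apply: big_ind => //; [apply: dvdO0|apply: dvdOD]. Qed.

Lemma dvdO_int (m : nat) (a : int) : (m %| a)%Z -> dvdO m (a%:~R : OF).
Proof. by move=> /dvdzP[c ->]; exists c%:~R; rewrite intrM mulrC. Qed.

Lemma OF_valM x y : val (x * y) = val x * val y. Proof. exact: (rmorphM val). Qed.
Lemma OF_valD x y : val (x + y) = val x + val y. Proof. exact: (raddfD val). Qed.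
Lemma OF_valn m : val (m%:R : OF) = m%:R. Proof. exact: (rmorph_nat val). Qed.

Definition galO (s : T) (x : OF) : OF := RingOfIntegers (gal_integral s (OF_integral x)).

Lemma galOB s x y : galO s (x - y) = galO s x - galO s y.
Proof. by apply: val_inj; rewrite /= raddfB. Qed.
Lemma galOM s x y : galO s (x * y) = galO s x * galO s y.
Proof. by apply: val_inj; exact: (rmorphM (gal_repr s)). Qed.
Lemma galO1 s : galO s 1 = 1.
Proof. by apply: val_inj; exact: (rmorph1 (gal_repr s)). Qed.
Lemma galO0 s : galO s 0 = 0.
Proof. by have := galOB s 0 0; rewrite !subrr. Qed.
Lemma galON s x : galO s (- x) = - galO s x.
Proof. by have := galOB s 0 x; rewrite galO0 !sub0r. Qed.
Lemma galOD s x y : galO s (x + y) = galO s x + galO s y.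
Proof. by have := galOB s x (- y); rewrite galON !opprK. Qed.
Lemma galOX s x k : galO s (x ^+ k) = galO s x ^+ k.
Proof. by elim: k => [|k IH]; rewrite ?galO1// !exprS galOM IH. Qed.
Lemma galO_nat s m : galO s m%:R = m%:R.
Proof. by elim: m => [|m IH]; rewrite ?galO0// mulrS galOD galO1 IH. Qed.
Lemma galO_dvd s m x : dvdO m x -> dvdO m (galO s x).
Proof. by move=> [a ->]; exists (galO s a); rewrite galOM galO_nat. Qed.
Lemma galO_id x : galO 1%g x = x.
Proof. by apply: val_inj; rewrite /= gal_id. Qed.
Lemma galO_comp s t x : galO t (galO s x) = galO (s * t)%g x.
Proof. by apply: val_inj; rewrite /= galM ?memvf. Qed.

Definition trO (x : OF) : int := sval (cid (trace_int galK (OF_integral x))).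

Lemma trOE x : (trO x)%:~R = field_trace (val x).
Proof. by rewrite /trO; case: cid => m /= ->. Qed.

Lemma trO_sum x : (trO x)%:~R = \sum_s galO s x.
Proof.
apply: val_inj; rewrite rmorph_int -ratz_alg trOE (field_traceE galK).
by rewrite raddf_sum.
Qed.

Lemma trO_inj (a c : int) : a%:~R = c%:~R :> rat -> a = c.
Proof. by move/eqP; rewrite eqr_int => /eqP. Qed.

Lemma trOD x y : trO (x + y) = trO x + trO y.
Proof. by apply: trO_inj; rewrite rmorphD /= !trOE raddfD /= (field_traceD galK). Qed.

Lemma trOZ (a : int) x : trO (a%:~R * x) = a * trO x.
Proof.
apply: trO_inj; rewrite rmorphM /= !trOE rmorphM rmorph_int -ratz_alg mulr_algl.
by rewrite (field_traceZ galK).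
Qed.

Lemma trO_natZ m x : trO (m%:R * x) = m%:Z * trO x.
Proof. by rewrite -trOZ. Qed.

Lemma trO1 : trO 1 = n%:Z.
Proof. by apply: trO_inj; rewrite trOE (field_trace1 galK). Qed.

Section Basis.
Variables (b : 'I_n -> OF) (bP : integral_basis b).

Lemma basis_dvd (a : 'I_n -> int) (m : nat) :
  dvdO m (\sum_i b i *~ a i) -> forall i, (m %| a i)%Z.
Proof.
move=> [v vE] i; have [c [cv _]] := bP v.
have [e [_ eu]] := bP (\sum_i b i *~ a i).
have e1 : e = [ffun j => a j] by apply: eu; apply: eq_bigr => j _; rewrite ffunE.
have e2 : e = [ffun j => m%:Z * c j].
  apply: eu; rewrite vE {1}cv mulr_sumr; apply: eq_bigr => j _.
  by rewrite ffunE mulrzAr mulrzA mulr_natl.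
have /ffunP/(_ i) := etrans (esym e1) e2; rewrite !ffunE => ->.
by rewrite dvdz_mulr.
Qed.

Definition box (c : {ffun 'I_n -> 'I_p}) : OF := \sum_i b i *~ (c i : nat)%:Z.

Lemma box_ex x : exists c, dvdO p (x - box c).
Proof.
have [a [-> _]] := bP x.
have ltp (i : 'I_n) : (`|(a i %% p)%Z| < p)%N.
  by rewrite -ltz_nat gez0_abs ?modz_ge0 ?ltz_pmod//; have := prime_gt0 p_pr; lia.
exists [ffun i => Ordinal (ltp i)]; rewrite /box -sumrB.
have p0 : (p%:Z != 0) by have := prime_gt0 p_pr; lia.
apply: dvdO_sum => i _; rewrite ffunE /= gez0_abs ?modz_ge0//.
exists (b i *~ (a i %/ p)%Z); rewrite {1}(divz_eq (a i) p) mulrzDr addrK mulrzA.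
by rewrite mulr_natl.
Qed.

End Basis.

(** There are finitely many classes modulo [p]. *)
Lemma mod_p_collision (f : nat -> OF) : exists i j, (i < j)%N /\ dvdO p (f i - f j).
Proof.
have [b bP] := integral_basis_exists galK.
have [c cP] := choice (fun i => box_ex bP (f i)).
pose N := #|{ffun 'I_n -> 'I_p}|.
have ninj : ~ injective (fun i : 'I_N.+1 => c i).
  by move=> /leq_card; rewrite card_ord ltnn.
have [i [j [cij ij]]] : exists i j : 'I_N.+1, c i = c j /\ (i < j)%N.
  apply: contrapT => nex; apply: ninj => i j cij; apply: val_inj.
  case: (ltngtP i j) => // ij; exfalso; apply: nex.
    by exists i, j.
  by exists j, i.
exists i, j; split=> //.
have -> : f i - f j = (f i - box b (c i)) - (f j - box b (c j)) by rewrite cij; ring.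
exact: dvdOB.
Qed.

(** Multiplication by [y / p] preserves [L], which lies between [p OF] and [OF]
    and hence is finitely generated; so [y / p] is an eigenvalue of an integer
    matrix. *)
Lemma integrally_closed (L : OF -> Prop) y :
  (forall x z, L x -> L z -> L (x - z)) -> (forall x, L (p%:R * x)) ->
  (forall x, L x -> exists2 v, L v & y * x = p%:R * v) -> dvdO p y.
Proof.
move=> LB Lp Ly; have [b bP] := integral_basis_exists galK.
have L0 : L 0 by rewrite -[0](mulr0 p%:R).
have LN x : L x -> L (- x) by move=> Lx; rewrite -[- x]sub0r; apply: LB.
have LD x z : L x -> L z -> L (x + z).
  by move=> Lx Lz; rewrite -[z]opprK; apply/LB/LN.
have Lz x (m : int) : L x -> L (x *~ m).
  have Ln (k : nat) : L x -> L (x *+ k).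
    by elim: k => [|k IH] Lx; rewrite ?mulr0n// mulrS; apply: LD => //; apply: IH.
  by case: m => k Lx; [apply: Ln|rewrite NegzE mulrNz; apply/LN/Ln].
pose J : finType := ('I_n + {ffun 'I_n -> 'I_p})%type.
pose l (j : J) : OF := match j with
  | inl i => p%:R * b i | inr c => if `[< L (box b c) >] then box b c else 0 end.
have Ll j : L (l j) by case: j => [i|c] /=; [apply: Lp|case: asboolP].
have span x : L x -> exists a : J -> int, x = \sum_j l j *~ a j.
  move=> Lx; have [c [v xc]] := box_ex bP x; have [e [ve _]] := bP v.
  have Lc : L (box b c).
    have -> : box b c = x - (x - box b c) by ring.
    by rewrite xc; apply: LB.
  exists (fun j => match j with inl i => e i | inr d => (d == c)%:Z end).
  rewrite big_sumType /= -[LHS](subrK (box b c)) xc; congr (_ + _).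
    by rewrite {1}ve mulr_sumr; apply: eq_bigr => i _; rewrite -mulrzr mulrA mulrzr.
  by rewrite (bigD1 c) //= eqxx asboolT// big1 ?addr0// => d /negPf ->.
have H j : exists a : J -> int, y * l j = p%:R * \sum_k l k *~ a k.
  by have [v /span[a ->] ->] := Ly _ (Ll j); exists a.
have [A AE] := choice H.
have p0 : (p%:R : K) != 0.
  by rewrite -(rmorph_nat (in_alg K)) fmorph_eq0 pnatr_eq0 -lt0n prime_gt0.
have i0 : 'I_n := Ordinal (adim_gt0 {:K}%AS).
have /(_ (val y / p%:R)) H' := @integral_of_int_mx K #|J| _ (fun i => val (l (enum_val i)))
  (\matrix_(i, j) A (enum_val i) (enum_val j)) (enum_rank (inl i0 : J)).
have yO : val y / p%:R \in @integral_closure K.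
  apply: H' => [|i].
    rewrite enum_rankK -[X in X != 0]/(val (p%:R * b i0)) OF_valM OF_valn mulf_neq0//.
    apply/negP => /eqP bi0; have {}bi0 : val (b i0) = 0 := bi0.
    have := integral_basis_free bP (c := fun i => (i == i0)%:R).
    move=> /(_ _ i0); rewrite eqxx => /(_ _)/eqP; rewrite oner_eq0 => H0.
    suff: false by []. apply: H0; rewrite (bigD1 i0) //= eqxx scale1r bi0 add0r.
    by rewrite big1// => j /negPf ->; rewrite scale0r.
  have := congr1 val (AE (enum_val i)); rewrite !OF_valM OF_valn => yl.
  rewrite mulrAC yl mulrAC mulfV// mul1r OF_sumE.
  rewrite (reindex (@enum_val _ J)) /=; last by exists enum_rank => ? _; rewrite ?enum_valK ?enum_rankK.
  by apply: eq_bigr => j _; rewrite mxE.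
exists (RingOfIntegers yO); apply: val_inj; rewrite rmorphM rmorph_nat /=.
by rewrite mulrC divfK.
Qed.

End PrimesAbove.

(** * Prime ideals as annihilators *)

Section PrimeIdeals.
Variables (K : splittingFieldType rat) (galK : galois 1 {:K}).
Local Notation n := (\dim {:K}).
Local Notation T := (gal_of {:K}).
Local Notation OF := (ring_of_integers K).
Variables (p : nat) (p_pr : prime p).
Implicit Types (x y z u v w : OF).

Section Closure.
Variables (P : {pred OF}) (hP : Defs.prime_above p P).

Lemma prime_in0 : 0 \in P. Proof. by case: hP => -[]. Qed.
Lemma prime_notin1 : 1 \notin P. Proof. by case: hP => -[]. Qed.
Lemma prime_inp : p%:R \in P. Proof. by case: hP. Qed.
Lemma prime_inD x y : x \in P -> y \in P -> x + y \in P.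
Proof. by move=> xP yP; case: hP => -[_ _ /(_ 1 x y xP yP)]; rewrite mul1r. Qed.
Lemma prime_inMl x y : x \in P -> y * x \in P.
Proof.
by move=> xP; case: hP => -[P0 _ /(_ y x 0 xP P0)]; rewrite addr0.
Qed.
Lemma prime_inMr x y : x \in P -> x * y \in P.
Proof. by rewrite mulrC; apply: prime_inMl. Qed.
Lemma prime_inN x : x \in P -> - x \in P.
Proof. by rewrite -mulN1r; apply: prime_inMl. Qed.
Lemma prime_inB x y : x \in P -> y \in P -> x - y \in P.
Proof. by move=> xP yP; apply: prime_inD => //; apply: prime_inN. Qed.
Lemma prime_in_sum (I : finType) (Q : pred I) (f : I -> OF) :
  (forall i, Q i -> f i \in P) -> \sum_(i | Q i) f i \in P.
Proof.
move=> H; apply: (big_ind (fun x => x \in P)) => // [|x y xP yP].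
  exact: prime_in0.
exact: prime_inD.
Qed.
Lemma prime_in_or x y : x * y \in P -> x \in P \/ y \in P.
Proof. by case: hP => _ /(_ x y) h _ /h /orP. Qed.
Lemma prime_notinM x y : x \notin P -> y \notin P -> x * y \notin P.
Proof. by move=> xP yP; apply/negP => /prime_in_or[]; apply/negP. Qed.
Lemma prime_notinX x k : x \notin P -> x ^+ k \notin P.
Proof.
move=> xP; elim: k => [|k IH]; first exact: prime_notin1.
by rewrite exprS prime_notinM.
Qed.
Lemma prime_in_dvd x : dvdO p x -> x \in P.
Proof. by move=> [a ->]; apply: prime_inMr; apply: prime_inp. Qed.

Lemma prime_in_int (a : int) : a%:~R \in P -> (p %| a)%Z.
Proof.
move=> aP; apply/negPn/negP => pa.
have cop : coprimez p%:Z a by rewrite coprimezE prime_coprime.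
have [[e f] /= ef] := coprimezP _ _ cop; move/negP: prime_notin1; apply.
have -> : (1 : OF) = e%:~R * p%:R + f%:~R * a%:~R.
  by rewrite -[LHS]/(1%:~R) -ef rmorphD !rmorphM.
by apply: prime_inD; apply: prime_inMl => //; apply: prime_inp.
Qed.

(** The residue ring is a finite domain, hence a field. *)
Lemma prime_inverse u : u \notin P -> exists s, s * u - 1 \in P.
Proof.
move=> uP; have [i [j [ij /prime_in_dvd]]] := mod_p_collision galK p_pr (fun i => u ^+ i).
have -> : u ^+ i - u ^+ j = u ^+ i * (1 - u ^+ (j - i)).
  by rewrite mulrBr mulr1 -exprD subnKC// ltnW.
case/prime_in_or; first by move=> /negP[]; apply/negP/prime_notinX.
move=> H; exists (u ^+ (j - i).-1).
rewrite -exprSr prednK ?subn_gt0// -opprB; exact: prime_inN.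
Qed.

(** Dedekind's independence of characters, for the Galois conjugates taken
    modulo a prime that has trivial inertia. *)
Lemma conjugates_independent :
  (forall s t : T, s != t -> exists x, galO s x - galO t x \notin P) ->
  forall c : T -> OF, (forall x, \sum_s c s * galO s x \in P) ->
  forall s, c s \in P.
Proof.
move=> inert c; move: {2}#|_| (leqnn #|[set s | c s \notin P]|) => m.
elim: m c => [|m IH] c cm cP s0.
  apply/negPn/negP => cs0; move: cm; rewrite leqn0 cards_eq0 => /eqP/setP/(_ s0).
  by rewrite !inE cs0.
apply/negPn/negP => cs0.
have [[t [ts0 ct]]|nt] := pselect (exists t, t != s0 /\ c t \notin P); last first.
  have := cP 1; rewrite (bigD1 s0) //= galO1 mulr1 => H; apply/negP: cs0; rewrite negbK.
  have -> : c s0 = c s0 + \sum_(i | i != s0) c i * galO i 1 - \sum_(i | i != s0) c i * galO i 1.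
    by rewrite addrK.
  apply: prime_inB => //; apply: prime_in_sum => i is0; apply: prime_inMr.
  by apply/negPn/negP => ci; apply: nt; exists i.
have [z zP] := inert _ _ ts0.
pose c' s := c s * (galO s z - galO t z).
suff : c' s0 \in P.
  case/prime_in_or; first by apply/negP.
  by rewrite -opprB => /prime_inN; rewrite opprK; apply/negP.
apply: IH => [|x]; last first.
  have -> : \sum_s c' s * galO s x =
      \sum_s c s * galO s (z * x) - galO t z * \sum_s c s * galO s x.
    rewrite mulr_sumr -sumrB; apply: eq_bigr => s _; rewrite galOM /c'; ring.
  by apply: prime_inB; last apply: prime_inMl; apply: cP.
rewrite -ltnS; apply: leq_trans cm; apply: proper_card; apply/properP; split.
  apply/fintype.subsetP => s; rewrite !inE; apply: contra => cs; exact: prime_inMr.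
exists t; rewrite !inE// /c' subrr mulr0 negbK; exact: prime_in0.
Qed.

End Closure.

(** An annihilator modulo [p] that is maximal among the proper ones is prime; one
    exists because it is determined by its finitely many classes modulo [p]. *)
Lemma annihilator_prime (Q : OF -> Prop) :
  (exists2 y, Q y & ~ dvdO p y) -> (forall u y, Q y -> Q (u * y)) ->
  exists (y : OF) (P : {pred OF}), [/\ Q y, ~ dvdO p y, Defs.prime_above p P &
    forall s, s \in P <-> dvdO p (s * y)].
Proof.
move=> [y0 Qy0 py0] QM; have [b bP] := integral_basis_exists galK.
pose N y := #|[set c : {ffun 'I_n -> 'I_p} | `[< dvdO p (box b c * y) >] ]|.
pose ok := [pred m : nat | `[< exists y, [/\ Q y, ~ dvdO p y & N y = m] >] ].
have ex : exists m, ok m by exists (N y0); apply/asboolP; exists y0.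
have bnd m : ok m -> (m <= #|{: {ffun 'I_n -> 'I_p}}|)%N.
  by move=> /asboolP[y [_ _ <-]]; apply: max_card.
case: (ex_maxnP ex bnd) => m /asboolP[y [Qy py Ny]] ymax.
pose P : {pred OF} := fun s => `[< dvdO p (s * y) >].
have inP s : s \in P <-> dvdO p (s * y) by rewrite unfold_in; split=> /asboolP.
exists y, P.
split=> //; split.
- split; first by apply/inP; rewrite mul0r; apply: dvdO0.
    by apply/negP => /inP; rewrite mul1r.
  move=> a u v /inP pu /inP pv; apply/inP; rewrite mulrDl -mulrA.
  by apply: dvdOD => //; apply: dvdOMl.
- move=> u v /inP uvP; apply/orP; have [pu|pu] := pselect (dvdO p (u * y)).
    by left; apply/inP.
  right; apply/inP.
  have := ymax (N (u * y)); have -> : ok (N (u * y)).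
    by apply/asboolP; exists (u * y); split=> //; apply: QM.
  move=> /(_ isT); rewrite -Ny => le.
  have eqs : [set c : {ffun 'I_n -> 'I_p} | `[< dvdO p (box b c * y) >] ] =
             [set c : {ffun 'I_n -> 'I_p} | `[< dvdO p (box b c * (u * y)) >] ].
    apply/eqP; rewrite eqEcard le andbT; apply/fintype.subsetP => c.
    rewrite !finset.inE => /asboolP H; apply/asboolP.
    by rewrite mulrCA; apply: dvdOMl.
  have [c vc] := box_ex galK p_pr bP v.
  have : dvdO p (box b c * (u * y)).
    have -> : box b c * (u * y) = u * v * y - (v - box b c) * (u * y) by ring.
    by apply: dvdOB => //; apply: dvdOMr.
  have /setP/(_ c) := eqs; rewrite !finset.inE => e /asboolP; rewrite -e => /asboolP H.
  have -> : v * y = box b c * y + (v - box b c) * y by ring.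
  by apply: dvdOD => //; apply: dvdOMr.
- by apply/inP; apply: dvdOMr; exists 1; rewrite mulr1.
Qed.
End PrimeIdeals.

(** * Fields whose integers are reduced modulo p *)

(** A singular matrix over the prime field has a kernel vector. *)
Lemma det_mod_p (p : nat) (p_pr : prime p) m (A : 'M[int]_m) :
  (p %| \det A)%Z -> exists a : 'I_m -> int,
    (exists i, ~~ (p %| a i)%Z) /\ forall j, (p %| \sum_i a i * A i j)%Z.
Proof.
have pchar := pchar_Fp p_pr; rewrite (dvdz_pcharf pchar) -det_map_mx.
move=> /det0P[v v0 vA]; exists (fun i => (v 0 i : nat)%:Z); split.
  apply: contrapT => nv; case/eqP: v0; apply/rowP => i; rewrite mxE.
  apply/eqP; rewrite -[v 0 i]natr_Zp; apply/negPn/negP => vi; apply: nv; exists i.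
  by rewrite (dvdz_pcharf pchar).
move=> j; rewrite (dvdz_pcharf pchar); have /rowP/(_ j) := vA; rewrite !mxE => <-.
rewrite rmorph_sum; apply/eqP; apply: eq_bigr => i _; rewrite !mxE rmorphM /=.
by congr (_ * _); rewrite -[RHS]natr_Zp.
Qed.

Section Reduced.
Variables (K : splittingFieldType rat) (galK : galois 1 {:K}).
Local Notation n := (\dim {:K}).
Local Notation T := (gal_of {:K}).
Local Notation OF := (ring_of_integers K).
Variables (p : nat) (p_pr : prime p).
Implicit Types (x y z u v w : OF).

Definition reduced_mod_p := forall x, dvdO p (x * x) -> dvdO p x.

Lemma dvdOM m1 m2 x y : dvdO m1 x -> dvdO m2 y -> dvdO (m1 * m2) (x * y).
Proof. by move=> [a ->] [c ->]; exists (a * c); rewrite natrM; ring. Qed.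

Lemma dvdO_natr m x : dvdO m (m%:R * x). Proof. by exists x. Qed.

Lemma dvdO_mulrn m k x : (m %| k)%N -> dvdO m (x *+ k).
Proof. by move=> /dvdnP[c ->]; exists (x *+ c); rewrite mulr_natl -mulrnA. Qed.

Lemma dvdOX m x k : (0 < k)%N -> dvdO m x -> dvdO m (x ^+ k).
Proof. by case: k => // k _ mx; rewrite exprS; apply: dvdOMr. Qed.

Lemma dvdO_subX m x y k : dvdO m (x - y) -> dvdO m (x ^+ k - y ^+ k).
Proof. by move=> mxy; rewrite subrXX; apply: dvdOMr. Qed.

Lemma dvdO_dvdn m1 m2 x : (m1 %| m2)%N -> dvdO m2 x -> dvdO m1 x.
Proof. by move=> /dvdnP[c ->] [v ->]; exists (c%:R * v); rewrite natrM; ring. Qed.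

Lemma binomial_tail x y k : (x + y) ^+ k =
  x ^+ k + \sum_(i < k) x ^+ (k - i.+1) * y ^+ i.+1 *+ 'C(k, i.+1).
Proof. by rewrite exprDn big_ord_recl subn0 expr0 mulr1 bin0 mulr1n. Qed.

Lemma frobenius_add x y : dvdO p ((x + y) ^+ p - x ^+ p - y ^+ p).
Proof.
have p0 := prime_gt0 p_pr; have p1 : (p.-1 < p)%N by rewrite prednK.
rewrite binomial_tail [x ^+ p + _]addrC addrK (bigD1 (Ordinal p1)) //= prednK//.
rewrite subnn expr0 mul1r binn mulr1n [y ^+ p + _]addrC addrK.
apply: dvdO_sum => i; rewrite -val_eqE /= => ip; apply/dvdO_mulrn/prime_dvd_bin => //.
by have := ltn_ord i; lia.
Qed.

Lemma frobenius_addX x y k :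
  dvdO p ((x + y) ^+ (p ^ k) - x ^+ (p ^ k) - y ^+ (p ^ k)).
Proof.
elim: k => [|k IH]; first by rewrite !expr1 addrAC addrK subrr; apply: dvdO0.
rewrite expnSr !exprM; set X := x ^+ _; set Y := y ^+ _; set Z := (x + y) ^+ _.
have -> : Z ^+ p - X ^+ p - Y ^+ p =
  (Z ^+ p - (X + Y) ^+ p) + ((X + Y) ^+ p - X ^+ p - Y ^+ p) by ring.
apply: dvdOD; last exact: frobenius_add.
by apply: dvdO_subX; rewrite opprD addrA.
Qed.

(** The extra factor comes from the binomial coefficients, and from the power of
    [d] in the last term. *)
Lemma dvdO_subXp k x d : (0 < k)%N -> dvdO (p ^ k) d ->
  dvdO (p ^ k.+1) ((x + d) ^+ p - x ^+ p).
Proof.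
move=> k0 dk; rewrite binomial_tail addrC addKr; apply: dvdO_sum => i _.
have pd : dvdO p d by apply: dvdO_dvdn dk; rewrite -{1}(expn1 p) dvdn_exp2l.
rewrite expnSr; have [ip|ip] := ltnP i.+1 p.
  have /dvdnP[c ->] : (p %| 'C(p, i.+1))%N by apply: prime_dvd_bin.
  have -> : x ^+ (p - i.+1) * d ^+ i.+1 *+ (c * p) =
      x ^+ (p - i.+1) * d ^+ i *+ c * d * p%:R.
    by rewrite -mulr_natr natrM exprSr -[_ *+ c]mulr_natr; ring.
  apply: dvdOM; first exact: dvdOMl.
  by rewrite -[p%:R]mulr1; apply: dvdO_natr.
rewrite -mulr_natr; apply/dvdOMr/dvdOMl; rewrite exprS; apply: dvdOM => //.
by apply: dvdOX => //; have := prime_gt1 p_pr; lia.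
Qed.

Hypothesis red : reduced_mod_p.

Lemma reduced_root x k : dvdO p (x ^+ k) -> (0 < k)%N -> dvdO p x.
Proof.
elim: k => // -[_|k IH] xk _ //; apply: IH => //; apply: red.
by rewrite -exprD addSnnS exprD; apply: dvdOMl.
Qed.

(** Otherwise some [r] different from [1] acts trivially modulo [P].  In a reduced
    ring modulo [p] every [z] is [w ^ p + p a], and the increment of a [p]-th
    power gains a factor [p]; hence, up to factors outside [P], [r z - z] is
    divisible by every power of [p], and it vanishes. *)
Lemma reduced_inertia_trivial (P : {pred OF}) : Defs.prime_above p P ->
  forall s t : T, s != t -> exists x, galO s x - galO t x \notin P.
Proof.
move=> hP s0 t0 st; apply: contrapT => nx.
have p0 := prime_gt0 p_pr.
pose r : T := (t0^-1 * s0)%g.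
have r1 : r != 1%g by apply: contraNneq st => r1; rewrite -(mulKVg t0 s0) -/r r1 mulg1.
have rP z : galO r z - z \in P.
  apply/negPn/negP => zP; apply: nx; exists (galO t0^-1%g z).
  by rewrite !galO_comp mulVg galO_id.
have V k z : (0 < k)%N -> exists2 s, s \notin P & dvdO (p ^ k) (s * (galO r z - z)).
  elim: k z => // -[_|k IH] z _.
    set d := galO r z - z.
    have [i [j [ij dij]]] := mod_p_collision galK p_pr (fun i => d ^+ i).
    exists (1 - d ^+ (j - i)).
      apply/negP => H; move/negP: (prime_notin1 hP); apply.
      rewrite -[1](subrK (d ^+ (j - i))); apply: (prime_inD hP) => //.
      case: (j - i)%N (subn_gt0 i j) => [|m _]; first by rewrite ij.
      by rewrite exprS; apply: (prime_inMr hP); apply: rP.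
    rewrite expn1 mulrC; apply: (@reduced_root _ i.+1) => //.
    have -> : (d * (1 - d ^+ (j - i))) ^+ i.+1 =
        (d ^+ i - d ^+ j) * (d * (1 - d ^+ (j - i)) ^+ i).
      rewrite exprMn -{2}(subnKC (ltnW ij)) exprD !exprS; ring.
    exact: dvdOMr.
  have [i [j [ij dij]]] := mod_p_collision galK p_pr (fun i => z ^+ (p ^ i)).
  pose u := z ^+ (p ^ (j - i)); pose w := z ^+ (p ^ (j - i).-1).
  have uw : u = w ^+ p.
    by rewrite /u /w -exprM -expnSr prednK// subn_gt0.
  have [a za] : dvdO p (z - u).
    apply: (@reduced_root _ (p ^ i)); last by rewrite expn_gt0 p0.
    have := frobenius_addX u (z - u) i; rewrite [u + _]addrC subrK.
    rewrite /u -exprM -expnD subnK ?(ltnW ij)// -/u => H.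
    have -> : (z - u) ^+ (p ^ i) = z ^+ (p ^ i) - z ^+ (p ^ j) -
      (z ^+ (p ^ i) - z ^+ (p ^ j) - (z - u) ^+ (p ^ i)) by ring.
    exact: dvdOB.
  have zE : z = w ^+ p + p%:R * a by rewrite -uw -za; ring.
  have [sa saP sad] := IH a isT; have [sw swP swd] := IH w isT.
  exists (sa * sw ^+ p); first by apply: (prime_notinM hP) => //; apply: (prime_notinX hP).
  have -> : sa * sw ^+ p * (galO r z - z) =
    sa * ((sw * w + sw * (galO r w - w)) ^+ p - (sw * w) ^+ p)
    + sw ^+ p * (p%:R * (sa * (galO r a - a))).
    rewrite {1 2}zE galOD galOM galO_nat galOX -mulrDr [w + _]addrC subrK.
    rewrite !exprMn; ring.
  apply: dvdOD; first by apply/dvdOMl/dvdO_subXp.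
  apply: dvdOMl; rewrite expnS; apply: dvdOM => //.
  by rewrite -[p%:R]mulr1; apply: dvdO_natr.
have [z dz] : exists z, galO r z - z <> 0.
  apply: contrapT => nz; case/eqP: r1; apply/eqP/gal_eqP => y _.
  have [D D0 DyO] := integral_denominator y.
  have /eqP : galO r (RingOfIntegers DyO) - RingOfIntegers DyO = 0.
    by apply: contrapT => H; apply: nz; eexists; exact: H.
  rewrite subr_eq0 => /eqP/(congr1 val) /=; rewrite gal_id rmorphM rmorph_int.
  by apply: mulfI; rewrite -ratz_alg -[X in X != 0]/(in_alg K _) fmorph_eq0 intr_eq0.
set d := galO r z - z in dz.
have d0 : val d != 0 by apply/negP => /eqP d0; apply: dz; apply: val_inj; rewrite d0 rmorph0.
have [m m0 mE] := norm_int galK (OF_integral d) d0.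
pose e := \prod_(s | s != 1%g) galO s d.
have dm : d * e = m%:~R.
  apply: val_inj; rewrite OF_valM rmorph_int -mE (bigD1 1%g) //= gal_id.
  by congr (_ * _); exact: (rmorph_prod val).
pose k := (logn p `|m|).+1.
have [s sP [v sv]] := V k z isT.
have am0 : (0 < `|m|)%N by rewrite absz_gt0.
have [c cE] : exists c : int, m = (p ^ k.-1)%N%:Z * c.
  have : ((p ^ k.-1)%N %| m)%Z by rewrite dvdzE /= pfactor_dvdn.
  by move=> /dvdzP[c ->]; exists c; rewrite mulrC.
have scP : s * c%:~R \in P.
  apply: (prime_in_dvd hP); exists (v * e).
  apply: (@OF_natrI _ (p ^ k.-1)); first by rewrite expn_gt0 p0.
  have -> : (p ^ k.-1)%:R * (s * c%:~R) = s * m%:~R :> OF.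
    by rewrite cE rmorphM /=; ring.
  by rewrite -dm mulrA sv /k expnS natrM /=; ring.
case/(prime_in_or hP): scP; first by apply/negP.
move=> /(prime_in_int p_pr hP) pc.
have : ((p ^ k)%N %| m)%Z by rewrite cE /k /= expnSr PoszM dvdz_mul.
by rewrite dvdzE /= pfactor_dvdn// /k ltnn.
Qed.

(** If the trace form degenerates modulo [p], its kernel contains some [x]; for a
    prime [P] not containing [x], the sum of the conjugates of [x] times those of
    [z] lies in [P] for all [z], which contradicts their independence. *)
Lemma reduced_gram (b : 'I_n -> OF) : integral_basis b ->
  ~~ (p %| \det (\matrix_(i, j) trO galK (b i * b j)))%Z.
Proof.
move=> bP; apply/negP => /(det_mod_p p_pr)[a [[i0 ai0] aP]].
pose x := \sum_i b i *~ a i.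
have px : ~ dvdO p x by move=> /(basis_dvd bP)/(_ i0); apply/negP.
have trsum (c : 'I_n -> int) y : trO galK (y * \sum_i b i *~ c i) =
    \sum_i c i * trO galK (y * b i).
  rewrite mulr_sumr (big_morph (trO galK) (trOD galK) (_ : _ = 0)); last first.
    by have := trOZ galK 0 0; rewrite mul0r mul0r.
  by apply: eq_bigr => i _; rewrite -mulrzr mulrA mulrzr -mulrzl trOZ.
have xtr y : (p %| trO galK (x * y))%Z.
  have [c [-> _]] := bP y; rewrite trsum; apply: rpred_sum => j _.
  apply: dvdz_mull; have := aP j; congr (_ %| _)%Z.
  rewrite mulrC trsum; apply: eq_bigr => i _; rewrite !mxE.
  by rewrite [b j * _]mulrC.
have [] := annihilator_prime galK p_pr (Q := fun y => exists t, y = t * x).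
- by exists x => //; exists 1; rewrite mul1r.
- by move=> u _ [t ->]; exists (u * t); rewrite mulrA.
move=> y [P [[t yt] py hP inP]].
have xP : x \notin P.
  apply/negP => /inP [v xy]; apply: py; apply: red.
  by rewrite {1}yt -mulrA xy; exists (t * v); ring.
have := conjugates_independent hP (reduced_inertia_trivial hP) (c := fun s => galO s x).
move=> /(_ _ 1%g); rewrite galO_id => H; move/negP: xP; apply; apply: H => z.
have -> : \sum_s galO s x * galO s z = (trO galK (x * z))%:~R.
  by rewrite trO_sum; apply: eq_bigr => s _; rewrite galOM.
by apply: (prime_in_dvd hP); apply: dvdO_int.
Qed.

End Reduced.

(** * Total tame ramification *)

Section IdealPowers.
Variables (R : comNzRingType) (P : {pred R}).
Implicit Types (x y z : R).

Lemma ideal_power0 x : ideal_power P 0 x.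
Proof.
exists 1%N, (fun=> x), (fun _ _ => 0); split; first by move=> _ [].
by rewrite big_ord1 big_ord0 mulr1.
Qed.

Lemma ideal_powerMl e x y : ideal_power P e x -> ideal_power P e (y * x).
Proof.
move=> [m [c [t [tP ->]]]]; exists m, (fun i => y * c i), t; split=> //.
by rewrite mulr_sumr; apply: eq_bigr => i _; rewrite mulrA.
Qed.

Lemma ideal_powerD e x y :
  ideal_power P e x -> ideal_power P e y -> ideal_power P e (x + y).
Proof.
move=> [m [c [t [tP ->]]]] [m' [c' [t' [tP' ->]]]].
exists (m + m')%N, (fun i => match split i with inl j => c j | inr j => c' j end),
  (fun i => match split i with inl j => t j | inr j => t' j end); split.
  by move=> i j; case: (split i).
rewrite big_split_ord /=; congr (_ + _); apply: eq_bigr => i _.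
  by rewrite (unsplitK (inl i)).
by rewrite (unsplitK (inr i)).
Qed.

Lemma ideal_powerB e x y :
  ideal_power P e x -> ideal_power P e y -> ideal_power P e (x - y).
Proof. by move=> xe ye; rewrite -mulN1r; apply/ideal_powerD/ideal_powerMl. Qed.

Lemma ideal_powerS e x z : ideal_power P e x -> z \in P -> ideal_power P e.+1 (x * z).
Proof.
move=> [m [c [t [tP ->]]]] zP.
exists m, c, (fun i j => if unlift ord0 j is Some j' then t i j' else z); split.
  by move=> i j; case: unliftP.
rewrite mulr_suml; apply: eq_bigr => i _; rewrite big_ord_recl unlift_none.
by under [in RHS]eq_bigr => j _ do rewrite liftK; ring.
Qed.

Lemma ideal_powerX e z : z \in P -> ideal_power P e (z ^+ e).
Proof.
move=> zP; elim: e => [|e IH]; first exact: ideal_power0.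
by rewrite exprSr; apply: ideal_powerS.
Qed.

Lemma ideal_powerW e x : ideal_power P e.+1 x -> ideal_power P e x.
Proof.
move=> [m [c [t [tP ->]]]].
exists m, (fun i => c i * t i ord0), (fun i j => t i (lift ord0 j)); split=> //.
by apply: eq_bigr => i _; rewrite big_ord_recl mulrA.
Qed.

Lemma ideal_power_le d e x : (d <= e)%N -> ideal_power P e x -> ideal_power P d x.
Proof.
move=> /subnK <-; elim: (e - d)%N => //= k IH H; apply: IH; exact: ideal_powerW.
Qed.

End IdealPowers.

Section Ramified.
Variables (K : splittingFieldType rat) (galK : galois 1 {:K}).
Local Notation n := (\dim {:K}).
Local Notation T := (gal_of {:K}).
Local Notation OF := (ring_of_integers K).
Variables (p : nat) (p_pr : prime p).
Implicit Types (x y z u v w : OF) (P : {pred OF}).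

(** Each factor in [P] absorbs one factor of the inverse ideal, through [y / p]. *)
Lemma ideal_power_quotient P y e x : (forall s, s \in P -> dvdO p (s * y)) ->
  ideal_power P e x -> dvdO (p ^ e) (y ^+ e * x).
Proof.
move=> Py [m [c [t [tP ->]]]]; rewrite mulr_sumr; apply: dvdO_sum => i _.
rewrite mulrCA; apply: dvdOMl.
elim: e t tP => [|e IH] t tP; first by exists 1; rewrite big_ord0.
rewrite big_ord_recl exprS expnS.
set Q := \prod_(j < e) _; have -> : y * y ^+ e * (t i ord0 * Q) = (t i ord0 * y) * (y ^+ e * Q) by ring.
apply: dvdOM; first (have := Py _ (tP i ord0); by []).
by apply: (IH (fun i j => t i (lift ord0 j))) => *; apply: tP.
Qed.

(** A nilpotent modulo [p] yields a prime [P], the annihilator of [y], and an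
    element [y / p] of its inverse; integral closedness makes [P] invertible
    there, through [w] with [(y / p) w = u] outside [P]. *)
Lemma uniformizer_exists : ~ reduced_mod_p K p ->
  exists (P : {pred OF}) (y w u : OF),
    [/\ Defs.prime_above p P, ~ dvdO p y, forall s, s \in P -> dvdO p (s * y),
        (y \in P) /\ (w \in P) & y * w = p%:R * u /\ u \notin P].
Proof.
move=> nred; have [x [xx px]] : exists x, dvdO p (x * x) /\ ~ dvdO p x.
  apply: contrapT => nx; apply: nred => x xx; apply: contrapT => px.
  by apply: nx; exists x.
have [] := annihilator_prime galK p_pr (Q := fun y => exists t, y = t * x).
- by exists x => //; exists 1; rewrite mul1r.
- by move=> a _ [t ->]; exists (a * t); rewrite mulrA.
move=> y [P [[t yt] py hP inP]].
have yP : y \in P.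
  apply/inP; have -> : y * y = t * t * (x * x) by rewrite yt; ring.
  exact: dvdOMl.
have [w [wP [u [yw uP]]]] : exists w, w \in P /\ exists u, y * w = p%:R * u /\ u \notin P.
  apply: contrapT => nw; apply: py.
  apply: (integrally_closed galK p_pr (L := fun z => z \in P)).
  - by move=> *; apply: (prime_inB hP).
  - by move=> z; apply: (prime_in_dvd hP); apply: dvdO_natr.
  - move=> z zP; have /inP[v zy] := zP; exists v; last by rewrite mulrC.
    apply/negPn/negP => vP; apply: nw; exists z; split=> //; exists v.
    by rewrite mulrC.
by exists P, y, w, u; split=> // s /inP.
Qed.

(** The element [y / p] of the inverse of [P] puts [p] into the square of [P]; and
    [p] is not in all powers of [P], as then [y / p] would be integral. *)
Lemma nonreduced_ramifies : ~ reduced_mod_p K p -> ramifies K p.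
Proof.
move=> /uniformizer_exists[P [y [w [u [hP py Py [yP wP] [yw uP]]]]]].
have p2 : ideal_power P 2 p%:R.
  have [s suP] := prime_inverse galK p_pr hP uP.
  have -> : p%:R = s * (y ^+ 1 * w) - p%:R ^+ 1 * (s * u - 1).
    by rewrite !expr1 yw; ring.
  apply: ideal_powerB; last by apply: ideal_powerS => //; apply/ideal_powerX/prime_inp.
  by apply/ideal_powerMl/ideal_powerS => //; apply: ideal_powerX.
have [k kP] : exists k, ~ ideal_power P k p%:R.
  apply: contrapT => nk; apply: py.
  have allk k : ideal_power P k p%:R by apply: contrapT => H; apply: nk; exists k.
  apply: (integrally_closed galK p_pr (L := fun x => forall k, dvdO (p ^ k) (y ^+ k * x))).
  - by move=> x z Lx Lz k; rewrite mulrBr; apply: dvdOB.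
  - move=> x k; rewrite mulrA; apply: dvdOMr; exact: (ideal_power_quotient Py (allk k)).
  - move=> x Lx; have [v yv] := Lx 1%N; rewrite expr1 expn1 in yv; exists v => // k.
    have [v' v'E] := Lx k.+1; exists v'.
    apply: (@OF_natrI _ p); first exact: prime_gt0.
    have -> : p%:R * (y ^+ k * v) = y ^+ k.+1 * x by rewrite mulrCA -yv exprSr mulrA.
    by rewrite v'E expnS natrM mulrA.
have exk : exists k, `[< ~ ideal_power P k p%:R >] by exists k; apply/asboolP.
case: (ex_minnP exk) => -[|e] /asboolP eP emin; first by case: eP; apply: ideal_power0.
exists P, e; split=> //; last first.
  rewrite ltnNge; apply/negP => e1; apply: eP; apply: ideal_power_le p2; exact: leq_ltn_trans e1 _.
split=> //; apply: contrapT => H.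
by have := emin e (asboolT H); rewrite ltnn.
Qed.

Section TotallyRamified.
Variables (P : {pred OF}) (y w u : OF) (n : nat).
Hypothesis nE : n = \dim {:K}.
Hypothesis hP : Defs.prime_above p P.
Hypothesis Py : forall s, s \in P -> dvdO p (s * y).
Hypothesis wP : w \in P.
Hypothesis yw : y * w = p%:R * u.
Hypothesis uP : u \notin P.
Hypothesis pPn : ideal_power P n p%:R.
Hypothesis npPn1 : ~ ideal_power P n.+1 p%:R.
Hypothesis tame_p : ~~ (p %| n)%N.

Let p0 : (0 < p)%N. Proof. exact: prime_gt0. Qed.
Let pX0 k : (0 < p ^ k)%N. Proof. by rewrite expn_gt0 p0. Qed.
Let n0 : (0 < n)%N. Proof. by rewrite nE adim_gt0. Qed.

Lemma ramified_quotient k : (k <= n)%N -> exists z, y ^+ k * p%:R = (p ^ k)%:R * z.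
Proof. by move=> kn; apply: ideal_power_quotient Py _; apply: ideal_power_le pPn. Qed.

Lemma ywX k : y ^+ k * w ^+ k = (p ^ k)%:R * u ^+ k.
Proof. by rewrite -exprMn yw exprMn natrX. Qed.

(** The quotient of [p y^n] by [p^n] is outside [P], since [p] is not in the
    power [n + 1] of [P]. *)
Lemma ramified_top z : y ^+ n * p%:R = (p ^ n)%:R * z -> z \notin P /\ w ^+ n * z = p%:R * u ^+ n.
Proof.
move=> zE; have wz : w ^+ n * z = p%:R * u ^+ n.
  apply: (OF_natrI (pX0 n)); rewrite mulrCA -zE.
  have -> : w ^+ n * (y ^+ n * p%:R) = (y ^+ n * w ^+ n) * p%:R by ring.
  by rewrite ywX; ring.
split=> //; apply/negP => zP; apply: npPn1.
have [s suP] := prime_inverse galK p_pr hP (prime_notinX hP n uP).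
have -> : p%:R = s * (w ^+ n * z) - p%:R * (s * u ^+ n - 1) by rewrite wz; ring.
apply: ideal_powerB; last exact: ideal_powerS.
by apply/ideal_powerMl/ideal_powerS => //; apply: ideal_powerX.
Qed.

(** Multiplying by the powers of [y / p] lowers the valuation at [P]; the
    lowest coefficient of a combination divisible by [p] is therefore in [P]. *)
Lemma powers_independent t (a : 'I_n -> int) : t \notin P ->
  dvdO p (t * \sum_i (a i)%:~R * w ^+ i) -> forall i, (p %| a i)%Z.
Proof.
move=> tP [v tv] [k kn]; elim/ltn_ind: k kn => k IH kn.
have [z zE] := ramified_quotient (ltnW kn).
have zP : z \in P.
  have [h hE] := ramified_quotient (leqnn n).
  have e : w ^+ (n - k) * h = u ^+ (n - k) * z.
    apply: (OF_natrI (pX0 n)); rewrite mulrCA -hE.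
    have -> : (p ^ n)%:R = (p ^ (n - k))%:R * (p ^ k)%:R :> OF.
      by rewrite -natrM -expnD subnK // ltnW.
    rewrite [in LHS](_ : y ^+ n = y ^+ (n - k) * y ^+ k); last by rewrite -exprD subnK // ltnW.
    have -> : w ^+ (n - k) * (y ^+ (n - k) * y ^+ k * p%:R) =
      (y ^+ (n - k) * w ^+ (n - k)) * (y ^+ k * p%:R) by ring.
    by rewrite ywX zE; ring.
  have : u ^+ (n - k) * z \in P.
    rewrite -e; case: (n - k)%N (subn_gt0 k n) => [|m _]; first by rewrite kn.
    by rewrite exprS; do 2 apply: (prime_inMr hP).
  by case/(prime_in_or hP) => // /negP[]; apply/negP/(prime_notinX hP).
have H (i : 'I_n) : exists r, [/\ (a i)%:~R * w ^+ i * y ^+ k = (p ^ k)%:R * r,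
    (i : nat) != k -> r \in P & (i : nat) = k -> r = (a i)%:~R * u ^+ k].
  case: (ltngtP i k) => ik.
  - have /dvdzP[c ac] : (p %| a i)%Z.
      by have := IH i ik (ltn_ord i); rewrite (_ : Ordinal _ = i) //; apply: val_inj.
    exists (c%:~R * w ^+ i * z); split=> [|_|e]; [|exact: (prime_inMl hP)|by rewrite e ltnn in ik].
    have -> : (p ^ k)%:R * (c%:~R * w ^+ i * z) = c%:~R * w ^+ i * (y ^+ k * p%:R).
      by rewrite zE; ring.
    have -> : (a i)%:~R = c%:~R * p%:R :> OF by rewrite ac rmorphM.
    by ring.
  - exists ((a i)%:~R * u ^+ k * w ^+ (i - k)); split=> [|_|e];
      last by rewrite e ltnn in ik.
      have -> : w ^+ i = w ^+ k * w ^+ (i - k) by rewrite -exprD subnKC // ltnW.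
      have -> : (a i)%:~R * (w ^+ k * w ^+ (i - k)) * y ^+ k =
        (a i)%:~R * w ^+ (i - k) * (y ^+ k * w ^+ k) by ring.
      by rewrite ywX; ring.
    case: (i - k)%N (subn_gt0 k i) => [|m _]; first by rewrite ik.
    by rewrite exprS; apply/(prime_inMl hP)/(prime_inMr hP).
  - exists ((a i)%:~R * u ^+ k); split=> [|/eqP//|//].
    by rewrite ik -mulrA [w ^+ k * _]mulrC ywX; ring.
have [r rP] := choice H.
have sr : t * \sum_i r i = z * v.
  apply: (OF_natrI (pX0 k)); rewrite mulrCA mulr_sumr.
  transitivity (t * (\sum_i (a i)%:~R * w ^+ i) * y ^+ k).
    rewrite -mulrA mulr_suml; congr (_ * _); apply: eq_bigr => i _.
    by have [-> _ _] := rP i.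
  by rewrite tv mulrA -zE; ring.
have : t * \sum_i r i \in P by rewrite sr; apply: (prime_inMr hP).
case/(prime_in_or hP) => [|srP]; first by move/negP: tP.
have : r (Ordinal kn) \in P.
  have := srP; rewrite (bigD1 (Ordinal kn)) //= => srP'.
  rewrite -[r _](addrK (\sum_(i < n | i != Ordinal kn) r i)); apply: (prime_inB hP) => //.
  by apply: (prime_in_sum hP) => i ik; have [_ + _] := rP i; apply.
have [_ _ ->] // := rP (Ordinal kn).
case/(prime_in_or hP) => [|/negP[]]; first exact: (prime_in_int p_pr hP).
exact/negP/(prime_notinX hP).
Qed.

(** The combinations of the powers of [w] with coefficients below [p] are distinct
    modulo [p], and there are as many as classes. *)
Lemma powers_span x : exists a : 'I_n -> int, dvdO p (x - \sum_i (a i)%:~R * w ^+ i).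
Proof.
have [b bP] := integral_basis_exists galK.
pose S (c : {ffun 'I_(\dim {:K}) -> 'I_p}) : OF :=
  \sum_(i < n) (c (cast_ord nE i) : nat)%:Z%:~R * w ^+ i.
have [g gP] := choice (fun c => box_ex galK p_pr bP (S c)).
have ginj : injective g.
  move=> c d gcd; apply/ffunP => i; rewrite -(cast_ordKV nE i).
  move: (cast_ord _ i) => {}i; apply: val_inj => /=.
  have : dvdO p (1 * \sum_(i < n) ((c (cast_ord nE i) : nat)%:Z
      - (d (cast_ord nE i) : nat)%:Z)%:~R * w ^+ i).
    rewrite mul1r (_ : \sum__ _ = (S c - box b (g c)) - (S d - box b (g d))).
      exact: dvdOB.
    rewrite gcd opprB addrA subrK /S -sumrB.
    by apply: eq_bigr => j _; rewrite rmorphB mulrBl.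
  move=> /(powers_independent (prime_notin1 hP))/(_ i).
  by rewrite -eqz_mod_dvd => /eqP; rewrite !modz_small ?ltz_nat ?ltn_ord// => -[].
have [c xc] := box_ex galK p_pr bP x.
have /codomP[d cd] := inj_card_onto ginj (leqnn _) c.
exists (fun i => (d (cast_ord nE i) : nat)%:Z).
have -> : x - \sum_(i < n) (d (cast_ord nE i) : nat)%:Z%:~R * w ^+ i =
   (x - box b c) - (S d - box b (g d)) by rewrite cd -/(S d); ring.
exact: dvdOB.
Qed.

Lemma powers_tail (a : 'I_n -> int) : exists r,
  \sum_i (a i)%:~R * w ^+ i = (a (Ordinal n0))%:~R + w * r.
Proof.
exists (\sum_(i < n | i != Ordinal n0) (a i)%:~R * w ^+ i.-1).
rewrite (bigD1 (Ordinal n0)) //= expr0 mulr1; congr (_ + _); rewrite mulr_sumr.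
apply: eq_bigr => i i0; rewrite mulrCA -exprS prednK// lt0n.
by apply: contraNneq i0 => i0; apply/eqP/val_inj.
Qed.

(** All powers of [w] but the first lie in [P]: the residue field is the prime
    field. *)
Lemma residue_int x : exists a : int, x - a%:~R \in P.
Proof.
have [a xa] := powers_span x; have [r rE] := powers_tail a; exists (a (Ordinal n0)).
rewrite -(subrK (\sum_i (a i)%:~R * w ^+ i) x) -addrA; apply: (prime_inD hP).
  exact: (prime_in_dvd hP).
by rewrite rE addrAC subrr add0r; apply: (prime_inMr hP).
Qed.

Lemma notinP_cancel t x : t \notin P -> dvdO p (t * x) -> dvdO p x.
Proof.
move=> tP tx; have [a xa] := powers_span x.
rewrite -(subrK (\sum_i (a i)%:~R * w ^+ i) x); apply: dvdOD => //.
apply: dvdO_sum => i _; apply/dvdOMr/dvdO_int; apply: (powers_independent tP).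
rewrite -[X in t * X](subKr x) mulrBr; apply: dvdOB => //; exact: dvdOMl.
Qed.

(** So [p] is [w ^ n] times a unit at [P]. *)
Lemma uniformizer_top : exists z, w ^+ n = p%:R * z /\ z \notin P.
Proof.
have [h hE] := ramified_quotient (leqnn n); have [hP' wh] := ramified_top hE.
have [z wz] : dvdO p (w ^+ n).
  by apply: (notinP_cancel hP'); rewrite mulrC wh; apply: dvdO_natr.
exists z; split=> //; apply/negP => zP; move/negP: (prime_notinX hP n uP); apply.
have <- : z * h = u ^+ n.
  by apply: (OF_natrI p0); rewrite -wh wz mulrA.
exact: (prime_inMr hP).
Qed.

(** The [n]-th power of [P] is divisible by [p], a condition that does not mention
    [P]. *)
Lemma inP_powX x : x \in P -> dvdO p (x ^+ n).
Proof.
move=> xP; have [a xa] := powers_span x; have [r rE] := powers_tail a.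
have pa : (p %| a (Ordinal n0))%Z.
  apply: (prime_in_int p_pr hP); rewrite -[_%:~R](addrK (w * r)) -rE.
  apply: (prime_inB hP); last exact: (prime_inMr hP).
  rewrite -[X in X \in P](subKr x); apply: (prime_inB hP) => //.
  exact: (prime_in_dvd hP).
have [z [wz _]] := uniformizer_top.
have xw : dvdO p (x ^+ n - (w * r) ^+ n).
  apply: dvdO_subX; have -> : x - w * r =
    (x - \sum_i (a i)%:~R * w ^+ i) + (a (Ordinal n0))%:~R by rewrite rE; ring.
  by apply: dvdOD => //; apply: dvdO_int.
rewrite -(subrK ((w * r) ^+ n) (x ^+ n)); apply: dvdOD => //.
by rewrite exprMn wz; apply/dvdOMr/dvdO_natr.
Qed.

(** [P] is the only prime above [p], hence Galois stable. *)
Lemma inP_gal s x : x \in P -> galO s x \in P.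
Proof.
move=> /inP_powX/(galO_dvd s)/(prime_in_dvd hP); rewrite galOX => sx.
by apply/negPn/negP => H; move: sx; apply/negP/(prime_notinX hP).
Qed.

Lemma inP_trace x : x \in P -> (p %| trO galK x)%Z.
Proof.
move=> xP; apply: (prime_in_int p_pr hP); rewrite trO_sum.
by apply: (prime_in_sum hP) => s _; apply: inP_gal.
Qed.

(** The form [(n tr (x z) - tr x tr z) / p + tr x tr z] is nondegenerate modulo
    [p]: test the lowest term [a w^k] of [x] against [z = w^(n-k)], for which
    [tr (x z) = p tr (a w^n / p)] is [p n a] times a unit. *)
Lemma ramified_kernel x :
  (forall z, exists d : int,
     n%:Z * trO galK (x * z) - trO galK x * trO galK z = p%:Z * d /\
     (p %| d + trO galK x * trO galK z)%Z) -> dvdO p x.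
Proof.
move=> H; have [a xa] := powers_span x.
have tr1 : trO galK 1 = n%:Z by rewrite (trO1 galK) nE.
have copn (c : int) : (p %| n%:Z * c)%Z -> (p %| c)%Z.
  by rewrite Gauss_dvdzr// coprimezE prime_coprime.
have trc (c : int) z : trO galK (z - c%:~R) = trO galK z - c * n%:Z.
  have -> : z - c%:~R = z + (- c)%:~R * 1 by rewrite mulr1 rmorphN.
  by rewrite trOD trOZ tr1 mulNr.
suff pa : forall i, (p %| a i)%Z.
  rewrite -(subrK (\sum_i (a i)%:~R * w ^+ i) x); apply: dvdOD => //.
  by apply: dvdO_sum => i _; apply/dvdOMr/dvdO_int.
have [v xv] := xa.
have pa0 : (p %| a (Ordinal n0))%Z.
  have [d []] := H 1; rewrite mulr1 tr1 mulrC subrr => /esym/eqP.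
  rewrite mulf_eq0 eqz_nat gtn_eqF //= => /eqP ->; rewrite add0r mulrC => /copn ptx.
  have [r rE] := powers_tail a.
  have : x - (a (Ordinal n0))%:~R \in P.
    have -> : x - (a (Ordinal n0))%:~R = p%:R * v + w * r by rewrite -xv rE; ring.
    by apply: (prime_inD hP); apply: (prime_inMr hP); rewrite ?(prime_inp hP).
  move=> /inP_trace; rewrite trc => h; apply: copn.
  have -> : n%:Z * a (Ordinal n0) = trO galK x - (trO galK x - a (Ordinal n0) * n%:Z) by ring.
  exact: rpredB.
have xP : x \in P.
  have [r rE] := powers_tail a.
  have -> : x = p%:R * v + (a (Ordinal n0))%:~R + w * r by rewrite -xv rE; ring.
  apply: (prime_inD hP); last exact: (prime_inMr hP).
  apply: (prime_inD hP); last by apply: (prime_in_dvd hP); apply: dvdO_int.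
  by apply: (prime_inMr hP); apply: (prime_inp hP).
move=> [k kn]; elim/ltn_ind: k kn => k IH kn.
have [k0|k0] := posnP k.
  by rewrite (_ : Ordinal kn = Ordinal n0) //; apply: val_inj.
have nk0 : (0 < n - k)%N by rewrite subn_gt0.
have wkP : w ^+ (n - k) \in P.
  by case: (n - k)%N nk0 => // m _; rewrite exprS; apply: (prime_inMr hP).
have [z [wz zP]] := uniformizer_top.
have Hi (i : 'I_n) : exists r, [/\ (a i)%:~R * w ^+ i * w ^+ (n - k) = p%:R * r,
    (i : nat) != k -> r \in P & (i : nat) = k -> r = (a i)%:~R * z].
  case: (ltngtP i k) => ik.
  - have /dvdzP[c ac] : (p %| a i)%Z.
      by have := IH i ik (ltn_ord i); rewrite (_ : Ordinal _ = i) //; apply: val_inj.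
    have ac' : (a i)%:~R = c%:~R * p%:R :> OF by rewrite ac rmorphM.
    exists (c%:~R * w ^+ i * w ^+ (n - k)); split=> [|_|e].
    + by rewrite ac'; move: (w ^+ (n - k)) => W; ring.
    + exact: (prime_inMl hP).
    + by rewrite e ltnn in ik.
  - exists ((a i)%:~R * z * w ^+ (i - k)); split=> [|_|e]; last by rewrite e ltnn in ik.
      have e : w ^+ i * w ^+ (n - k) = w ^+ n * w ^+ (i - k).
        by rewrite -!exprD; congr (w ^+ _); have := ltnW ik; clear -kn; lia.
      by rewrite -mulrA e wz; ring.
    apply: (prime_inMl hP); case: (i - k)%N (subn_gt0 k i) => [|m _]; first by rewrite ik.
    by rewrite exprS; apply: (prime_inMr hP).
  - exists ((a i)%:~R * z); split=> [|/eqP//|//].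
    by rewrite ik -mulrA -exprD subnKC ?wz 1?ltnW//; ring.
have [r rP] := choice Hi.
have pa_k : exists2 q, q \in P & x * w ^+ (n - k) = p%:R * ((a (Ordinal kn))%:~R * z + q).
  exists (\sum_(i | i != Ordinal kn) r i + v * w ^+ (n - k)).
    apply: (prime_inD hP); last exact: (prime_inMl hP).
    by apply: (prime_in_sum hP) => i ik; have [_ + _] := rP i; apply.
  have -> : x = p%:R * v + \sum_i (a i)%:~R * w ^+ i by rewrite -xv subrK.
  rewrite mulrDl mulr_suml.
  have -> : \sum_i (a i)%:~R * w ^+ i * w ^+ (n - k) = p%:R * \sum_i r i.
    by rewrite mulr_sumr; apply: eq_bigr => i _; have [-> _ _] := rP i.
  rewrite (bigD1 (Ordinal kn)) //=; have [_ _ ->] // := rP (Ordinal kn).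
  by move: (w ^+ (n - k)) (\sum_(i < n | _) _) => W S; ring.
have [q qP xq] := pa_k.
have [d [dE pd]] := H (w ^+ (n - k)).
have /dvdzP[c1 c1E] := inP_trace xP; have /dvdzP[c2 c2E] := inP_trace wkP.
have pd' : (p %| d)%Z.
  rewrite -[d](addrK (trO galK x * trO galK (w ^+ (n - k)))); apply: rpredB => //.
  by rewrite c1E; apply/dvdz_mulr/dvdz_mull.
have : (p %| n%:Z * trO galK ((a (Ordinal kn))%:~R * z + q))%Z.
  move/dvdzP: pd' => [d' d'E]; apply/dvdzP; exists (d' + c1 * c2).
  apply: (@mulfI _ p%:Z); first by rewrite eqz_nat gtn_eqF.
  move: dE; rewrite xq trO_natZ d'E c1E c2E => /eqP; rewrite subr_eq => /eqP dE.
  rewrite mulrCA dE; ring.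
move=> /copn; rewrite trOD trOZ => pq.
have : (p %| a (Ordinal kn) * trO galK z)%Z.
  rewrite -[_ * _](addrK (trO galK q)); apply: rpredB => //; exact: inP_trace.
rewrite Gauss_dvdzl// coprimezE prime_coprime//; apply/negP => pz.
have [c zc] := residue_int z.
have pcn : (p %| n%:Z * c)%Z.
  have -> : n%:Z * c = trO galK z - (trO galK z - c * n%:Z) by ring.
  by apply: rpredB => //; rewrite -trc; apply: inP_trace.
move/negP: zP; apply; rewrite -(subrK c%:~R z); apply: (prime_inD hP) => //.
by apply: (prime_in_dvd hP); apply/dvdO_int/copn.
Qed.
End TotallyRamified.
End Ramified.

(** * The integral trace form at a prime *)

Section LocalGram.
Variables (K : splittingFieldType rat) (galK : galois 1 {:K}).
Hypothesis oddK : odd (\dim {:K}).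
Local Notation n := (\dim {:K}).
Local Notation T := (gal_of {:K}).
Local Notation OF := (ring_of_integers K).
Implicit Types (x y z u v w : OF).
Local Notation tr := (trO galK).

Lemma trO_sum_lin (I : finType) (c : I -> int) (f : I -> OF) :
  tr (\sum_i (c i)%:~R * f i) = \sum_i c i * tr (f i).
Proof.
rewrite (big_morph tr (trOD galK) (_ : tr 0 = 0)); last first.
  by have := trOZ galK 0 0; rewrite mul0r mul0r.
by apply: eq_bigr => i _; rewrite trOZ.
Qed.

(** Here [e] is the second elementary symmetric function of the values of [f]. *)
Lemma sum_square (f : T -> OF) (r : seq T) : exists e,
  (\sum_(s <- r) f s) ^+ 2 = \sum_(s <- r) f s ^+ 2 + 2%:R * e /\
  forall p (P : {pred OF}), Defs.prime_above p P -> (forall s, f s \in P) -> e \in P.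
Proof.
elim: r => [|s r [e [eE eP]]].
  exists 0; split=> [|p P hP _]; last exact: (prime_in0 hP).
  by rewrite !big_nil expr0n mulr0 addr0.
exists (e + f s * \sum_(t <- r) f t); split=> [|p P hP fP].
  by rewrite !big_cons sqrrD eE; ring.
by apply: (prime_inD hP); [apply: eP hP fP|apply/(prime_inMr hP)/fP].
Qed.

(** The second elementary symmetric function of the conjugates is a rational
    integer. *)
Lemma trace_square x : exists e : int, tr x ^+ 2 = tr (x * x) + 2 * e /\
  forall p (P : {pred OF}), prime p -> Defs.prime_above p P ->
    (forall s, galO s x \in P) -> (p %| e)%Z.
Proof.
have [e [eE eP]] := sum_square (fun s => galO s x) (index_enum T).
have e2 : 2%:R * e = (tr x ^+ 2 - tr (x * x))%:~R :> OF.
  rewrite rmorphB rmorphXn /= !trO_sum eE.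
  have -> : \sum_s galO s (x * x) = \sum_s galO s x ^+ 2.
    by apply: eq_bigr => s _; rewrite galOM.
  by rewrite addrAC subrr add0r.
have [m mE] : exists m : int, (tr x ^+ 2 - tr (x * x))%:~R / 2 = m%:~R :> rat.
  apply: (@int_of_integral K).
  have -> : ((tr x ^+ 2 - tr (x * x))%:~R / 2 : rat)%:A = val e.
    have /(congr1 val) := e2; rewrite OF_valM OF_valn rmorph_int -ratz_alg => e2'.
    apply: (@mulfI _ (2%:R : K)).
      by rewrite -(rmorph_nat (in_alg K)) fmorph_eq0 pnatr_eq0.
    rewrite e2' -(rmorph_nat (in_alg K)) -[_%:A]/(in_alg K _) -rmorphM /=.
    by congr (_ *: _); field.
  exact: OF_integral.
have mE' : tr x ^+ 2 - tr (x * x) = 2 * m.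
  by apply: trO_inj; rewrite [RHS]rmorphM /= -mE [RHS]mulrC divfK.
have em : e = m%:~R.
  apply: (@OF_natrI _ 2) => //; rewrite e2 mE' rmorphM //.
exists m; split; first by rewrite -mE' addrC subrK.
move=> p P p_pr hP xP; apply: (prime_in_int p_pr hP); rewrite -em.
exact: eP hP xP.
Qed.

Lemma trace_gramE m (b : 'I_m -> OF) :
  trace_gram b = map_mx intr (\matrix_(i, j) tr (b i * b j)).
Proof. by apply/matrixP => i j; rewrite !mxE trOE. Qed.

Section AtPrime.
Variables (p : nat) (p_pr : prime p).

(** The element [y = n x - tr x] has trace zero and lies in [P] with its
    conjugates, so that [tr (y * y) = - 2 e] with [e] in [P], that is, even. *)
Lemma trace_form_even_ramified (P : {pred OF}) x : p = 2%N ->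
  Defs.prime_above p P -> (forall s z, z \in P -> galO s z \in P) ->
  (exists a : int, x - a%:~R \in P) -> (forall z, z \in P -> (p %| tr z)%Z) ->
  (4 %| n%:Z * tr (x * x) - tr x ^+ 2)%Z.
Proof.
move=> p2 hP stabP [a xa] trP.
pose y := n%:R * x - (tr x)%:~R.
have trc (c : int) z : tr (z - c%:~R) = tr z - c * n%:Z.
  have -> : z - c%:~R = z + (- c)%:~R * 1 by rewrite mulr1 rmorphN.
  by rewrite trOD trOZ trO1 mulNr.
have yP : y \in P.
  have trx : (tr x)%:~R - (a * n%:Z)%:~R \in P.
    rewrite -rmorphB; apply: (prime_in_dvd hP); apply: dvdO_int.
    by rewrite -trc; apply: trP.
  have -> : y = n%:R * (x - a%:~R) - ((tr x)%:~R - (a * n%:Z)%:~R).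
    by rewrite /y rmorphM /=; ring.
  by apply: (prime_inB hP) => //; apply: (prime_inMl hP).
have try0 : tr y = 0 by rewrite /y trc trO_natZ mulrC subrr.
have [e [ye eP]] := trace_square y.
have e2 : (2 %| e)%Z.
  by have := eP p P p_pr hP (fun s => stabP s y yP); rewrite p2.
have yy : tr (y * y) = n%:Z * (n%:Z * tr (x * x) - tr x ^+ 2).
  have -> : y * y = n%:R * (n%:R * (x * x)) + ((- 2 * n%:Z * tr x)%:~R * x + (tr x ^+ 2)%:~R * 1).
    rewrite /y; move: (tr x) (n) => c m; rewrite ?rmorphM ?rmorphXn /= ?rmorphN ?rmorphM /=; ring.
  by rewrite !trOD !trOZ !trO_natZ trO1; ring.
have c4 : coprimez 4%:Z n%:Z by rewrite coprimezE /= (@coprime_pexpl 2 2) // coprime2n.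
rewrite -(Gauss_dvdzr _ c4) -yy.
move: ye; rewrite try0 expr0n /= => /esym/eqP; rewrite addr_eq0 => /eqP ->.
by have /dvdzP[c ->] := e2; apply/dvdzP; exists (- c); ring.
Qed.

Lemma trace_form_even x : (2 %| n%:Z * tr (x * x) - tr x ^+ 2)%Z.
Proof.
have [e [-> _]] := trace_square x.
have nE : n%:Z = 1 + 2 * (n./2)%:Z.
  by rewrite -{1}(odd_double_half n) oddK -muln2 PoszD PoszM mulrC.
have -> : n%:Z * tr (x * x) - (tr (x * x) + 2 * e) = 2 * ((n./2)%:Z * tr (x * x) - e).
  by rewrite nE; ring.
by rewrite dvdz_mulr.
Qed.

Hypothesis ramK : totally_ramified K.
Hypothesis tameK : tame K.

(** If the trace form degenerates modulo [p], the integers are not reduced modulo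
    [p], and [p] ramifies. *)
Lemma ramified_setup (b : 'I_n -> OF) : integral_basis b ->
  (p %| \det (\matrix_(i, j) tr (b i * b j)))%Z ->
  exists (P : {pred OF}) (y w u : OF),
  [/\ Defs.prime_above p P, forall s, s \in P -> dvdO p (s * y), w \in P,
      y * w = p%:R * u & u \notin P] /\
  [/\ ideal_power P n p%:R, ~ ideal_power P n.+1 p%:R & ~~ (p %| n)%N].
Proof.
move=> bP pd; have nred : ~ reduced_mod_p K p.
  by move=> /(reduced_gram galK p_pr)/(_ _ bP); rewrite pd.
have [P [y [w [u [hP _ Py [_ wP] [yw uP]]]]]] := uniformizer_exists galK p_pr nred.
have Pn := ramK p_pr (nonreduced_ramifies galK p_pr nred) hP.
have tame_p := tameK p_pr hP Pn.
by exists P, y, w, u; case: Pn.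
Qed.

(** The common divisor, at [p], of the form on the orthogonal complement of [1]. *)
Definition local_scale m (b : 'I_m -> OF) : nat :=
  if (p %| \det (\matrix_(i, j) tr (b i * b j)))%Z then p else 1%N.

(** The element [1] has length [n], a unit at [p], and splits off the trace form.
    If [p] ramifies, the elements of trace zero lie in the prime above [p]: their
    form is divisible by [p], and unimodular after the division. *)
Lemma local_gram m (b : 'I_m -> OF) : integral_basis b -> ~~ (p %| n)%N ->
  exists D : 'M[int]_m,
  [/\ forall i j, (local_scale b)%:Z * D i j = n%:Z * tr (b i * b j) - tr (b i) * tr (b j),
      p = 2%N -> forall i, (2 %| D i i)%Z &
      ~~ (p %| \det (\matrix_(i, j) (D i j + tr (b i) * tr (b j))))%Z].
Proof.
move=> bP pn; have mn := integral_basis_size bP; subst m.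
rewrite /local_scale; case: ifPn => [pd|pd]; last first.
  exists (\matrix_(i, j) (n%:Z * tr (b i * b j) - tr (b i) * tr (b j))); split.
  - by move=> i j; rewrite mul1r mxE.
  - move=> _ i; rewrite mxE -expr2; exact: trace_form_even.
  rewrite (_ : \matrix_(i, j) _ = n%:Z *: \matrix_(i, j) tr (b i * b j)); last first.
    by apply/matrixP => i j; rewrite !mxE subrK.
  rewrite detZ dvdzE abszM abszX Euclid_dvdM// negb_or Euclid_dvdX// (negPf pn) /=.
  by move: pd; rewrite dvdzE.
have [P [y [w [u [[hP Py wP yw uP] [pPn npPn1 _]]]]]] := ramified_setup bP pd.
have res := residue_int galK p_pr (erefl n) hP Py wP yw uP pPn.
have trP := inP_trace galK p_pr (erefl n) hP Py wP yw uP pPn npPn1.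
have galP := inP_gal galK p_pr (erefl n) hP Py wP yw uP pPn npPn1.
have trc (c : int) z : tr (z - c%:~R) = tr z - c * n%:Z.
  have -> : z - c%:~R = z + (- c)%:~R * 1 by rewrite mulr1 rmorphN.
  by rewrite trOD trOZ trO1 mulNr.
have trres x a : x - a%:~R \in P -> exists c, tr x = a * n%:Z + p%:Z * c.
  by move=> /trP; rewrite trc => /dvdzP[c cE]; exists c; rewrite [p%:Z * c]mulrC -cE addrC subrK.
have dvd x z : (p %| n%:Z * tr (x * z) - tr x * tr z)%Z.
  have [a xa] := res x; have [c zc] := res z.
  have [e1 e1E] := trres _ _ xa; have [e2 e2E] := trres _ _ zc.
  have : x * z - (a * c)%:~R \in P.
    have -> : x * z - (a * c)%:~R = (x - a%:~R) * z + a%:~R * (z - c%:~R).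
      by rewrite rmorphM /=; ring.
    by apply: (prime_inD hP); [apply: (prime_inMr hP)|apply: (prime_inMl hP)].
  move=> /trres[e3 e3E]; rewrite e1E e2E e3E; apply/dvdzP.
  exists (n%:Z * e3 - a * n%:Z * e2 - e1 * c * n%:Z - p%:Z * e1 * e2).
  by move: (n%:Z) => N; ring.
have H (ij : 'I_n * 'I_n) : exists d : int,
    n%:Z * tr (b ij.1 * b ij.2) - tr (b ij.1) * tr (b ij.2) = p%:Z * d.
  by have /dvdzP[d dE] := dvd (b ij.1) (b ij.2); exists d; rewrite dE mulrC.
have [D DE] := choice H; exists (\matrix_(i, j) D (i, j)); split.
- by move=> i j; rewrite mxE -DE.
- move=> p2 i; rewrite mxE; have := trace_form_even_ramified p2 hP galP (res (b i)) trP.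
  rewrite expr2 (DE (i, i)) p2 -[4]/(2%N%:Z * 2%N%:Z) dvdz_mul2l //.
apply/negP => /(det_mod_p p_pr)[a [[i0 ai0] aP]].
pose x := \sum_i b i *~ a i.
have xE : x = \sum_i (a i)%:~R * b i by apply: eq_bigr => i _; rewrite mulrzl.
have : dvdO p x.
  apply: (ramified_kernel p_pr (erefl n) hP Py wP yw uP pPn npPn1 pn (galK := galK)) => z.
  have [c [zE _]] := bP z.
  have zE' : z = \sum_j (c j)%:~R * b j by rewrite zE; apply: eq_bigr => j _; rewrite mulrzl.
  have xz : tr (x * z) = \sum_j c j * \sum_i a i * tr (b i * b j).
    have -> : x * z = \sum_j (c j)%:~R * (\sum_i (a i)%:~R * (b i * b j)).
      rewrite {1}zE' mulr_sumr; apply: eq_bigr => j _; rewrite mulrCA; congr (_ * _).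
      by rewrite xE mulr_suml; apply: eq_bigr => i _; rewrite mulrA.
    by rewrite trO_sum_lin; apply: eq_bigr => j _; rewrite trO_sum_lin.
  have xzt : tr x * tr z = \sum_j c j * \sum_i a i * (tr (b i) * tr (b j)).
    rewrite zE' trO_sum_lin mulr_sumr; apply: eq_bigr => j _; rewrite mulrCA; congr (_ * _).
    by rewrite xE trO_sum_lin mulr_suml; apply: eq_bigr => i _; rewrite mulrA.
  exists (\sum_j c j * \sum_i a i * D (i, j)); split.
    rewrite xz xzt !mulr_sumr -sumrB; apply: eq_bigr => j _.
    rewrite mulrCA -mulrBr [RHS]mulrCA; congr (_ * _).
    rewrite !mulr_sumr -sumrB; apply: eq_bigr => i _.
    by rewrite mulrCA -mulrBr (DE (i, j)) mulrCA.
  rewrite xzt -big_split; apply: rpred_sum => j _ /=; rewrite -mulrDr -big_split /=.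
  apply: dvdz_mull; have := aP j; congr (_ %| _)%Z; apply: eq_bigr => i _.
  by rewrite !mxE mulrDr.
by move=> /(basis_dvd bP)/(_ i0); apply/negP.
Qed.

(** The change from the trace form to the form of [local_gram] multiplies it by
    [n], and divides it by the scale on the complement of [1]. *)
Lemma local_gram_det m (b : 'I_m -> OF) (lam : nat) (D : 'M[int]_m) :
  integral_basis b ->
  (forall i j, lam%:Z * D i j = n%:Z * tr (b i * b j) - tr (b i) * tr (b j)) ->
  lam%:Z ^+ m * \det (\matrix_(i, j) (D i j + tr (b i) * tr (b j))) =
  n%:Z ^+ m * \det (\matrix_(i, j) tr (b i * b j)) * lam%:Z.
Proof.
move=> bP DE; have [e [e1 _]] := bP 1.
have n0 : n%:R != 0 :> rat by rewrite pnatr_eq0 -lt0n adim_gt0.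
pose M : 'M[rat]_m := map_mx intr (\matrix_(i, j) tr (b i * b j)).
pose t : 'rV[rat]_m := \row_i (tr (b i))%:~R.
pose E : 'cV[rat]_m := \col_i (e i)%:~R.
have ME i : (M *m E) i 0 = t 0 i.
  rewrite !mxE; transitivity ((\sum_j e j * tr (b i * b j))%:~R : rat).
    by rewrite rmorph_sum; apply: eq_bigr => j _; rewrite !mxE rmorphM mulrC.
  rewrite -trO_sum_lin; congr (_%:~R); congr tr.
  rewrite -[RHS]mulr1 {2}e1 mulr_sumr; apply: eq_bigr => j _.
  by rewrite mulrCA; congr (_ * _); rewrite mulrzl.
have tE : (t *m E) 0 0 = n%:R.
  rewrite mxE; transitivity ((\sum_j e j * tr (b j))%:~R : rat).
    by rewrite rmorph_sum; apply: eq_bigr => j _; rewrite !mxE rmorphM mulrC.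
  rewrite -trO_sum_lin -[RHS]/(n%:Z%:~R) -(trO1 galK); congr (_%:~R); congr tr.
  by rewrite [RHS]e1; apply: eq_bigr => j _; rewrite mulrzl.
pose C : 'M[int]_m := \matrix_(i, j) (D i j + tr (b i) * tr (b j)).
have CE : lam%:R *: map_mx intr C = n%:R *: (M *m (1%:M + E *m (((lam%:R - 1) / n%:R) *: t))).
  apply/matrixP => i j; set c := (_ / _).
  have entry : (M *m E *m (c *: t)) i j = t 0 i * (c * t 0 j).
    by rewrite mxE big_ord1 ME !mxE.
  rewrite mulmxDr mulmx1 mulmxA [LHS]mxE [RHS]mxE [X in _ = _ * X]mxE entry /c !mxE.
  have DE' : lam%:R * (D i j)%:~R =
      n%:R * (tr (b i * b j))%:~R - (tr (b i))%:~R * (tr (b j))%:~R :> rat.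
    by have /(congr1 (intr : int -> rat)) := DE i j; rewrite rmorphB !rmorphM.
  rewrite rmorphD rmorphM /= mulrDr DE'; move: n0; move: (n%:R : rat) => N N0.
  by field.
have := congr1 determinant CE; rewrite !detZ det_mulmx det_add_rank_one -scalemxAl.
rewrite mxE tE divfK // addrC subrK => detE.
apply: trO_inj; rewrite !rmorphM !rmorphXn /= -!det_map_mx -/M -/C.
by rewrite -[lam%:~R]/(lam%:R) detE mulrA.
Qed.

(** The complement of [1] has rank [n - 1] and is [p] times a unimodular form. *)
Lemma disc_valuation m (b : 'I_m -> OF) : integral_basis b ->
  (p %| \det (\matrix_(i, j) tr (b i * b j)))%Z ->
  (logn p `|\det (\matrix_(i, j) tr (b i * b j))|).+1 = n.
Proof.
move=> bP pd; have mn := integral_basis_size bP; subst m.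
have [_ [_ [_ [_ [_ [_ _ pn]]]]]] := ramified_setup bP pd.
have [D [DE _ pC]] := local_gram bP pn.
have := local_gram_det bP DE; rewrite /local_scale pd.
move=> /(congr1 (fun z : int => logn p `|z|%N)).
set d := \det _ in pd *; set c := \det _ in pC *.
have d0 : d != 0.
  have := trace_gram_unit galK (integral_basis_free bP).
  rewrite -(discE galK bP) (discE galK bP); apply: contra_neq => d0.
  by rewrite trace_gramE det_map_mx -/d d0.
rewrite !abszM !abszX /= => H.
have n0 : (0 < n)%N by rewrite adim_gt0.
have c0' : c != 0 by apply: contraNneq pC => ->; rewrite dvdz0.
have c0 : (0 < `|c|)%N by rewrite absz_gt0; apply: contraNneq pC => ->; rewrite dvdz0.
move: H; rewrite !lognM ?muln_gt0 ?expn_gt0 ?absz_gt0 ?n0 ?(prime_gt0 p_pr)//.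
rewrite !lognX (logn_prime _ p_pr) eqxx muln1.
rewrite (lognE p `|c|) p_pr c0 /= (_ : (p %| `|c|)%N = false); last first.
  by apply/negbTE; move: pC; rewrite dvdzE.
rewrite (lognE p n) p_pr n0 /= (negPf pn) muln0 add0n addn0 addn1.
by move=> ->.
Qed.

End AtPrime.
End LocalGram.

(** A ramified prime exhibits the degree in the discriminant; without ramified
    primes Minkowski's theorem applies. *)
Lemma dim_of_disc (K L : splittingFieldType rat) :
  galois 1 {:K} -> galois 1 {:L} -> odd (\dim {:K}) -> odd (\dim {:L}) ->
  totally_ramified K -> totally_ramified L -> tame K -> tame L ->
  disc K = disc L -> \dim {:K} = \dim {:L}.
Proof.
move=> galK galL oddK oddL ramK ramL tameK tameL dKL.
have [b bP] := integral_basis_exists galK; have [c cP] := integral_basis_exists galL.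
have dK := discE galK bP; have dL := discE galL cP.
rewrite (trace_gramE galK) det_map_mx in dK; rewrite (trace_gramE galL) det_map_mx in dL.
set d := \det _ in dK; set e := \det _ in dL.
have de : d = e by apply: trO_inj; rewrite -dK -dL.
have [Y YB] := trace_form_orthonormal galK oddK bP.
have dpos : 0 < d.
  have := congr1 determinant YB; rewrite !det_mulmx det_tr det1 -(discE galK bP) dK => H.
  rewrite -(ltr_int rat) ltNge; apply/negP => d0.
  have := @ltr01 rat; rewrite -H mulrAC -expr2 ltNge => /negP; apply.
  by rewrite mulr_ge0_le0 ?sqr_ge0.
have [d1|d1] := eqVneq d 1.
  rewrite (unimodular_trivial galK oddK) ?dK ?d1//.
  by rewrite (unimodular_trivial galL oddL) ?dL -?de ?d1.
have d1' : (1 < `|d|)%N by move: dpos d1; case: d {de dK} => // -[|[]].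
have pp := pdiv_prime d1'.
have pd : (pdiv `|d| %| d)%Z by rewrite dvdzE /= pdiv_dvd.
have := disc_valuation (galK := galK) oddK pp ramK tameK bP pd.
rewrite -/d de => <-; apply: (disc_valuation (galK := galL) oddL _ ramL tameL cP).
  by rewrite -de.
by rewrite -/e -de.
Qed.

(** * The p-adic numbers *)

Section PadicInt.
Variables (p : nat) (p_pr : prime p).
Local Notation R := (padic_int p_pr).
Local Notation k := (padic p_pr).
Implicit Types (x y z r s t c d : R) (n m : nat).

Lemma padic_resB x y n : (x - y) n = ((x n - y n) %% (p ^ n)%N)%Z.
Proof. by rewrite /= modzDmr. Qed.

Lemma padic_resM x y n : (x * y) n = (x n * y n %% (p ^ n)%N)%Z.
Proof. by []. Qed.

Lemma padic_eq_mod x y n : (x - y) n = 0 <-> x n = y n.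
Proof.
rewrite padic_resB; split=> [/dvdz_mod0P|->]; last by rewrite subrr mod0z.
by rewrite -eqz_mod_dvd => /eqP; rewrite !padic_res_mod.
Qed.

Lemma padic_res_pX m r n : (n <= m)%N -> ((p ^ m)%:R * r : R) n = 0.
Proof.
move=> nm; rewrite padic_resM padic_res_natr modzMml.
by apply/dvdz_mod0P/dvdz_mulr; rewrite -(subnK nm) expnD PoszM dvdz_mull.
Qed.

Lemma padic_res0 r : r 0%N = 0.
Proof. by rewrite -padic_res_mod modz1. Qed.

Lemma padic_divp r : r 1%N = 0 -> exists s, r = p%:R * s.
Proof.
move=> r1; have p0 : p%:Z != 0 by have := prime_gt0 p_pr; lia.
have pr n : r n.+1 = p%:Z * (r n.+1 %/ p)%Z.
  rewrite mulrC divzK//; have /eqP := r1.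
  by rewrite -(padic_dvdz r 1 n) add1n expn1.
have co : coherent p (fun n => (r n.+1 %/ p)%Z).
  move=> n; apply/eqP; rewrite eqz_mod_dvd -(@dvdz_mul2l p%:Z)//.
  rewrite mulrBr -!pr -PoszM -expnS -eqz_mod_dvd -padic_resP padic_res_mod.
  by [].
exists (mk_padic p_pr co); apply: padicP => n.
rewrite padic_resM padic_res_natr modzMml /= modzMmr -pr.
by rewrite -padic_resP.
Qed.

(** The inverses modulo the powers of [p] are coherent. *)
Lemma padic_inverse r : r 1%N != 0 -> exists s, s * r = 1.
Proof.
move=> r1.
have cop n : coprimez (p ^ n)%N%:Z (r n).
  case: n => [|n]; first by rewrite expn0 /coprimez gcd1z.
  rewrite coprimezE coprimeXl// prime_coprime//; apply/negP => pr.
  case/negP: r1; rewrite -(padic_dvdz r 1 n) add1n expn1; exact: pr.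
have H n : exists s : int, (s * r n == 1 %[mod (p ^ n)%N])%Z.
  have [[a b] /= ab] := coprimezP _ _ (cop n); exists b.
  by rewrite eqz_mod_dvd -ab opprD addrCA subrr addr0 rpredN dvdz_mull.
have [s sP] := choice H.
have co : coherent p s.
  move=> n; apply/eqP; rewrite eqz_mod_dvd -(Gauss_dvdzl _ (cop n)) mulrBl -eqz_mod_dvd.
  rewrite (eqP (sP n)); have := sP n.+1; rewrite !eqz_mod_dvd => H1.
  have /dvdzP[e eE] : ((p ^ n)%N %| s n.+1 * r n.+1 - 1)%Z.
    by apply: dvdz_trans H1; rewrite expnS PoszM dvdz_mull.
  have /dvdzP[f fE] : ((p ^ n)%N %| r n.+1 - r n)%Z.
    by rewrite -eqz_mod_dvd -padic_resP padic_res_mod.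
  apply/dvdzP; exists (e - s n.+1 * f).
  by rewrite mulrBl -eE -mulrA -fE; ring.
exists (mk_padic p_pr co); apply: padicP => n.
by rewrite padic_resM /= modzMml (eqP (sP n)).
Qed.

Lemma padic_factor r : r != 0 -> exists m s, r = (p ^ m)%:R * s /\ s 1%N != 0.
Proof.
move=> /padic_neq0[n]; elim: n r => [|n IH] r rn; first by rewrite padic_res0 in rn.
have [/padic_divp[s rs]|r1] := eqVneq (r 1%N) 0; last first.
  by exists 0%N, r; rewrite expn0 mul1r.
have [|m [t [st t1]]] := IH s.
  apply: contraNneq rn => sn; rewrite rs padic_resM padic_res_natr modzMml.
  apply/eqP/dvdz_mod0P; rewrite expnS PoszM.
  rewrite dvdz_mul2l; last by have := prime_gt0 p_pr; lia.
  by have := padic_dvdz s n 1; rewrite addn1 sn eqxx => ->.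
by exists m.+1, t; rewrite rs st expnS natrM mulrA.
Qed.

Lemma padic_residue r : exists m : nat, exists s, r = m%:R + p%:R * s.
Proof.
have r1 : 0 <= r 1%N by rewrite -padic_res_mod modz_ge0 // expn1; have := prime_gt0 p_pr; lia.
exists `|r 1%N|%N; have [s sE] : exists s, r - `|r 1%N|%:R = p%:R * s.
  apply: padic_divp; apply/padic_eq_mod; rewrite padic_res_natr gez0_abs//.
  by rewrite padic_res_mod.
by exists s; rewrite -sE addrC subrK.
Qed.

(** Iterate the contraction [t |-> - p c - d t ^ 2] of the multiples of [p]. *)
Lemma padic_hensel c d : exists t, t = - (p%:R * c) - d * t ^+ 2.
Proof.
pose f t := - (p%:R * c) - d * t ^+ 2.
pose x m := iter m f 0.
have xp m : exists s, x m = p%:R * s.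
  elim: m => [|m [s sE]]; first by exists 0; rewrite mulr0.
  by exists (- c - d * p%:R * s ^+ 2); rewrite /x iterS -/(x m) sE /f; ring.
have dx m : exists s, x m.+1 - x m = (p ^ m.+1)%:R * s.
  elim: m => [|m [s sE]]; first by exists (- c); rewrite /x /= /f expn1; ring.
  have [s1 e1] := xp m.+1; have [s2 e2] := xp m.
  exists (- d * (s1 + s2) * s); rewrite expnS natrM.
  have -> : x m.+2 - x m.+1 = - d * (x m.+1 + x m) * (x m.+1 - x m).
    rewrite {1}/x iterS -/(x m.+1) {2}/x iterS -/(x m) /f; ring.
  by rewrite sE e1 e2; ring.
have xS m n : (n <= m.+1)%N -> x m.+1 n = x m n.
  by move=> nm; apply/padic_eq_mod; have [s ->] := dx m; apply: padic_res_pX.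
have xle m n : (n <= m)%N -> x m n = x n n.
  move=> /subnK <-; elim: (m - n)%N => // j IH; rewrite addSn xS//.
  by rewrite -addSn leq_addl.
have co : coherent p (fun n => x n n).
  by move=> n; rewrite -padic_resP padic_res_mod xS.
exists (mk_padic p_pr co); apply: padicP => n; set t := mk_padic p_pr co.
have tn : t n = x n n by rewrite /t /= padic_res_mod.
have fc y z : y n = z n -> f y n = f z n.
  move=> yz; rewrite /f !padic_resB; congr ((_ - _) %% _)%Z.
  by rewrite !padic_resM yz.
by rewrite -[RHS]/(f t n) (fc t (x n) tn) -[f _]/(x n.+1) xS.
Qed.

End PadicInt.

Lemma fraction_ex (R : idomainType) (a : {fraction R}) :
  exists x y : R, y != 0 /\ a = FracField.tofrac x / FracField.tofrac y.
Proof.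
elim/quotW: a => z; exists \n_z, \d_z; have d0 := denom_ratioP z; split=> //.
apply: canRL (mulfK _) _; first by rewrite tofrac_eq0.
unlock FracField.tofrac; rewrite -[LHS]FracField.pi_mul.
apply/eqmodP; rewrite /= FracField.equivfE /FracField.mulf /=.
by rewrite !numden_Ratio ?(oner_neq0, mulf_neq0, mul1r, mulr1)// mulrC.
Qed.

Lemma mulf_div_cancel (F : fieldType) (q r u v : F) : q != 0 -> v != 0 ->
  q * (r * u / (q * v)) = r * (u / v).
Proof. by move=> q0 v0; field; rewrite q0 v0. Qed.

Section PadicField.
Variables (p : nat) (p_pr : prime p).
Local Notation R := (padic_int p_pr).
Local Notation k := (padic p_pr).
Local Notation "x %:F" := (@FracField.tofrac R x).
Implicit Types (a b c d u v : k).

Definition pint a : Prop := exists r : R, a = r%:F.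
Definition punit u : Prop := pint u /\ exists2 v, pint v & v * u = 1.

Lemma pint0 : pint 0. Proof. by exists 0; rewrite rmorph0. Qed.
Lemma pint1 : pint 1. Proof. by exists 1; rewrite rmorph1. Qed.
Lemma pintD a b : pint a -> pint b -> pint (a + b).
Proof. by move=> [r ->] [s ->]; exists (r + s); rewrite rmorphD. Qed.
Lemma pintM a b : pint a -> pint b -> pint (a * b).
Proof. by move=> [r ->] [s ->]; exists (r * s); rewrite rmorphM. Qed.
Lemma pintN a : pint a -> pint (- a).
Proof. by move=> [r ->]; exists (- r); rewrite rmorphN. Qed.
Lemma pintB a b : pint a -> pint b -> pint (a - b).
Proof. by move=> ha hb; apply: pintD => //; apply: pintN. Qed.
Lemma pintX a n : pint a -> pint (a ^+ n).
Proof. by move=> [r ->]; exists (r ^+ n); rewrite rmorphXn. Qed.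
Lemma pint_nat n : pint n%:R.
Proof. by exists n%:R; rewrite rmorph_nat. Qed.
Lemma pint_int (m : int) : pint m%:~R.
Proof. by exists m%:~R; rewrite rmorph_int. Qed.
Lemma padic_p_neq0 : p%:R != 0 :> k.
Proof.
have /pcharf0P -> := padic_pchar p_pr; by rewrite -lt0n prime_gt0.
Qed.

Lemma punit_neq0 u : punit u -> u != 0.
Proof.
move=> [_ [v _ vu]]; apply/negP => /eqP u0; move: vu; rewrite u0 mulr0 => /eqP.
by rewrite eq_sym oner_eq0.
Qed.
Lemma punit_inv u : punit u -> punit u^-1.
Proof.
move=> hu; have u0 := punit_neq0 hu; case: hu => hu [v hv vu].
have -> : u^-1 = v by apply: (mulIf u0); rewrite vu mulVf.
by split=> //; exists u => //; rewrite mulrC.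
Qed.
Lemma punit_int u : punit u -> pint u. Proof. by case. Qed.
Lemma punit_pintV u : punit u -> pint u^-1. Proof. by move/punit_inv/punit_int. Qed.
Lemma punitM u v : punit u -> punit v -> punit (u * v).
Proof.
move=> [hu [u' hu' uu]] [hv [v' hv' vv]]; split; first exact: pintM.
by exists (u' * v'); [apply: pintM|rewrite mulrACA uu vv mulr1].
Qed.
Lemma punit1 : punit 1. Proof. by split; [exact: pint1|exists 1; [exact: pint1|rewrite mulr1]]. Qed.
Lemma punitN u : punit u -> punit (- u).
Proof.
move=> [hu [v hv vu]]; split; first exact: pintN.
by exists (- v); rewrite ?mulrNN//; apply: pintN.
Qed.

Lemma punit_res (r : R) : r 1%N != 0 -> punit r%:F.
Proof.
move=> /padic_inverse[s sr]; split; first by exists r.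
by exists s%:F; [exists s|rewrite -rmorphM sr rmorph1].
Qed.

Lemma pint_factor a : pint a -> a != 0 -> exists m u, punit u /\ a = p%:R ^+ m * u.
Proof.
move=> [r ->]; rewrite tofrac_eq0 => /padic_factor[m [s [-> s1]]].
exists m, s%:F; split; first exact: punit_res.
by rewrite rmorphM natrX rmorphXn rmorph_nat.
Qed.

Lemma padic_factor_ex a : a != 0 ->
  exists m1 m2 u, punit u /\ p%:R ^+ m1 * a = p%:R ^+ m2 * u.
Proof.
have [x [y [y0 ->]]] := fraction_ex a => a0.
have x0 : x%:F != 0 by apply: contraNneq a0 => ->; rewrite mul0r.
have yF0 : y%:F != 0 by rewrite tofrac_eq0.
have [m [u [uu ->]]] := pint_factor (ex_intro _ x erefl) x0.
have [m' [u' [uu' ->]]] := pint_factor (ex_intro _ y erefl) yF0.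
exists m', m, (u / u'); split; first exact/punitM/punit_inv.
have u'0 := punit_neq0 uu'; have p0 := expf_neq0 m' padic_p_neq0.
exact: mulf_div_cancel.
Qed.

Lemma padic_cases a : a != 0 -> exists m u, punit u /\
  (a = p%:R ^+ m * u \/ a = u / p%:R ^+ m).
Proof.
move=> /padic_factor_ex[m1 [m2 [u [uu e]]]].
have p0 n := expf_neq0 n padic_p_neq0.
have [m12|m21] := leqP m1 m2.
  exists (m2 - m1)%N, u; split=> //; left; apply: (mulfI (p0 m1)).
  by rewrite e mulrA -exprD subnKC.
exists (m1 - m2)%N, u; split=> //; right; apply: (canRL (mulfK (p0 _))).
apply: (mulfI (p0 m2)); rewrite -e [a * _]mulrC mulrA -exprD subnKC//.
exact: ltnW.
Qed.

Lemma not_pint_unit_div u m : punit u -> (0 < m)%N -> ~ pint (u / p%:R ^+ m).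
Proof.
move=> [[r ->] [_ [s ->] sr]] m0 [t tE].
have p0 n := expf_neq0 n padic_p_neq0.
have : p%:R ^+ m * (s * t)%:F = 1 
    by rewrite tofracM -tE mulrCA [_ * (_ / _)]mulrC divfK.
rewrite -(rmorph_nat (@FracField.tofrac R)) -rmorphXn -rmorphM => /eqP.
rewrite -(rmorph1 (@FracField.tofrac R)) tofrac_eq => /eqP/(congr1 (fun x : R => x 1%N)).
case: m m0 {tE} => // m _; rewrite -natrX padic_res_pX// -[(1 : R)]/(1%:R) padic_res_natr expn1.
by rewrite modz_small// ltz_nat prime_gt1.
Qed.

Lemma pint_unitP a : pint a -> ~ pint (a / p%:R) -> punit a.
Proof.
move=> ha na; have a0 : a != 0.
  by apply: contra_notN na => /eqP ->; rewrite mul0r; apply: pint0.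
have [[|m] [u [uu aE]]] := pint_factor ha a0; first by rewrite aE mul1r.
case: na; have -> : a / p%:R = p%:R ^+ m * u.
  by apply: (mulIf padic_p_neq0); rewrite divfK ?padic_p_neq0// aE exprSr mulrAC.
by apply/pintM/punit_int => //; apply/pintX/pint_nat.
Qed.

Lemma pint_bound a : exists m, pint (p%:R ^+ m * a).
Proof.
have [->|a0] := eqVneq a 0; first by exists 0%N; rewrite mulr0; apply: pint0.
have p0 n := expf_neq0 n padic_p_neq0.
have [m [u [uu [->|->]]]] := padic_cases a0.
  exists 0%N; rewrite mul1r; apply/pintM/punit_int => //; exact/pintX/pint_nat.
by exists m; rewrite mulrC divfK//; apply: punit_int.
Qed.

Lemma pint_hensel c d : pint c -> pint d ->
  exists2 t, pint t & t = - (p%:R * c) - d * t ^+ 2.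
Proof.
move=> [r ->] [s ->]; have [t tE] := padic_hensel r s.
exists t%:F; first by exists t.
by rewrite {1}tE tofracB tofracN tofracM rmorph_nat tofracM tofracXn.
Qed.

Lemma pint_residue a : pint a -> exists (m : nat) b, pint b /\ a = m%:R + p%:R * b.
Proof.
move=> [r ->]; have [m [s rE]] := padic_residue r.
exists m, s%:F; split; first by exists s.
by rewrite rE rmorphD rmorphM !rmorph_nat.
Qed.

Lemma punit_nat m : ~~ (p %| m)%N -> punit m%:R.
Proof.
move=> pm; have := @punit_res (m%:R : R); rewrite rmorph_nat; apply.
rewrite padic_res_natr expn1; apply: contraNneq pm => /dvdz_mod0P.
by rewrite dvdzE.
Qed.

Lemma punit_intr (m : int) : ~~ (p %| m)%Z -> punit m%:~R.
Proof.
rewrite dvdzE /= => /punit_nat; case: m => m //=; rewrite NegzE rmorphN.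
exact: punitN.
Qed.

Lemma not_pint_pV : ~ pint (p%:R^-1 : k).
Proof.
by move=> h; apply: (@not_pint_unit_div 1 1 punit1) => //; rewrite expr1 div1r.
Qed.

Lemma padic_intr_neq0 (D : int) : D != 0 -> D%:~R != 0 :> k.
Proof.
have natk (j : nat) : (j != 0)%N -> j%:R != 0 :> k.
  by move=> j0; have /pcharf0P -> := padic_pchar p_pr.
case: D => j j0; first exact: natk.
by rewrite NegzE rmorphN oppr_eq0; apply: natk.
Qed.

Lemma padic_ratrE (D m : int) (q : rat) : D%:~R * q = m%:~R ->
  D%:~R * ratr q = m%:~R :> k.
Proof.
move=> qE; rewrite /ratr mulrA.
apply: (canLR (mulfK (padic_intr_neq0 (denq_neq0 q)))).
have : (D * numq q)%:~R = (m * denq q)%:~R :> rat.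
  by rewrite !rmorphM /= -qE numqE -mulrA.
by move/eqP; rewrite eqr_int => /eqP e; rewrite -!intrM -e intrM.
Qed.

Lemma padic_ratr_uniq (D m : int) (q : rat) a : D != 0 ->
  D%:~R * q = m%:~R -> D%:~R * a = m%:~R -> ratr q = a.
Proof.
move=> D0 /padic_ratrE qE aE; apply: (mulfI (padic_intr_neq0 D0)).
by rewrite qE aE.
Qed.

Lemma denq_mul (q : rat) : (denq q)%:~R * q = (numq q)%:~R.
Proof. by rewrite numqE mulrC. Qed.

Fact padic_ratr_sub : zmod_morphism (ratr : rat -> k).
Proof.
move=> x y; have xE := padic_ratrE (denq_mul x); have yE := padic_ratrE (denq_mul y).
apply: (@padic_ratr_uniq (denq x * denq y) (denq y * numq x - denq x * numq y)).
- by rewrite mulf_neq0 ?denq_neq0.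
- by rewrite rmorphB !rmorphM /= -!denq_mul; ring.
- rewrite rmorphB !rmorphM /= mulrBr -!mulrA; congr (_ - _).
    by rewrite mulrCA xE.
  by rewrite yE.
Qed.

Fact padic_ratr_mul : monoid_morphism (ratr : rat -> k).
Proof.
split; first by apply: (@padic_ratr_uniq 1 1); rewrite ?mul1r.
move=> x y; have xE := padic_ratrE (denq_mul x); have yE := padic_ratrE (denq_mul y).
apply: (@padic_ratr_uniq (denq x * denq y) (numq x * numq y)).
- by rewrite mulf_neq0 ?denq_neq0.
- by rewrite !rmorphM /= -!denq_mul; ring.
- by rewrite !rmorphM /= mulrACA xE yE.
Qed.

(** An alias of [ratr] on which the morphism structures are declared. *)
Definition padic_ratr : rat -> k := ratr.
HB.instance Definition _ := GRing.isZmodMorphism.Build rat k padic_ratr padic_ratr_sub.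
HB.instance Definition _ := GRing.isMonoidMorphism.Build rat k padic_ratr padic_ratr_mul.

Lemma pint_ratr (q : rat) (D m : int) : ~~ (p %| D)%Z ->
  D%:~R * q = m%:~R -> pint (padic_ratr q).
Proof.
move=> pD qE; have uD := punit_intr pD.
have -> : padic_ratr q = D%:~R^-1 * m%:~R.
  by rewrite -(padic_ratrE qE) mulKf//; apply: punit_neq0.
by apply: pintM; [apply: punit_pintV|apply: pint_int].
Qed.

End PadicField.

(** * Self-dual lattices over a complete valuation ring *)

(** What is used of a p-adic field, with integers [I] and uniformizer [p].  The
    axiom [val_residue] says that binary diagonal forms of unit determinant are
    universal over the residue field if this has odd order, and that the residue
    field is that of two elements otherwise. *)
Record valuation_ring (k : fieldType) (I : k -> Prop) (p : k) : Prop := {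
  vr1 : I 1;
  vrD : forall a b, I a -> I b -> I (a + b);
  vrN : forall a, I a -> I (- a);
  vrM : forall a b, I a -> I b -> I (a * b);
  valp : I p;
  valp_neq0 : p != 0;
  val2_neq0 : 2 != 0 :> k;
  valpV : ~ I p^-1;
  val_bound : forall a, exists m, I (p ^+ m * a);
  val_unit : forall a, I a -> ~ I (a / p) -> I a^-1;
  val_hensel : forall c d, I c -> I d -> exists2 t, I t & t = - (p * c) - d * t ^+ 2;
  val_residue : (I 2^-1 /\ forall a b u, I a -> I b -> I u -> I a^-1 -> I b^-1 -> a != 0 -> b != 0 ->
      exists x y, [/\ I x, I y & exists2 c, I c & a * x ^+ 2 + b * y ^+ 2 = u + p * c])
    \/ (p = 2 /\ forall u v, I u -> I v -> I u^-1 -> I v^-1 -> u != 0 -> v != 0 ->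
          exists2 c, I c & u = v + p * c)
}.

Section LocalLattices.
Variables (k : fieldType) (I : k -> Prop) (p : k).
Hypothesis V : valuation_ring I p.
Variables (n : nat) (G : 'M[k]_n).
Hypothesis symG : G^T = G.
Implicit Types (a b d t : k) (c x y z v w : 'rV[k]_n) (M N C : 'rV[k]_n -> Prop).
Local Notation B := (bform G).
Local Notation Q := (qform G).

Lemma vr0 : I 0.
Proof. by rewrite -(subrr 1); apply: (vrD V); [|apply: (vrN V)]; apply: (vr1 V). Qed.
Lemma vrB a b : I a -> I b -> I (a - b).
Proof. by move=> ha hb; apply: (vrD V) => //; apply: (vrN V). Qed.
Lemma vrX a m : I a -> I (a ^+ m).
Proof.
by move=> ha; elim: m => [|m IH]; rewrite ?exprS; [apply: (vr1 V)|apply: (vrM V)].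
Qed.
Lemma vr2 : I 2. Proof. by apply: (vrD V); apply: (vr1 V). Qed.
Lemma val_pX m : I (p ^+ m). Proof. by apply/vrX/(valp V). Qed.
Lemma pX_neq0 m : p ^+ m != 0. Proof. by rewrite expf_neq0// (valp_neq0 V). Qed.

Lemma val_unit_add u a : I u -> I u^-1 -> u != 0 -> I a -> I (u + p * a)^-1 /\ u + p * a != 0.
Proof.
move=> hu hu' u0 ha; have p0 := valp_neq0 V.
have nI : ~ I ((u + p * a) / p).
  move=> h; apply: (valpV V).
  have -> : p^-1 = u^-1 * ((u + p * a) / p - a) by field; rewrite p0 u0.
  by apply: (vrM V) => //; apply: vrB.
split; last by apply: contra_notN nI => /eqP ->; rewrite mul0r; apply: vr0.
by apply: (val_unit V) => //; apply: (vrD V) => //; apply: (vrM V) => //; apply: (valp V).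
Qed.

Definition selfdual M := forall x, M x <-> forall y, M y -> I (B x y).

(** Such a [C] is an orthogonal summand of every integral lattice containing it. *)
Definition splits C := forall x, (forall c, C c -> I (B x c)) ->
  exists2 c, C c & forall c', C c' -> B (x - c) c' = 0.

Definition orth C x := forall c, C c -> B x c = 0.

Definition even_on C M := forall x, M x -> orth C x -> exists2 h, I h & Q x = 2 * h.

Section Selfdual.
Variables (M : 'rV[k]_n -> Prop).
Hypothesis sdM : selfdual M.

Lemma selfdual_form x y : M x -> M y -> I (B x y).
Proof. by move=> /sdM h /h. Qed.

Lemma selfdualD x y : M x -> M y -> M (x + y).
Proof.
move=> /sdM hx /sdM hy; apply/sdM => z zM; rewrite bformDl.
by apply: (vrD V); auto.
Qed.

Lemma selfdualZ a x : I a -> M x -> M (a *: x).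
Proof.
move=> ha /sdM hx; apply/sdM => z zM; rewrite bformZl; apply: (vrM V); auto.
Qed.

Lemma selfdualN x : M x -> M (- x).
Proof. by rewrite -scaleN1r; apply: selfdualZ; apply/(vrN V)/(vr1 V). Qed.

Lemma selfdualB x y : M x -> M y -> M (x - y).
Proof. by move=> hx hy; apply: selfdualD => //; apply: selfdualN. Qed.

Variable (C : 'rV[k]_n -> Prop).
Hypothesis CM : forall c, C c -> M c.
Hypothesis splC : splits C.

Lemma selfdual_project x : M x -> exists x', [/\ M x', orth C x' & C (x - x')].
Proof.
move=> Mx; have [c cC xc] : exists2 c, C c & forall c', C c' -> B (x - c) c' = 0.
  by apply: splC => c cC; apply: selfdual_form => //; apply: CM.
exists (x - c); split=> //; last by rewrite opprB addrC subrK.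
by apply: selfdualB => //; apply: CM.
Qed.

(** If [p] divided all products with [x], then [p^-1 x] would be in the dual
    lattice. *)
Lemma selfdual_partner x : M x -> ~ M (p^-1 *: x) -> orth C x ->
  exists y, [/\ M y, orth C y & B x y = 1].
Proof.
move=> Mx nMx xC; have [y My nI] : exists2 y, M y & ~ I (B x y / p).
  apply: contrapT => ny; apply: nMx; apply/sdM => y My; rewrite bformZl mulrC.
  by apply: contrapT => nI; apply: ny; exists y.
have uxy : I (B x y)^-1 by apply: (val_unit V) => //; apply: selfdual_form.
have xy0 : B x y != 0 by apply: contra_notN nI => /eqP ->; rewrite mul0r; apply: vr0.
have [y' [My' y'C yy']] := selfdual_project My.
exists ((B x y)^-1 *: y'); split; first exact: selfdualZ.
  by move=> c cC; rewrite bformZl y'C// mulr0.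
have /eqP := xC _ yy'; rewrite bformDr// bformNr// subr_eq0 => /eqP xy.
by rewrite bformZr// -xy mulVf.
Qed.

End Selfdual.

(** Duality reverses inclusions. *)
Lemma selfdual_sub M N : selfdual M -> selfdual N -> (forall x, N x -> M x) ->
  forall x, M x <-> N x.
Proof.
move=> sdM sdN NM x; split=> [Mx|]; last exact: NM.
by apply/sdN => y /NM My; apply: selfdual_form sdM _ _ Mx My.
Qed.

Lemma selfdual_reflection M v : Q v != 0 -> selfdual M ->
  selfdual (fun x => M (x *m reflection G v)).
Proof.
move=> v0 sdM x; have rK y : y *m reflection G v *m reflection G v = y.
  by rewrite -mulmxA reflectionK// mulmx1.
split=> [/sdM h y /h|h]; first by rewrite reflection_bform.
apply/sdM => y My; have := h (y *m reflection G v); rewrite rK => /(_ My).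
by rewrite -(reflection_bform symG _ _ v0) rK.
Qed.

(** Let [P] be the least power of [p] with [P N] in [M].  Some [x] of [N] has
    [w1 = P x] primitive in [M], with a partner [w] in [M]; then [x] and [P w]
    span a regular plane of [N].  The reflection in [x - w], which would
    exchange [x] and [w] if they were isotropic, carries this plane into [M]
    because both vectors have even length.  Replacing [M] by its reflection, the
    plane can be added to the common part [C]; the rows of [D] witness the rank
    of [C], which grows at each step. *)
Theorem selfdual_transport r (D : 'M[k]_(r, n)) M N C :
  row_free D -> (forall i, C (row i D)) -> C 0 ->
  (forall a b x y, I a -> I b -> C x -> C y -> C (a *: x + b *: y)) ->
  (forall c, C c -> M c) -> (forall c, C c -> N c) -> splits C ->
  selfdual M -> selfdual N -> even_on C M -> even_on C N ->
  (exists j, forall x, N x -> M (p ^+ j *: x)) ->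
  exists vs, [/\ all (fun v => Q v != 0) vs, forall v, v \in vs -> orth C v &
    forall x, M x <-> N (x *m reflections G vs)].
Proof.
have p0 := valp_neq0 V; have two0 := val2_neq0 V.
have [s] := ubnP (n - r)%N; elim: s r D M N C => // s IH r D M N C rs Df DC C0
  Clin CM CN splC sdM sdN evM evN j0P.
have [NM|nNM] := pselect (forall x, N x -> M x).
  exists [::]; split=> // x; rewrite /reflections big_nil mulmx1.
  exact: selfdual_sub.
have jP : exists j, `[< forall x, N x -> M (p ^+ j *: x) >].
  by case: j0P => j jP; exists j; apply/asboolP.
case: (ex_minnP jP) => -[|j] /asboolP jM jmin.
  by case: nNM => x /jM; rewrite expr0 scale1r.
have [x0 Nx0 nMx0] : exists2 x, N x & ~ M (p ^+ j *: x).
  apply: contrapT => nx; have := jmin j; rewrite ltnn => jm; suff: false by [].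
  apply: jm; apply/asboolP => x Nx; apply: contrapT => nM.
  by apply: nx; exists x.
have [x [Nx xC Cx]] := selfdual_project sdN CN splC Nx0.
have nMx : ~ M (p ^+ j *: x).
  move=> Mx; apply: nMx0; rewrite -[x0](subrK x) scalerDr.
  apply: (selfdualD sdM) => //; apply: (selfdualZ sdM); first exact: val_pX.
  exact: CM.
have [P PE] : exists P, P = p ^+ j.+1 by exists (p ^+ j.+1).
have P0 : P != 0 by rewrite PE; apply: pX_neq0.
have PI : I P by rewrite PE; apply: val_pX.
pose w1 := P *: x; have Mw1 : M w1 by rewrite /w1 PE; apply: jM.
have w1C : orth C w1 by move=> c cC; rewrite bformZl xC// mulr0.
have [w [Mw wC w1w]] : exists y, [/\ M y, orth C y & B w1 y = 1].
  apply: (selfdual_partner sdM CM splC) => //.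
  by rewrite scalerA PE exprS mulrA mulVf// mul1r.
have [h hI Qx] := evN _ Nx xC; have [g gI Qw] := evM _ Mw wC.
have PB : P * B x w = 1 by rewrite -bformZl.
have PBC : P * B w x = 1 by rewrite bformC.
have PNw : N (P *: w).
  apply/sdN => z Nz; rewrite bformZl -(bformZr symG); apply: (selfdual_form sdM) => //.
  by rewrite PE; apply: jM.
have unit_m1 a : I a -> exists u, [/\ I u^-1, u != 0 & u = - 1 + P * a].
  move=> aI; exists (- 1 + P * a); rewrite PE exprS -mulrA.
  have [] := @val_unit_add (- 1) (p ^+ j * a); rewrite ?oppr_eq0 ?oner_neq0 ?invrN1//.
  - by apply/(vrN V)/(vr1 V).
  - by apply/(vrN V)/(vr1 V).
  - by apply: (vrM V) => //; apply: val_pX.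
(* The length of [x - w] is [2 e / P], and [d] is the determinant of the plane
   of [x] and [P w]. *)
have [e [eI e0 eE]] : exists u, [/\ I u^-1, u != 0 & u = - 1 + P * (h + g)].
  by apply: unit_m1; apply: (vrD V).
have [d [dI d0 dE]] : exists u, [/\ I u^-1, u != 0 & u = - 1 + P * (4 * P * h * g)].
  apply: unit_m1; apply: (vrM V) => //; apply: (vrM V) => //; apply: (vrM V) => //.
  by have -> : (4 : k) = 2 * 2 by [ring]; apply: (vrM V); apply: vr2.
pose v := x - w.
have Qv : P * Q v = 2 * e.
  rewrite /Q /v !bformE// -/(Q x) -/(Q w) Qx Qw eE; move: PB PBC.
  move: (B x w) (B w x) => b1 b2 b1E b2E.
  transitivity (P * (2 * h) - P * b1 - (P * b2) + P * (2 * g)); first by ring.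
  by rewrite b1E b2E; ring.
have Qv0 : Q v != 0.
  by apply: contraNneq (mulf_neq0 two0 e0) => qv; rewrite -Qv qv mulr0.
pose rv := reflection G v.
have rE y : y *m rv = y - (P * B y v / e) *: v.
  rewrite /rv reflectionE; congr (_ - _ *: _).
  have -> : Q v = 2 * e / P by rewrite -Qv mulrC mulKf.
  by field; rewrite P0 two0 e0.
have vC : orth C v by move=> c cC; rewrite bformDl bformNl xC// wC// subrr.
have rx : x *m rv = ((g - h) / e) *: w1 + ((2 * P * h - 1) / e) *: w.
  rewrite rE; have -> : P * B x v = 2 * P * h - 1.
    by rewrite /v bformDr// bformNr// -/(Q x) Qx mulrBr PB; ring.
  rewrite /w1 /v scalerBr opprB addrCA scalerA -{1}[x]scale1r -scalerBl.
  rewrite addrC; congr (_ *: _ + _); rewrite eE in e0 *; field.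
  exact: e0.
have rw : (P *: w) *m rv = P *: w - ((1 - 2 * P * g) / e) *: (w1 - P *: w).
  rewrite rE bformZl; congr (_ - _).
  have -> : P * (P * B w v) = P * (1 - 2 * P * g).
    by rewrite /v bformDr// bformNr// -/(Q w) Qw mulrBr PBC; congr (_ * _); ring.
  by rewrite /w1 /v -scalerBr scalerA; congr (_ *: _); ring.
pose M1 y := M (y *m rv).
(* The sum of [C] and the plane of [x] and [P w]. *)
pose C1 y := exists c a b, [/\ C c, I a, I b & y = c + a *: x + b *: (P *: w)].
have sdM1 : selfdual M1 by apply: selfdual_reflection.
have C1C c : C c -> C1 c.
  by move=> cC; exists c, 0, 0; split=> //; rewrite ?scale0r ?addr0//; apply: vr0.
have C1x : C1 x.
  exists 0, 1, 0; split=> //; [exact: (vr1 V)|exact: vr0|].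
  by rewrite scale1r scale0r addr0 add0r.
have C1w : C1 (P *: w).
  exists 0, 0, 1; split=> //; [exact: vr0|exact: (vr1 V)|].
  by rewrite scale1r scale0r addr0 add0r.
have orthC1 y : orth C1 y -> [/\ orth C y, B y x = 0 & B y (P *: w) = 0].
  by move=> yC1; split; [move=> c /C1C /yC1| exact: yC1|exact: yC1].
pose D1 : 'M[k]_(r + (1 + 1), n) := col_mx D (col_mx x (P *: w)).
have D1f : row_free D1.
  apply: inj_row_free => u.
  rewrite -(hsubmxK u) -(hsubmxK (rsubmx u)).
  set u1 := lsubmx u; set a := lsubmx _; set b := rsubmx _.
  rewrite !mul_row_col (mx11_scalar a) (mx11_scalar b) !mul_scalar_mx.
  set a0 := a 0 0; set b0 := b 0 0 => u0.
  have u1o z : orth C z -> B (u1 *m D) z = 0.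
    move=> zC; rewrite /bform -2!mulmxA [X in _ *m X](_ : _ = 0) ?mulmx0 ?mxE//.
    apply/matrixP => i i'; rewrite [i']ord1 [RHS]mxE -[RHS](zC _ (DC i)) bformC// /bform.
    by rewrite mulmxA -!row_mul !mxE; apply: eq_bigr => l _; rewrite !mxE.
  have ex : 2 * h * a0 + b0 = 0.
    have := congr1 (fun y => B y x) u0; rewrite bform0l !bformDl !bformZl u1o// add0r.
    by rewrite PBC mulr1 -/(Q x) Qx => <-; ring.
  have ew : a0 + 2 * P ^+ 2 * g * b0 = 0.
    have := congr1 (fun y => B y (P *: w)) u0.
    rewrite bform0l !bformDl !bformZl !(bformZr symG) u1o// mulr0 add0r PB mulr1 -/(Q w) Qw.
    by move=> <-; ring.
  have b0E : b0 = - (2 * h * a0) by apply/eqP; rewrite -addr_eq0 addrC ex.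
  have a00 : a0 = 0.
    apply/eqP; have /eqP : d * a0 = 0.
      by rewrite -[RHS]oppr0 -ew b0E dE; ring.
    by rewrite mulf_eq0 (negPf d0).
  have b00 : b0 = 0 by rewrite b0E a00 mulr0 oppr0.
  have -> : u1 = 0.
    apply: (row_free_inj Df); rewrite mul0mx -[RHS]u0 a00 b00.
    by rewrite !scale0r !addr0.
  by rewrite a00 b00 !raddf0 !row_mx0.
have rn : (r + 2 <= n)%N.
  have := D1f; rewrite -row_leq_rank => h1; apply: leq_trans h1 _; exact: rank_leq_col.
have [] := IH (r + (1 + 1))%N D1 M1 N C1 => //.
- by lia.
- move=> i; rewrite /D1; case: (split_ordP i) => [i' ->|i' ->].
    by rewrite rowKu; apply: C1C.
  rewrite rowKd; case: (split_ordP i') => i'' ->; rewrite ?rowKu ?rowKd [i'']ord1.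
    by rewrite (_ : row 0 x = x) //; apply/rowP => l; rewrite mxE.
  by rewrite (_ : row 0 (P *: w) = P *: w) //; apply/rowP => l; rewrite mxE.
- exact: C1C.
- move=> a b y z aI bI [c [a1 [b1 [cC a1I b1I ->]]]] [c' [a2 [b2 [cC' a2I b2I ->]]]].
  exists (a *: c + b *: c'), (a * a1 + b * a2), (a * b1 + b * b2); split.
  + exact: Clin.
  + by apply: (vrD V); apply: (vrM V).
  + by apply: (vrD V); apply: (vrM V).
  + apply/rowP => l; rewrite !mxE; ring.
- move=> _ [c [a [b [cC aI bI ->]]]]; rewrite /M1 !mulmxDl -!scalemxAl.
  rewrite [c *m rv]reflection_fix; last by rewrite bformC// vC.
  apply: (selfdualD sdM); first apply: (selfdualD sdM); first exact: CM.
  + apply: (selfdualZ sdM) => //; rewrite rx; apply: (selfdualD sdM).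
      by apply: (selfdualZ sdM) => //; apply: (vrM V) => //; apply: vrB.
    apply: (selfdualZ sdM) => //; apply: (vrM V) => //; apply: vrB; last exact: (vr1 V).
    by apply: (vrM V) => //; apply: (vrM V) => //; apply: vr2.
  + apply: (selfdualZ sdM) => //; rewrite scalemxAl rw.
    have MPw : M (P *: w) by apply: (selfdualZ sdM).
    apply: (selfdualB sdM) => //; apply: (selfdualZ sdM); last exact: (selfdualB sdM).
    apply: (vrM V) => //; apply: vrB; first exact: (vr1 V).
    by apply: (vrM V) => //; apply: (vrM V) => //; apply: vr2.
- move=> _ [c [a [b [cC aI bI ->]]]]; apply: (selfdualD sdN).
    by apply: (selfdualD sdN); [apply: CN|apply: (selfdualZ sdN)].
  exact: (selfdualZ sdN).
- move=> y yI; have [c cC yc] := splC y (fun c cC => yI c (C1C c cC)).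
  pose al := B y x; pose be := B y (P *: w).
  have alI : I al by apply: yI.
  have beI : I be by apply: yI.
  (* Cramer's rule in the plane of [x] and [P w]. *)
  pose a := (2 * P ^+ 2 * g * al - be) / d; pose b := (2 * h * be - al) / d.
  have P2I : I (2 * P ^+ 2 * g).
    by apply: (vrM V) => //; apply: (vrM V); [apply: vr2|apply: vrX].
  have aI : I a by apply: (vrM V) => //; apply: vrB => //; apply: (vrM V).
  have bI : I b.
    apply: (vrM V) => //; apply: vrB => //; do 2?[apply: (vrM V) => //].
    exact: vr2.
  exists (c + a *: x + b *: (P *: w)); first by exists c, a, b.
  have cx : B c x = 0 by rewrite bformC// xC.
  have cw : B c w = 0 by rewrite bformC// wC.
  have d0' : -1 + P * (4 * P * h * g) != 0 by rewrite -dE.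
  move=> _ [c' [a' [b' [cC' _ _ ->]]]].
  have E1 : B (y - (c + a *: x + b *: (P *: w))) c' = 0.
    have := yc _ cC'; rewrite !bformE// xC// wC// => e0'.
    by rewrite !mulr0 !addr0.
  have E2 : B (y - (c + a *: x + b *: (P *: w))) x = 0.
    rewrite !bformE// -/al -/(Q x) Qx cx PBC /a /b dE; field.
    exact: d0'.
  have E3 : B (y - (c + a *: x + b *: (P *: w))) (P *: w) = 0.
    rewrite bformDl bformNl -/be !bformE// -/(Q w) Qw cw PB /a /b dE.
    by field.
  by rewrite !bformDr// (bformZr symG a' x) (bformZr symG b' (P *: w)) E1 E2 E3 !mulr0 !addr0.
- move=> y M1y /orthC1[yC yx]; rewrite bformZr// => /eqP.
  rewrite mulf_eq0 (negPf P0) => /eqP yw; apply: evM => //.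
  move: M1y; rewrite /M1 /rv reflection_fix//.
  by rewrite /v bformDr// bformNr// yx yw subrr.
- by move=> y Ny /orthC1[yC _ _]; apply: evN.
- exists j.+1 => y Ny; rewrite -PE /M1 -scalemxAl rE.
  have -> : P *: (y - (P * B y v / e) *: v) = P *: y - (B y (P *: v) / e) *: (P *: v).
    by rewrite scalerBr !scalerA bformZr//; congr (_ - _ *: _); ring.
  have Pv : P *: v = w1 - P *: w by rewrite /v scalerBr.
  apply: (selfdualB sdM); first by rewrite PE; apply: jM.
  rewrite Pv; apply: (selfdualZ sdM).
    apply: (vrM V) => //; rewrite bformDr// bformNr//; apply: vrB.
      rewrite /w1 bformZr//; apply: (vrM V) => //; exact: (selfdual_form sdN).
    exact: (selfdual_form sdN).
  by apply: (selfdualB sdM) => //; apply: (selfdualZ sdM).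
move=> vs [vs0 vsC1 MN]; exists (v :: vs); split.
- by rewrite /= Qv0.
- by move=> v'; rewrite finset.inE => /orP[/eqP -> //|/vsC1 h' c /C1C/h'].
move=> y; rewrite /reflections big_cons -/(reflections G vs) mulmxA -/rv -MN /M1.
by rewrite -mulmxA reflectionK// mulmx1.
Qed.
Definition val_is_unit a := [/\ I a, I a^-1 & a != 0].

Lemma val_unit_or a : I a -> val_is_unit a \/ I (a / p).
Proof.
move=> aI; have [h|h] := pselect (I (a / p)); [by right|left].
split=> //; first exact: (val_unit V).
by apply: contra_notN h => /eqP ->; rewrite mul0r; apply: vr0.
Qed.

Lemma val_unit_not a : val_is_unit a -> ~ I (a / p).
Proof.
move=> [_ a' a0] h; apply: (valpV V); have -> : p^-1 = a^-1 * (a / p) by rewrite mulKf.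
exact: (vrM V).
Qed.

(** Multiply a suitable power of [p] by the inverse of [a]. *)
Lemma val_arch a : a != 0 -> exists m, ~ I (a / p ^+ m).
Proof.
move=> a0; have [m mI] := val_bound V a^-1; exists m.+1 => h; apply: (valpV V).
have -> : p^-1 = p ^+ m / a * (a / p ^+ m.+1).
  by rewrite exprSr; field; rewrite (valp_neq0 V) a0 pX_neq0.
exact: (vrM V).
Qed.

Lemma val_is_unitM a b : val_is_unit a -> val_is_unit b -> val_is_unit (a * b).
Proof.
move=> [aI a' a0] [bI b' b0]; split; rewrite ?mulf_neq0 ?invfM//; exact: (vrM V).
Qed.

(** Solve the equation modulo [p], and lift a coordinate that is a unit. *)
Lemma val_conic a b (u : k) : I 2^-1 ->
  (forall a b u : k, I a -> I b -> I u -> I a^-1 -> I b^-1 -> a != 0 -> b != 0 ->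
      exists x y : k, [/\ I x, I y & exists2 c, I c & a * x ^+ 2 + b * y ^+ 2 = u + p * c]) ->
  val_is_unit a -> val_is_unit b -> val_is_unit u ->
  exists x y : k, [/\ I x, I y & a * x ^+ 2 + b * y ^+ 2 = u].
Proof.
move=> h2 res ua ub uu; have u2 : val_is_unit 2 by split=> //; [apply: vr2|apply: (val2_neq0 V)].
have p0 := valp_neq0 V.
have lift (a0 x0 r c : k) : val_is_unit a0 -> val_is_unit x0 -> I c ->
    a0 * x0 ^+ 2 + r = u + p * c -> exists2 x : k, I x & a0 * x ^+ 2 + r = u.
  move=> ua0 ux0 cI E; have [xI x' x00] := ux0.
  have [dI d' d0] := val_is_unitM (val_is_unitM u2 ua0) ux0.
  have [eI e' e0] := val_is_unitM u2 ux0.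
  have [a0I a0' a00] := ua0.
  have [t tI tE] := val_hensel V (vrM V cI d') e'.
  exists (x0 + t); first exact: (vrD V).
  have -> : a0 * (x0 + t) ^+ 2 + r = u + p * c + 2 * a0 * x0 * t + a0 * t ^+ 2.
    by rewrite -E; ring.
  have -> : 2 * a0 * x0 * t = - (p * c) - a0 * t ^+ 2.
    rewrite {1}tE; move: (t ^+ 2) => t2; field.
    by rewrite x00 a00 (val2_neq0 V).
  by ring.
have [aI a' a0] := ua; have [bI b' b0] := ub; have [uI u' u0] := uu.
have [x [y [xI yI [c cI E]]]] := res a b u aI bI uI a' b' a0 b0.
have [ux|nx] := val_unit_or xI.
  by have [x1 x1I x1E] := lift a x _ c ua ux cI E; exists x1, y.
have [uy|ny] := val_unit_or yI.
  rewrite addrC in E; have [y1 y1I y1E] := lift b y _ c ub uy cI E.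
  by exists x, y1; split=> //; rewrite addrC.
case: (val_unit_not uu); have -> : u / p = a * (x / p) * x + b * (y / p) * y - c.
  apply: (mulIf p0); rewrite mulfVK//.
  have -> : u = a * x ^+ 2 + b * y ^+ 2 - p * c by rewrite E addrK.
  by field.
by apply: vrB => //; apply: (vrD V); do 2?[apply: (vrM V) => //].
Qed.

Section Represents.
Variables M C : 'rV[k]_n -> Prop.
Hypotheses (sdM : selfdual M) (CM : forall c, C c -> M c) (splC : splits C).
Hypotheses (evM : even_on C M) (Gu : G \in unitmx).
Hypothesis absM : forall x, exists m, M (p ^+ m *: x).

(** A nonzero vector is divided by [p] as long as it stays in [M]; this ends as the
    form is nondegenerate. *)
Lemma primitive_vector (C' : 'rV[k]_n -> Prop) z : z != 0 -> orth C' z ->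
  exists x, [/\ M x, ~ M (p^-1 *: x) & orth C' x].
Proof.
move=> z0 zC; have [m mz] := absM z.
have p0 := valp_neq0 V.
have sC a : orth C' (a *: z) by move=> c cC; rewrite bformZl zC// mulr0.
have [y yz] : exists y, B z y != 0.
  apply: contrapT => ny; case/eqP: z0; apply: (can_inj (mulmxK Gu)); rewrite mul0mx.
  apply/rowP => j; rewrite [RHS]mxE.
  apply/eqP/negPn/negP => zj; apply: ny; exists (delta_mx 0 j).
  by rewrite /bform trmx_delta -colE mxE.
have [l ly] := absM y.
have ay0 : p ^+ m * p ^+ l * B z y != 0 by rewrite !mulf_neq0 ?pX_neq0.
have [j jn] := val_arch ay0.
have ex : exists j, `[< ~ M ((p ^+ j)^-1 *: (p ^+ m *: z)) >].
  exists j; apply/asboolP => h; apply: jn.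
  have := selfdual_form sdM h ly; rewrite !bformZl (bformZr symG).
  have -> : p ^+ m * p ^+ l * B z y / p ^+ j = (p ^+ j)^-1 * (p ^+ m * (p ^+ l * B z y)).
    by move: (B z y) => b; field; apply: pX_neq0.
  by [].
case: (ex_minnP ex) => -[|i] /asboolP nM imin; first by case: nM; rewrite expr0 invr1 scale1r.
exists ((p ^+ i)^-1 *: (p ^+ m *: z)); split.
- apply: contrapT => h; have := imin i; rewrite ltnn => im; suff: false by [].
  by apply: im; apply/asboolP.
- by rewrite [p^-1 *: _]scalerA -invfM -exprS.
- by rewrite scalerA.
Qed.

(** For a pair with [B x y = 1], the halved lengths [q] satisfy
    [q (x + y) = q x + q y + 1], so that one of the three is a unit. *)
Lemma orth_unit_vector z : z != 0 -> orth C z ->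
  exists v h, [/\ M v, orth C v, Q v = 2 * h & val_is_unit h].
Proof.
move=> z0 zC; have [x [Mx nMx xC]] := primitive_vector z0 zC.
have [y [My yC xy]] := selfdual_partner sdM CM splC Mx nMx xC.
have [a aI Qx] := evM Mx xC; have [b bI Qy] := evM My yC.
have [ua|na] := val_unit_or aI; first by exists x, a.
have [ub|nb] := val_unit_or bI; first by exists y, b.
exists (x + y), (a + b + 1); split.
- exact: selfdualD.
- by move=> c cC; rewrite bformDl xC// yC// addr0.
- by rewrite qformD// Qx Qy xy; ring.
have -> : a + b + 1 = 1 + p * (a / p + b / p) by field; apply: (valp_neq0 V).
have I1 := vr1 V.
have [] := @val_unit_add 1 (a / p + b / p) I1; rewrite ?invr1 ?oner_neq0//.
  exact: (vrD V).
split=> //; apply: (vrD V) => //; apply: (vrM V); first exact: (valp V).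
exact: (vrD V).
Qed.

End Represents.

(** If [2] is a unit, two orthogonal vectors of unit length span a plane that
    represents all units.  Otherwise start from a vector [v1] whose halved length
    is a unit; it differs from [u] by an even number, and is primitive, so that
    adding a multiple of a partner corrects it by Hensel's lemma. *)
Theorem represents_units M C u : selfdual M -> (forall c, C c -> M c) -> C 0 ->
  splits C -> even_on C M -> G \in unitmx -> (forall x, exists m, M (p ^+ m *: x)) ->
  (forall y, exists z, [/\ z != 0, orth C z & B z y = 0]) -> val_is_unit u ->
  exists v, [/\ M v, orth C v & Q v = 2 * u].
Proof.
move=> sdM CM C0 splC evM Gu absM big uu; have two0 := val2_neq0 V.
have [z [z0 zC _]] := big 0.
have [v1 [h1 [Mv1 v1C Qv1 uh1]]] := orth_unit_vector sdM CM splC evM Gu absM z0 zC.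
have [h1I h1' h10] := uh1; have [uI u' u0] := uu.
case: (val_residue V) => [[h2 res]|[p2 res]].
  have [z2 [z20 z2C z2v]] := big v1.
  pose C2 y := exists c a, [/\ C c, I a & y = c + a *: v1].
  have C2M c : C2 c -> M c.
    move=> [c' [a [cC aI ->]]]; apply: (selfdualD sdM); first exact: CM.
    exact: (selfdualZ sdM).
  have CC2 c : C c -> C2 c.
    by move=> cC; exists c, 0; split=> //; rewrite ?scale0r ?addr0//; apply: vr0.
  have C2v : C2 v1.
    by exists 0, 1; rewrite scale1r add0r; split=> //; apply: (vr1 V).
  have spl2 : splits C2.
    move=> x xI; have [c cC xc] := splC x (fun c cC => xI c (CC2 c cC)).
    pose a := B x v1 / (2 * h1).
    have aI : I a.
      by rewrite /a invfM; apply: (vrM V); [apply: xI|apply: (vrM V)].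
    exists (c + a *: v1); first by exists c, a.
    move=> _ [c' [b [cC' _ ->]]].
    have E1 : B (x - (c + a *: v1)) c' = 0.
      have := xc _ cC'; rewrite !bformDl !bformNl bformDl bformZl v1C// => e.
      by rewrite mulr0 addr0.
    have E2 : B (x - (c + a *: v1)) v1 = 0.
      rewrite !bformDl !bformNl bformDl bformZl (bformC symG c) v1C// -/(Q v1) Qv1 /a.
      by field; rewrite two0 h10.
    by rewrite bformDr// (bformZr symG b) E1 E2 mulr0 addr0.
  have ev2 : even_on C2 M by move=> x Mx xC; apply: evM => // c /CC2/xC.
  have oz2 : orth C2 z2.
    by move=> _ [c [a [cC _ ->]]]; rewrite bformDr// bformZr// z2C// z2v mulr0 addr0.
  have [v2 [h [Mv2 v2C Qv2 uh]]] := orth_unit_vector sdM C2M spl2 ev2 Gu absM z20 oz2.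
  have [x [y [xI yI E]]] := val_conic h2 res uh1 uh uu.
  exists (x *: v1 + y *: v2); split.
  - by apply: (selfdualD sdM); apply: (selfdualZ sdM).
  - by move=> c cC; rewrite bformDl !bformZl v1C// v2C ?mulr0 ?addr0//; apply: CC2.
  - rewrite qformD// bformZl (bformZr symG y) (bformC symG v1) v2C//.
    rewrite /Q !bformZl (bformZr symG x) (bformZr symG y) -/(Q v1) -/(Q v2) Qv1 Qv2 -E.
    by ring.
have [c cI uE] := res u h1 uI h1I u' h1' u0 h10.
have nM : ~ M (p^-1 *: v1).
  move=> h; have hC : orth C (p^-1 *: v1).
    by move=> c' cC; rewrite bformZl v1C// mulr0.
  have [a aI Qa] := evM _ h hC.
  apply: (val_unit_not uh1); have -> : h1 / p = 2 * a; last exact: (vrM V vr2).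
  rewrite -Qa /Q bformZl (bformZr symG p^-1) -/(Q v1) Qv1 p2.
  by field.
have [w [Mw wC v1w]] := selfdual_partner sdM CM splC Mv1 nM v1C.
have [g gI Qw] := evM _ Mw wC.
have [t tI tE] := val_hensel V (vrN V cI) gI.
exists (v1 + t *: w); split.
- by apply: (selfdualD sdM) => //; apply: (selfdualZ sdM).
- by move=> c' cC; rewrite bformDl bformZl v1C// wC// mulr0 addr0.
rewrite qformD// (bformZr symG t) v1w /Q bformZl (bformZr symG t) -/(Q v1) -/(Q w) Qv1 Qw.
rewrite uE [in LHS]mulr1 {1}tE; move: (t) => t'; ring.
Qed.

End LocalLattices.

(** * The p-adic numbers as a valuation ring *)

Lemma parity_ring (F : fieldType) (x y b c : F) :
  1%:R + x * 2%:R + 2%:R * b = 1%:R + y * 2%:R + 2%:R * c + 2%:R * (x - y + b - c).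
Proof. by ring. Qed.

Lemma conic_ring (F : fieldType) (a b m x y q p a1 b1 u1 : F) :
  a * x ^+ 2 + b * y ^+ 2 + m = q * p ->
  (a + p * a1) * x ^+ 2 + (b + p * b1) * y ^+ 2 =
  - (m + p * u1) + p * (q + a1 * x ^+ 2 + b1 * y ^+ 2 + u1).
Proof.
move=> e; have -> : m = q * p - a * x ^+ 2 - b * y ^+ 2 by rewrite -e; ring.
by ring.
Qed.

(** The values [a x^2] and [- b y^2 - m] for [x] and [y] up to [p / 2] are more
    than [p] in number, and those of each kind are distinct. *)
Lemma conic_mod_p (p a b m : nat) : prime p -> odd p -> ~~ (p %| a)%N -> ~~ (p %| b)%N ->
  exists x y : nat,
    [/\ (x <= p./2)%N, (y <= p./2)%N & (p %| a * x ^ 2 + b * y ^ 2 + m)%N].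
Proof.
move=> p_pr p_odd pa pb.
have chp : p \in [pchar 'F_p] by rewrite pchar_Fp.
have natF (i : nat) : (i%:R == 0 :> 'F_p) = (p %| i)%N by rewrite (dvdn_pcharf chp).
have inj (c : nat) (i j : 'I_(p./2.+1)) : ~~ (p %| c)%N ->
    (c * i ^ 2)%:R = (c * j ^ 2)%:R :> 'F_p -> i = j.
  move=> pc; wlog le_ij : i j / (j <= i)%N.
    by move=> H; case: (leqP j i) => [/H //|/ltnW ji /esym e]; apply/esym/H.
  move=> e; apply/val_inj/eqP => /=; rewrite eqn_leq le_ij andbT leqNgt; apply/negP => lt_ji.
  have : (p %| c * ((i - j) * (i + j)))%N.
    by rewrite -subn_sqr mulnBr -natF natrB ?e ?subrr// leq_mul2l leq_exp2r// le_ij orbT.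
  rewrite !Euclid_dvdM// (negPf pc) /=.
  have := ltn_ord i; have := odd_double_half p; rewrite p_odd -addnn => pE ip.
  by move=> /orP[] /dvdn_leq; lia.
pose f (s : 'I_(p./2.+1) + 'I_(p./2.+1)) : 'F_p :=
  match s with inl i => (a * i ^ 2)%:R | inr j => - (b * j ^ 2 + m)%:R end.
have /injectivePn[s [t st fst]] : ~~ injectiveb f.
  apply/negP => /injectiveP/leq_card; rewrite card_sum card_ord card_Fp//.
  by have := odd_double_half p; rewrite p_odd -addnn; lia.
have solve (i j : 'I_(p./2.+1)) : (a * i ^ 2)%:R = - (b * j ^ 2 + m)%:R :> 'F_p ->
    exists x y : nat,
      [/\ (x <= p./2)%N, (y <= p./2)%N & (p %| a * x ^ 2 + b * y ^ 2 + m)%N].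
  move=> e; exists i, j; split; [exact: (ltn_ord i)|exact: (ltn_ord j)|].
  by rewrite -addnA -natF natrD e addNr.
case: s t st fst => i [] j st /= e.
- by case/eqP: st; congr inl; apply: (inj a).
- exact: solve e.
- exact: solve (esym e).
case/eqP: st; congr inr; apply: (inj b) => //.
by move: e => /oppr_inj; rewrite !natrD => /addIr.
Qed.

Section PadicValuationRing.
Variables (p : nat) (p_pr : prime p).
Local Notation k := (padic p_pr).
Local Notation pint := (@pint p p_pr).

Lemma punit_of_pintV (a : k) : pint a -> pint a^-1 -> a != 0 -> punit a.
Proof. by move=> aI a' a0; split=> //; exists a^-1 => //; rewrite mulVf. Qed.

Lemma punit_residue (a : k) (m : nat) b : punit a -> pint b ->
  a = m%:R + p%:R * b -> ~~ (p %| m)%N.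
Proof.
move=> ua bI aE; apply/negP => /dvdnP[q qE]; apply: (@not_pint_pV p p_pr).
have -> : p%:R^-1 = a^-1 * (q%:R + b) :> k.
  have a0 := punit_neq0 ua; have p0 := padic_p_neq0 p_pr.
  apply: (mulfI a0); rewrite mulVKf//; apply: (mulfI p0); rewrite mulrCA mulfV// mulr1.
  by rewrite aE qE natrM mulrDr mulrC.
apply: pintM; first exact: punit_pintV.
by apply: pintD => //; apply: pint_nat.
Qed.

Lemma padic_valuation_ring : valuation_ring pint (p%:R : k).
Proof.
have p0 := padic_p_neq0 p_pr.
split.
- exact: pint1.
- exact: pintD.
- exact: pintN.
- exact: pintM.
- exact: pint_nat.
- exact: p0.
- by have /pcharf0P -> := padic_pchar p_pr.
- exact: not_pint_pV.
- exact: pint_bound.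
- by move=> a aI na; apply/punit_pintV/pint_unitP.
- exact: pint_hensel.
have [p2|podd] := even_prime p_pr.
  right; split; first exact: (congr1 (fun i => i%:R) p2).
  move=> u v uI vI u' v' u0 v0.
  have [mu [b [bI uE]]] := pint_residue uI; have [mv [c [cI vE]]] := pint_residue vI.
  have ou := punit_residue (punit_of_pintV uI u' u0) bI uE.
  have ov := punit_residue (punit_of_pintV vI v' v0) cI vE.
  rewrite {1}p2 dvdn2 negbK in ou; rewrite {1}p2 dvdn2 negbK in ov; rewrite uE vE.
  exists (mu./2%:R - mv./2%:R + b - c).
    by apply: pintB => //; apply: pintD => //; apply: pintB; apply: pint_nat.
  rewrite -{1}(odd_double_half mu) -{1}(odd_double_half mv) ou ov -!muln2 !natrD !natrM.
  rewrite (congr1 (fun i => i%:R : k) p2); exact: parity_ring.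
left; split; first by apply/punit_pintV/punit_nat; rewrite dvdn_prime2//; apply: contraTneq podd => ->.
move=> a b u aI bI uI a' b' a0 b0.
have [ma [a1 [a1I aE]]] := pint_residue aI; have [mb [b1 [b1I bE]]] := pint_residue bI.
have [mu [u1 [u1I uE]]] := pint_residue (pintN uI).
have pa := punit_residue (punit_of_pintV aI a' a0) a1I aE.
have pb := punit_residue (punit_of_pintV bI b' b0) b1I bE.
have [x [y [_ _ /dvdnP[q qE]]]] := conic_mod_p mu p_pr podd pa pb.
exists x%:R, y%:R; split; [exact: pint_nat|exact: pint_nat|].
exists (q%:R + a1 * x%:R ^+ 2 + b1 * y%:R ^+ 2 + u1).
  by do 3?[apply: pintD => //]; rewrite -?natrX; do ?[apply: pintM => //]; apply: pint_nat.
have uE' : u = - (mu%:R + p%:R * u1) by rewrite -uE opprK.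
have : (ma * x ^ 2 + mb * y ^ 2 + mu)%:R = (q * p)%:R :> k by rewrite qE.
rewrite aE bE uE' !natrD (natrM _ ma) (natrM _ mb) (natrM _ q) !natrX; exact: conic_ring.
Qed.
End PadicValuationRing.

(** * Lattices with a distinguished vector *)

Section LocalModel.
Variables (k : fieldType) (I : k -> Prop) (p : k).
Hypothesis V : valuation_ring I p.
Variable n : nat.
Implicit Types (x y z v : 'rV[k]_n) (A G D : 'M[k]_n).

Definition intv x := forall i, I (x 0 i).
Definition intmx A := forall i j, I (A i j).

Lemma val_sum (J : finType) (P : pred J) (f : J -> k) :
  (forall i, P i -> I (f i)) -> I (\sum_(i | P i) f i).
Proof.
by move=> H; apply: (big_ind I) => //; [apply: (vr0 V)|apply: (vrD V)].
Qed.

Lemma val_prod (J : finType) (P : pred J) (f : J -> k) :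
  (forall i, P i -> I (f i)) -> I (\prod_(i | P i) f i).
Proof.
by move=> H; apply: (big_ind I) => //; [apply: (vr1 V)|apply: (vrM V)].
Qed.

Lemma intmx_det m (A : 'M[k]_m) : (forall i j, I (A i j)) -> I (\det A).
Proof.
move=> AI; apply: val_sum => s _; apply: (vrM V); last exact: val_prod.
by apply: (vrX V); apply: (vrN V); apply: (vr1 V).
Qed.

Lemma intv_mul x A : intv x -> intmx A -> intv (x *m A).
Proof. by move=> xI AI i; rewrite mxE; apply: val_sum => j _; apply: (vrM V). Qed.

Lemma intmx_inv A : intmx A -> I (\det A)^-1 -> A \in unitmx -> intmx (invmx A).
Proof.
move=> AI dI Au i j; rewrite /invmx Au !mxE; apply: (vrM V) => //.
rewrite /cofactor; apply: (vrM V); first by apply: (vrX V); apply: (vrN V); apply: (vr1 V).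
by apply: intmx_det => i' j'; rewrite !mxE.
Qed.

Lemma bform_int G x y : intmx G -> intv x -> intv y -> I (bform G x y).
Proof.
move=> GI xI yI; rewrite /bform mxE; apply: val_sum => j _; rewrite [_^T _ _]mxE.
by apply: (vrM V) => //; apply: intv_mul.
Qed.

Lemma intv_delta i : intv (delta_mx 0 i).
Proof.
by move=> j; rewrite mxE; case: (_ && _); [apply: (vr1 V)|apply: (vr0 V)].
Qed.

(** The inverse of the Gram matrix is integral by Cramer's rule. *)
Lemma selfdual_intv G : intmx G -> I (\det G)^-1 -> G \in unitmx -> selfdual I G intv.
Proof.
move=> GI dI Gu x; split=> [xI y yI|h]; first exact: bform_int.
rewrite -[x](mulmxK Gu); apply: intv_mul; last exact: intmx_inv.
by move=> i; have := h _ (intv_delta i); rewrite /bform trmx_delta -colE [col _ _ _ _]mxE.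
Qed.

Lemma selfdual_change G X : X \in unitmx -> selfdual I (X *m G *m X^T) intv ->
  selfdual I G (fun x => intv (x *m invmx X)).
Proof.
move=> Xu sd x.
have bE y : bform (X *m G *m X^T) (x *m invmx X) (y *m invmx X) = bform G x y.
  rewrite /bform trmx_mul !mulmxA mulmxKV// -(mulmxA _ X^T) -trmx_mul mulVmx//.
  by rewrite trmx1 mulmx1.
split=> [/sd h y /h|h]; first by rewrite bE.
apply/sd => y yI; have := h (y *m X); rewrite -bE !mulmxK// => /(_ yI).
by [].
Qed.

Lemma intv_absorb x : exists m, intv (p ^+ m *: x).
Proof.
suff [m mP] : exists m, forall i, i \in enum 'I_n -> I (p ^+ m * x 0 i).
  by exists m => i; rewrite mxE; apply: mP; rewrite mem_enum.
elim: (enum _) => [|i s [m IH]]; first by exists 0%N.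
have [l lI] := val_bound V (x 0 i); exists (m + l)%N => j.
rewrite inE exprD => /orP[/eqP ->|/IH js].
  by rewrite -mulrA; apply: (vrM V) => //; apply: (val_pX V).
by rewrite mulrAC mulrC; apply: (vrM V) => //; apply: (val_pX V).
Qed.

Lemma intmx_absorb A : exists m, intmx (p ^+ m *: A).
Proof.
suff [m mP] : exists m, forall i, i \in enum 'I_n -> intv (p ^+ m *: row i A).
  by exists m => i j; have := mP i (mem_enum _ _) j; rewrite !mxE.
elim: (enum _) => [|i s [m IH]]; first by exists 0%N.
have [l lI] := intv_absorb (row i A); exists (m + l)%N => j; rewrite inE exprD.
move=> /orP[/eqP -> c|/IH js c].
  by rewrite -scalerA mxE; apply: (vrM V) => //; apply: (val_pX V).
by rewrite mulrC -scalerA mxE; apply: (vrM V) => //; apply: (val_pX V).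
Qed.

(** On the orthogonal of [e] the form [model A t] is [A] scaled by [mu / lam];
    along [e] it is rescaled so as to stay regular. *)
Section Model.
Variables (mu lam : k).
Hypotheses (mu0 : mu != 0) (lam0 : lam != 0).

(** The form [A] minus its part along the vector with products [t], rescaled. *)
Definition model_rest A (t : 'rV[k]_n) := lam^-1 *: (mu *: A - t^T *m t).
Definition model A (t : 'rV[k]_n) := model_rest A t + t^T *m t.

(** The integral vector [e] has products [t] and length [mu] in [A]; it splits off
    as [mu] is a unit.  The case [e = 0], [t = 0] is that of a unimodular [A] on
    which nothing is rescaled. *)
Definition good_model A (e t : 'rV[k]_n) : Prop :=
  [/\ e *m A = t /\ ((e = 0 /\ t = 0) \/ ((t *m e^T) 0 0 = mu /\ I mu^-1)),
      intv e /\ intv t, intmx (model_rest A t),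
      I (\det (model A t))^-1 /\ model A t \in unitmx &
      I 2^-1 \/ forall i, exists2 h, I h & model_rest A t i i = 2 * h].

Lemma model_sym A t : A^T = A -> (model A t)^T = model A t.
Proof.
move=> symA; apply/matrixP => i j; rewrite !mxE !big_ord1 !mxE.
have -> : A j i = A i j by rewrite -{1}symA mxE.
by rewrite (mulrC (t 0 j)).
Qed.

Lemma qform_even_part A x : A^T = A ->
  exists s, (intmx A -> intv x -> I s) /\ qform A x = \sum_i A i i * x 0 i ^+ 2 + 2 * s.
Proof.
move=> symA.
exists (\sum_(i < n) \sum_(j < n | (i < j)%N) x 0 i * A i j * x 0 j); split.
  by move=> AI xI; apply: val_sum => i _; apply: val_sum => j _; do 2!apply: (vrM V) => //.
rewrite /qform /bform mxE.
transitivity (\sum_(j < n) \sum_(i < n) x 0 i * A i j * x 0 j).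
  by apply: eq_bigr => j _; rewrite !mxE mulr_suml.
rewrite [2 * _]mulr_natl mulr2n {1}exchange_big /=.
transitivity (\sum_(i < n) (x 0 i * A i i * x 0 i + \sum_(j < n | (j < i)%N) x 0 i * A i j * x 0 j +
     \sum_(j < n | (i < j)%N) x 0 i * A i j * x 0 j)).
  apply: eq_bigr => i _; rewrite (bigD1 i)//= -addrA; congr (_ + _).
  rewrite (bigID (fun j : 'I_n => (j < i)%N)) /=; congr (_ + _); apply: eq_bigl => j.
    by rewrite andbC; case: ltngtP => //= ji; rewrite -val_eqE /= ltn_eqF.
  by rewrite -leqNgt leq_eqVlt -val_eqE /= [val i == _]eq_sym; case: ltngtP.
rewrite !big_split /= -addrA; congr (_ + _).
  by apply: eq_bigr => i _; rewrite mulrAC -expr2 mulrC.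
congr (_ + _); rewrite (exchange_big_dep xpredT)//=; apply: eq_bigr => i _.
apply: eq_bigr => j _; rewrite -[in LHS]symA mxE; ring.
Qed.


Definition line_of (e : 'rV[k]_n) : 'rV[k]_n -> Prop := fun c => exists2 a, I a & c = a *: e.

Section GoodModel.
Variables (A : 'M[k]_n) (e t : 'rV[k]_n).
Hypothesis symA : A^T = A.
Hypothesis gA : good_model A e t.
Local Notation G := (model A t).

Lemma model_unit_vector : G *m e^T = mu *: t^T.
Proof.
have [[eA [[e0 t0]|[te _]]] _ _ _ _] := gA; first by rewrite e0 t0 trmx0 scaler0 mulmx0.
rewrite /model /model_rest mulmxDl -scalemxAl mulmxBl -scalemxAl -!mulmxA.
rewrite [t *m e^T]mx11_scalar te mul_mx_scalar.
have -> : A *m e^T = t^T by rewrite -{1}symA -trmx_mul eA.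
by rewrite subrr scaler0 add0r.
Qed.

Lemma bform_model_unit x : bform G x e = mu * (x *m t^T) 0 0.
Proof. by rewrite /bform -mulmxA model_unit_vector -scalemxAr mxE. Qed.

Lemma orth_line x : orth G (line_of e) x <-> x *m t^T = 0.
Proof.
split=> [h|xt c [a aI ->]]; last by rewrite bformZr ?model_sym// bform_model_unit xt mxE !mulr0.
have /eqP := h e (ex_intro2 _ _ 1 (vr1 V) (esym (scale1r e))).
rewrite bform_model_unit mulf_eq0 (negPf mu0) => /eqP xt0.
by rewrite [_ *m _]mx11_scalar xt0 raddf0.
Qed.

Lemma model_orth_mul v : v *m t^T = 0 -> v *m G = (mu / lam) *: (v *m A).
Proof.
move=> vt; rewrite /model /model_rest mulmxDr -scalemxAr mulmxBr -scalemxAr !mulmxA vt.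
by rewrite !mul0mx subr0 addr0 scalerA mulrC.
Qed.

Lemma qform_model v : v *m t^T = 0 -> qform G v = (mu / lam) * qform A v.
Proof. by move=> vt; rewrite /qform /bform model_orth_mul// -scalemxAl mxE. Qed.

Lemma reflection_model v : v *m t^T = 0 -> reflection G v = reflection A v.
Proof.
move=> vt; rewrite /reflection qform_model//; congr (_ - _).
have -> : G *m v^T = (mu / lam) *: (A *m v^T).
  by rewrite -(model_sym t symA) -trmx_mul model_orth_mul// linearZ /= trmx_mul symA.
rewrite -scalemxAl scalerA; congr (_ *: _).
have [->|q0] := eqVneq (qform A v) 0; first by rewrite mulr0 invr0 !mulr0 mul0r.
by field; rewrite mu0 lam0 q0.
Qed.

Lemma reflections_model vs : (forall v, v \in vs -> v *m t^T = 0) ->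
  reflections G vs = reflections A vs.
Proof.
move=> vst; rewrite /reflections !big_seq; apply: eq_bigr => v /vst; exact: reflection_model.
Qed.

Lemma line_intv c : line_of e c -> intv c.
Proof.
have [_ [eI _] _ _ _] := gA.
by move=> [a aI ->] i; rewrite mxE; apply: (vrM V).
Qed.

Lemma line_splits : splits I G (line_of e).
Proof.
move=> x xI; have [[eA [[e0 t0]|[te mu']]] [eI tI] _ _ _] := gA.
  exists 0; first by exists 0; [apply: (vr0 V)|rewrite scale0r].
  move=> _ [a _ ->]; rewrite e0 scaler0 bform0r// ?model_sym//.
have ee : bform G e e = mu * mu.
  rewrite bform_model_unit; congr (_ * _); rewrite -te.
  by rewrite -[in LHS](trmxK e) -trmx_mul mxE.
pose a := bform G x e / (mu * mu).
have e1 : line_of e e by exists 1; [apply: (vr1 V)|rewrite scale1r].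
exists (a *: e).
  by exists a => //; rewrite /a invfM; apply: (vrM V); [apply: xI|apply: (vrM V)].
move=> _ [b _ ->]; rewrite bformZr ?model_sym// bformDl bformNl bformZl ee /a.
by rewrite mulfVK ?mulf_neq0// subrr mulr0.
Qed.

Lemma model_int : intmx G.
Proof.
have [_ [_ tI] rI _ _] := gA; move=> i j; rewrite mxE; apply: (vrD V) => //.
by rewrite mxE big_ord1 mxE; apply: (vrM V).
Qed.

Lemma model_even : even_on I G (line_of e) intv.
Proof.
move=> x xI /orth_line xt; have [_ _ rI _ ev] := gA.
have [h2|ev2] := ev.
  exists (qform G x / 2); last by rewrite mulrC divfK// (val2_neq0 V).
  by apply: (vrM V) => //; apply: bform_int => //; apply: model_int.
have -> : qform G x = qform (model_rest A t) x.
  rewrite /qform /bform /model mulmxDr mulmxA xt mul0mx addr0; congr (_ 0 0).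
have sr : (model_rest A t)^T = model_rest A t.
  have := model_sym t symA; rewrite /model linearD /= trmx_mul trmxK.
  by move=> /addIr.
have [s [sI ->]] := qform_even_part x sr.
have /boolp.choice[h hP] : forall i, exists h, I h /\ model_rest A t i i = 2 * h.
  by move=> i; have [h hI hE] := ev2 i; exists h.
exists (\sum_i h i * x 0 i ^+ 2 + s).
  apply: (vrD V); last exact: sI.
  by apply: val_sum => i _; apply: (vrM V); [apply: (hP i).1|apply: (vrX V)].
rewrite mulrDr mulr_sumr; congr (_ + _); apply: eq_bigr => i _.
by rewrite (hP i).2 mulrA.
Qed.

Lemma model_selfdual : selfdual I G intv.
Proof.
have [_ _ _ [dI Gu] _] := gA; apply: selfdual_intv => //; exact: model_int.
Qed.

(** By [represents_units] the complement of [e] has vectors of halved length [1]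
    and [u] for [G]; their reflections preserve the lattice and are reflections
    for [A]. *)
Theorem model_units u : (2 < n)%N -> val_is_unit I u ->
  exists v1 v2 c,
  [/\ qform A v1 != 0, qform A v2 != 0, c != 0,
      forall x, intv x <-> intv (x *m reflections A [:: v1; v2])
    & qform A v1 * qform A v2 = c ^+ 2 * u].
Proof.
move=> n2 uu; have symG := model_sym t symA.
have [_ _ _ [_ Gu] _] := gA.
have big y : exists z, [/\ z != 0, orth G (line_of e) z & bform G z y = 0].
  pose W : 'M[k]_(n, 1 + 1) := row_mx t^T (G *m y^T).
  have kW : kermx W != 0.
    by rewrite -mxrank_eq0 mxrank_ker subn_eq0 -ltnNge (leq_ltn_trans (rank_leq_col W)).
  have [i zi] : exists i, row i (kermx W) != 0.
    apply/existsP; apply: contraNT kW; rewrite negb_exists => /forallP h.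
    by apply/eqP/row_matrixP => i; rewrite row0; apply/eqP/negPn/h.
  exists (row i (kermx W)).
  have : row i (kermx W) *m W = 0 by apply/sub_kermxP/row_sub.
  rewrite mul_mx_row mulmxA => /eqP; rewrite row_mx_eq0 => /andP[/eqP zt /eqP zy].
  by split=> //; [apply/orth_line|rewrite /bform zy mxE].
have get w : val_is_unit I w -> exists v, [/\ intv v, v *m t^T = 0 & qform G v = 2 * w].
  move=> uw; have [v [vI /orth_line vC Qv]] := represents_units V symG model_selfdual
    line_intv (ex_intro2 _ _ 0 (vr0 V) (esym (scale0r e))) line_splits model_even Gu
    intv_absorb big uw.
  by exists v.
have u1 : val_is_unit I 1 by split; rewrite ?invr1 ?oner_neq0//; apply: (vr1 V).
have [v1 [v1I v1t Qv1]] := get _ u1; have [v2 [v2I v2t Qv2]] := get _ uu.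
have two0 := val2_neq0 V; have [uI u' u0] := uu.
have ml0 : mu / lam != 0 by rewrite mulf_neq0// invr_eq0.
have QA v : v *m t^T = 0 -> qform A v = lam / mu * qform G v.
  by move=> vt; rewrite qform_model//; field; rewrite lam0 mu0.
have pres v w : intv v -> v *m t^T = 0 -> qform G v = 2 * w -> val_is_unit I w ->
    forall x, intv x -> intv (x *m reflection A v).
  move=> vI vt Qv [wI w' w0] x xI; rewrite -reflection_model// reflectionE Qv.
  have -> : 2 * bform G x v / (2 * w) = bform G x v / w by field; rewrite two0 w0.
  move=> i; rewrite !mxE; apply: (vrB V) => //; apply: (vrM V) => //.
  by apply: (vrM V) => //; apply: bform_int => //; apply: model_int.
have q0 v w : v *m t^T = 0 -> qform G v = 2 * w -> val_is_unit I w -> qform A v != 0.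
  by move=> vt Qv [_ _ w0]; rewrite QA// Qv !mulf_neq0// ?invr_eq0.
have q1 := q0 _ _ v1t Qv1 u1; have q2 := q0 _ _ v2t Qv2 uu.
exists v1, v2, (2 * lam / mu); split=> //.
- by rewrite !mulf_neq0// invr_eq0.
- have rE x : x *m reflections A [:: v1; v2] = x *m reflection A v1 *m reflection A v2.
    by rewrite /reflections !big_cons big_nil mulmx1 mulmxA.
  move=> x; rewrite rE; split=> [xI|h].
    by apply: (pres _ _ v2I v2t Qv2) => //; apply: (pres _ _ v1I v1t Qv1).
  have := pres _ _ v2I v2t Qv2 uu _ h; rewrite -mulmxA reflectionK// mulmx1.
  move=> /(pres _ _ v1I v1t Qv1 u1); by rewrite -mulmxA reflectionK// mulmx1.
by rewrite !QA// Qv1 Qv2; field.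
Qed.

End GoodModel.

(** The two lattices are self-dual for [G] and share the line of [e];
    [selfdual_transport] applies, and its reflections, orthogonal to [e], are
    reflections for [A]. *)
Theorem model_transport A e t A' e' t' X : A^T = A -> X \in unitmx ->
  X *m A *m X^T = A' -> e' *m X = e -> good_model A e t -> good_model A' e' t' ->
  exists vs, all (fun v => qform A v != 0) vs /\
    forall x, intv x <-> intv (x *m reflections A vs *m invmx X).
Proof.
move=> symA Xu XA eX gA gA'.
have symA' : A'^T = A' by rewrite -XA !trmx_mul trmxK symA mulmxA.
have tX : t *m X^T = t'.
  have [[<- _] _ _ _ _] := gA; have [[<- _] _ _ _ _] := gA'.
  by rewrite -XA -eX !mulmxA.
have GX : X *m model A t *m X^T = model A' t'.
  rewrite /model /model_rest -tX mulmxDr mulmxDl -scalemxAr -scalemxAl mulmxBr mulmxBl.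
  by rewrite -scalemxAr -scalemxAl XA trmx_mul trmxK !mulmxA.
have symG := model_sym t symA.
have sdM := model_selfdual gA.
have sdN : selfdual I (model A t) (fun x => intv (x *m invmx X)).
  by apply: selfdual_change => //; rewrite GX; apply: (model_selfdual gA').
have line0 : line_of e 0 by exists 0; [apply: (vr0 V)|rewrite scale0r].
have line_lin a b x y : I a -> I b -> line_of e x -> line_of e y -> line_of e (a *: x + b *: y).
  move=> aI bI [c cI ->] [d dI ->]; exists (a * c + b * d).
    by apply: (vrD V); apply: (vrM V).
  by rewrite scalerDl !scalerA.
have lineN c : line_of e c -> intv (c *m invmx X).
  move=> [a aI ->]; rewrite -eX scalemxAl mulmxK//.
  by apply: (line_intv gA'); exists a.
have evN : even_on I (model A t) (line_of e) (fun x => intv (x *m invmx X)).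
  move=> x xI /(orth_line symA gA) xt.
  have xt' : x *m invmx X *m t'^T = 0 by rewrite -tX trmx_mul trmxK mulmxA mulmxKV.
  have [] := model_even symA' gA' xI; first exact/(orth_line symA' gA').
  move=> h hI hE; exists h => //; rewrite -hE -GX /qform /bform trmx_mul !mulmxA mulmxKV//.
  by rewrite -(mulmxA _ X^T) -trmx_mul mulVmx// trmx1 mulmx1.
have [m mX] := intmx_absorb X.
have bd : exists j, forall x, intv (x *m invmx X) -> intv (p ^+ j *: x).
  exists m => x xI; rewrite -[x](mulmxKV Xu) scalemxAr; exact: intv_mul.
have Df : row_free (0 : 'M[k]_(0, n)) by rewrite /row_free mxrank0.
have DC (i : 'I_0) : line_of e (row i (0 : 'M[k]_(0, n))) by case: i.
have [vs [vs0 vsC MN]] := selfdual_transport V symG Df DC line0 line_lin (line_intv gA)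
  lineN (line_splits symA gA) sdM sdN (model_even symA gA) evN bd.
have vst v : v \in vs -> v *m t^T = 0 by move=> /vsC/(orth_line symA gA).
exists vs; split; last by move=> x; rewrite MN (reflections_model symA vst).
apply/allP => v vvs; have := allP vs0 _ vvs; rewrite qform_model ?vst//.
by apply: contraNneq => ->; rewrite mulr0.
Qed.

End Model.
End LocalModel.

(** * The trace form over the p-adic numbers *)

Lemma disc_prime_degree (K : splittingFieldType rat) (galK : galois 1 {:K}) p m
    (b : 'I_m -> ring_of_integers K) : prime p -> totally_ramified K -> tame K ->
  integral_basis b -> (p %| \dim {:K})%N ->
  ~~ (p %| \det (\matrix_(i, j) trO galK (b i * b j)))%Z.
Proof.
move=> p_pr ramK tameK bP pn; have mn := integral_basis_size bP; subst m.
apply/negP => pd; have [_ [_ [_ [_ [_ [_ _]]]]]] := ramified_setup p_pr ramK tameK bP pd.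
by rewrite pn.
Qed.

Section TraceModel.
Variables (K : splittingFieldType rat) (galK : galois 1 {:K}).
Local Notation OF := (ring_of_integers K).
Local Notation tr := (trO galK).
Variables (m : nat) (b : 'I_m -> OF) (e : 'I_m -> int).
Hypothesis bP : integral_basis b.
Hypothesis e1 : 1 = \sum_i b i *~ e i.

Lemma unit_coord_trace x : \sum_i e i * tr (b i * x) = tr x.
Proof.
rewrite -trO_sum_lin; congr tr; rewrite -[RHS]mul1r [in RHS]e1 mulr_suml.
by apply: eq_bigr => i _; rewrite mulrA mulrzl.
Qed.

Lemma unit_coord_degree : \sum_i e i * tr (b i) = \dim {:K}.
Proof.
by rewrite -(trO1 galK) -[RHS]unit_coord_trace; apply: eq_bigr => i _; rewrite mulr1.
Qed.

Section Padic.
Variables (p : nat) (p_pr : prime p).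
Local Notation k := (padic p_pr).
Local Notation phi := (padic_ratr p_pr).
Local Notation A := (map_mx phi (trace_gram b)).
Definition int_row (f : 'I_m -> int) : 'rV[k]_m := \row_i (f i)%:~R.
Local Notation t := (int_row (fun i => tr (b i))).

Lemma padic_trace_gram i j : A i j = (tr (b i * b j))%:~R.
Proof. by rewrite (trace_gramE galK) !mxE rmorph_int. Qed.

Lemma int_row_dot (f g : 'I_m -> int) :
  (int_row f *m (int_row g)^T) 0 0 = (\sum_i f i * g i)%:~R.
Proof.
by rewrite mxE rmorph_sum; apply: eq_bigr => i _; rewrite !mxE rmorphM.
Qed.

Lemma padic_half : p != 2%N -> pint ((2 : k)^-1).
Proof.
by move=> p2; apply/punit_pintV/(@punit_nat _ _ 2); rewrite dvdn_prime2.
Qed.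

Hypothesis oddK : odd (\dim {:K}).
Hypothesis ramK : totally_ramified K.
Hypothesis tameK : tame K.

Lemma local_scale_gt0 : (0 < local_scale galK p b)%N.
Proof. by rewrite /local_scale; case: ifP => // _; exact: prime_gt0. Qed.

Lemma natk_neq0 j : (0 < j)%N -> j%:R != 0 :> k.
Proof. by move=> j0; have /pcharf0P -> := padic_pchar p_pr; rewrite -lt0n. Qed.

(** Away from the degree the vector [1] splits off. *)
Lemma trace_form_model : ~~ (p %| \dim {:K})%N ->
  good_model (@pint p p_pr) (\dim {:K})%:R (local_scale galK p b)%:R A (int_row e) t.
Proof.
move=> pn; have [D [DE D2 pD]] := local_gram galK oddK p_pr ramK tameK bP pn.
have lam0 := natk_neq0 local_scale_gt0.
have restE i j : model_rest (\dim {:K})%:R (local_scale galK p b)%:R A t i j = (D i j)%:~R.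
  have := DE i j; move: (local_scale _ _ _) lam0 => l l0 E.
  rewrite /model_rest mxE; apply: (mulfI l0); rewrite mulVKf//.
  rewrite mxE [X in X + _]mxE padic_trace_gram.
  rewrite !mxE big_ord1 !mxE.
  have := congr1 (fun z : int => z%:~R : k) E.
  by rewrite rmorphM rmorphB !rmorphM.
split.
- split.
    apply/rowP => j; rewrite [LHS]mxE [RHS]mxE -unit_coord_trace rmorph_sum.
    by apply: eq_bigr => i _; rewrite padic_trace_gram mxE rmorphM.
  right; split; last by apply/punit_pintV/punit_nat.
  rewrite int_row_dot -[RHS](_ : (\dim {:K} : int)%:~R = _)//; congr (_%:~R).
  by rewrite -unit_coord_degree; apply: eq_bigr => i _; rewrite mulrC.
- by split=> i; rewrite mxE; apply: pint_int.
- by move=> i j; rewrite restE; apply: pint_int.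
- have -> : model (\dim {:K})%:R (local_scale galK p b)%:R A t =
      map_mx intr (\matrix_(i, j) (D i j + tr (b i) * tr (b j))).
    apply/matrixP => i j; rewrite [LHS]mxE restE !mxE big_ord1 !mxE.
    by rewrite rmorphD rmorphM.
  have uD := punit_intr p_pr pD.
  by rewrite unitmxE det_map_mx unitfE (punit_neq0 uD); split=> //; apply: punit_pintV.
have [p2|p2] := eqVneq p 2%N; last by left; apply: padic_half.
right=> i; have /dvdzP[q qE] := D2 p2 i; exists q%:~R; first exact: pint_int.
by rewrite restE qE rmorphM mulrC.
Qed.

(** By tameness a prime dividing the degree is unramified, and it is odd: the
    trace form itself is unimodular there and parity is no condition. *)
Lemma trace_form_model_degree : (p %| \dim {:K})%N ->
  good_model (@pint p p_pr) 1 1 A 0 0.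
Proof.
move=> pn.
have pdet := disc_prime_degree galK p_pr ramK tameK bP pn.
have restE : model_rest 1 1 A 0 = A.
  by rewrite /model_rest invr1 !scale1r mulmx0 subr0.
have modE : model 1 1 A 0 = A by rewrite /model restE mulmx0 addr0.
split.
- by split; [rewrite mul0mx|left].
- by split=> i; rewrite mxE; apply: pint0.
- by move=> i j; rewrite restE padic_trace_gram; apply: pint_int.
- rewrite modE; have -> : A = map_mx intr (\matrix_(i, j) tr (b i * b j)).
    by apply/matrixP => i j; rewrite padic_trace_gram [RHS]mxE mxE.
  have uD := punit_intr p_pr pdet.
  by rewrite unitmxE det_map_mx unitfE (punit_neq0 uD); split=> //; apply: punit_pintV.
left; apply: padic_half; apply: contraTneq pn => ->.
by rewrite dvdn2 oddK.
Qed.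

End Padic.
End TraceModel.

(** * Spinor norms over the rationals *)

Section OrthonormalReflections.
Variables (k : fieldType) (n : nat) (B Y : 'M[k]_n).
Hypotheses (symB : B^T = B) (YB : Y *m B *m Y^T = 1%:M).

Lemma orthonormal_row i j : bform B (row i Y) (row j Y) = (i == j)%:R.
Proof.
by rewrite -bform_mx YB mxE.
Qed.

(** Each vector of an orthonormal basis is only changed by its own reflection. *)
Lemma orthonormal_reflections s j : uniq s ->
  row j Y *m reflections B [seq row i Y | i <- s] =
  if j \in s then - row j Y else row j Y.
Proof.
elim: s j => [|i s IH] j /=; first by rewrite /reflections big_nil mulmx1.
case/andP=> ins us; rewrite /reflections big_cons -/(reflections _ _) mulmxA.
have q1 : qform B (row i Y) = 1 by rewrite /qform orthonormal_row eqxx.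
rewrite finset.inE; have [-> /=|ij] := eqVneq j i.
  rewrite reflectionE q1 -/(qform B (row i Y)) q1 mulr1 divr1.
  have -> : row i Y - 2 *: row i Y = - row i Y.
    by rewrite scalerDl !scale1r opprD addrA subrr add0r.
  by rewrite mulNmx IH// (negPf ins).
by rewrite reflection_fix ?orthonormal_row ?(negPf ij)// IH.
Qed.

(** The reflections in an orthonormal basis multiply to [-1]. *)
Lemma opposite_reflections : exists vs : seq 'rV[k]_n,
  [/\ all (fun v => qform B v != 0) vs, reflections B vs = - 1%:M &
      \prod_(v <- vs) qform B v = 1].
Proof.
have q1 i : qform B (row i Y) = 1 by rewrite /qform orthonormal_row eqxx.
exists [seq row i Y | i <- enum 'I_n]; split.
- by apply/allP => _ /mapP[i _ ->]; rewrite q1 oner_neq0.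
- have [Yu _] := mulmx1_unit (etrans (mulmxA _ _ _) YB).
  apply: (can_inj (mulKmx Yu)); apply/row_matrixP => i; rewrite mulmxN mulmx1.
  by rewrite row_mul orthonormal_reflections ?enum_uniq// mem_enum raddfN.
by rewrite big_map; apply: big1 => i _; rewrite q1.
Qed.

End OrthonormalReflections.

Lemma map_reflections (k k' : fieldType) (f : {rmorphism k -> k'}) n (B : 'M[k]_n) vs :
  map_mx f (reflections B vs) = reflections (map_mx f B) (map (map_mx f) vs).
Proof.
elim: vs => [|v vs IH]; first by rewrite /reflections !big_nil map_mx1.
rewrite map_cons /reflections !big_cons map_mxM -/(reflections _ _) IH; congr (_ *m _).
rewrite /reflection map_mxB map_mx1 map_mxZ !map_mxM -matrix.map_trmx qform_map.
by rewrite fmorph_div rmorph_nat.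
Qed.

(** It suffices to treat a prime [p], which divides some [x^2 + y^2 + 1] with a
    cofactor less than [p]; the cofactor is treated first. *)
Theorem spinor_norm_values n (B Y : 'M[rat]_n) (N : nat) : B^T = B ->
  Y *m B *m Y^T = 1%:M -> (2 < n)%N -> (0 < N)%N ->
  exists (vs : seq 'rV[rat]_n) (c : rat),
    [/\ all (fun v => qform B v != 0) vs, c != 0 &
        \prod_(v <- vs) qform B v = c ^+ 2 * N%:R].
Proof.
move=> symB YB n2.
have squares (x y z : nat) : exists v, qform B v = (x ^ 2 + y ^ 2 + z ^ 2)%:R.
  pose i0 : 'I_n := Ordinal (ltnW (ltnW n2)); pose i1 : 'I_n := Ordinal (ltnW n2).
  pose i2 : 'I_n := Ordinal n2.
  exists (x%:R *: row i0 Y + y%:R *: row i1 Y + z%:R *: row i2 Y).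
  rewrite !qformD// /qform !bformE// !orthonormal_row//= !mulr0 !mulr1 !addr0.
  by rewrite !natrD !natrX !expr2.
have [l] := ubnP N; elim: l N => // l IH N; rewrite ltnS => Nl N0.
have [N1|N1] := leqP N 1.
  exists [::], 1; split; rewrite ?oner_neq0// big_nil expr1n mul1r.
  by have -> : N = 1%N by lia.
have [q q_pr qN] : exists2 q, prime q & (q %| N)%N.
  by exists (pdiv N); [apply: pdiv_prime|apply: pdiv_dvd].
have q1 := prime_gt1 q_pr.
have [Nq|Nq] := eqVneq N q; last first.
  have /dvdnP[m mE] := qN.
  have m0 : (0 < m)%N by rewrite lt0n; apply: contraTneq N0 => m0; rewrite mE m0.
  have m1 : m != 1%N by apply: contraNneq Nq => m1; rewrite {1}mE m1 mul1n.
  have [vs [c [vs0 c0 vsE]]] := IH m ltac:(nia) m0.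
  have [ws [d [ws0 d0 wsE]]] := IH q ltac:(nia) ltac:(lia).
  exists (vs ++ ws), (c * d); split; first by rewrite all_cat vs0.
    by rewrite mulf_neq0.
  by rewrite big_cat /= vsE wsE mE natrM; ring.
rewrite Nq; have [q2|qodd] := even_prime q_pr.
  have [v vE] := squares 1%N 1%N 0%N; exists [:: v], 1.
  by rewrite /= vE q2 big_cons big_nil vE; split; rewrite ?expr1n ?mul1r ?mulr1.
have d1 : ~~ (q %| 1)%N by rewrite dvdn1; lia.
(* As [x] and [y] are at most [q / 2], the cofactor [m] is less than [q]. *)
have [x [y [xq yq /dvdnP[m mE]]]] := conic_mod_p 1 q_pr qodd d1 d1.
rewrite !mul1n in mE.
have mq : (m < q)%N.
  have := odd_double_half q; rewrite qodd -addnn => qE; nia.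
have m0 : (0 < m)%N by case: (m) mE => //; rewrite mul0n addn1.
have [vs [c [vs0 c0 vsE]]] := IH m ltac:(lia) m0.
have [v vE] := squares x y 1%N.
have q0 : q%:R != 0 :> rat by rewrite pnatr_eq0; lia.
have mR : m%:R != 0 :> rat by rewrite pnatr_eq0; lia.
have vE' : qform B v = m%:R * q%:R by rewrite vE -natrM -mE.
exists (v :: vs), (c * m%:R); split.
- by rewrite /= vE' mulf_neq0.
- by rewrite mulf_neq0.
by rewrite big_cons vE' vsE; ring.
Qed.

(** * From local isometries to the spinor genus *)

Section LatticeAt.
Variables (p : nat) (p_pr : prime p) (n : nat).
Local Notation k := (padic p_pr).
Local Notation phi := (padic_ratr p_pr).
Local Notation intv := (@intv k (@pint p p_pr) n).

Lemma lattice_atE (M : 'M[rat]_n) (x : 'rV[k]_n) : M \in unitmx ->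
  lattice_at p_pr M x <-> intv (x *m invmx (map_mx phi M)).
Proof.
move=> Mu; have Mpu : map_mx phi M \in unitmx by rewrite map_unitmx.
split=> [[c _ <-] i|xI].
  by rewrite -[map_mx ratr M]/(map_mx phi M) mulmxK// mxE; exists (c 0 i).
have /boolp.choice[c cE] : forall i, exists r, (x *m invmx (map_mx phi M)) 0 i = FracField.tofrac r.
  exact: xI.
exists (\row_i c i) => //; rewrite -[map_mx ratr M]/(map_mx phi M).
rewrite -[RHS](mulmxKV Mpu); congr (_ *m _).
by apply/rowP => i; rewrite !mxE -cE mxE.
Qed.

Lemma intvN (x : 'rV[k]_n) : intv x -> intv (- x).
Proof. by move=> xI i; rewrite mxE; apply: pintN. Qed.

End LatticeAt.

(** The part of the product prime to [p] is a [p]-adic unit. *)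
Lemma prod_prime_powers (s : seq nat) (f : nat -> nat) p : prime p -> uniq s ->
  all prime s -> (p \notin s -> f p = 0%N) ->
  exists2 N, ~~ (p %| N)%N & (\prod_(q <- s) q ^ f q = p ^ f p * N)%N.
Proof.
move=> p_pr us sp fp; exists (\prod_(q <- s | q != p) q ^ f q)%N.
  rewrite -prime_coprime// big_seq_cond; apply: (big_ind (coprime p)) => [|x y cx cy|q].
  - exact: coprimen1.
  - by rewrite coprimeMr cx.
  case/andP=> /(allP sp) q_pr qp; rewrite coprimeXr// prime_coprime// dvdn_prime2//.
  by rewrite eq_sym.
have [ps|ps] := boolP (p \in s); first by rewrite (bigD1_seq p).
rewrite fp// expn0 mul1n [LHS]big_seq_cond [RHS]big_seq_cond; apply: eq_bigl => q.
by rewrite andbT; case: (boolP (q \in s)) => // qs; apply/esym; apply: contraNneq ps => <-.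
Qed.

Lemma norm_ring (k : fieldType) (c1 c c0 u N q : k) :
  c1 ^+ 2 * (u * N) * (c ^+ 2 * q * u) * (c0 ^+ 2 * (q * N)) =
  (c1 * c * c0 * (u * N) * q) ^+ 2.
Proof. by ring. Qed.

Lemma norm_neq0 (k : fieldType) (a b c d e : k) :
  a != 0 -> b != 0 -> c != 0 -> d != 0 -> e != 0 -> a * b * c * d * e != 0.
Proof. by move=> a0 b0 c0 d0 e0; rewrite !mulf_neq0. Qed.

Lemma all_pair (T : Type) (P : pred T) a b : P a -> P b -> all P [:: a; b].
Proof. by move=> /= -> ->. Qed.

Lemma reflections_det (k : fieldType) n (B : 'M[k]_n) vs : B^T = B -> B \in unitmx ->
  all (fun v => qform B v != 0) vs ->
  \det (reflections B vs) = 1 \/ \det (reflections B vs) = -1.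
Proof. by move=> symB Bu vs0; apply: (orthogonal_det Bu); apply: orthogonal_reflections. Qed.

(** The local correction: [S] undoes the rational reflections [ws] and performs
    the local transport [vs], after a stabilizer [us] and possibly [-1] have
    adjusted its spinor norm and its determinant. *)
Lemma special_transport (k : fieldType) n (B Y : 'M[k]_n) (L N : 'rV[k]_n -> Prop)
    (us vs ws : seq 'rV[k]_n) (c : k) :
  B^T = B -> B \in unitmx -> Y *m B *m Y^T = 1%:M -> odd n ->
  all (fun v => qform B v != 0) us -> all (fun v => qform B v != 0) vs ->
  all (fun v => qform B v != 0) ws -> c != 0 ->
  (forall x, L x -> L (- x)) ->
  (forall x, L x <-> L (x *m reflections B us)) ->
  (forall x, L x <-> N (x *m reflections B vs)) ->
  (\prod_(v <- us) qform B v) * (\prod_(v <- vs) qform B v) *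
    (\prod_(v <- ws) qform B v) = c ^+ 2 ->
  exists S, [/\ special_orthogonal_group B S, trivial_spinor_norm B S &
    forall y, N y <-> exists2 x, L x & x *m S *m reflections B ws = y].
Proof.
move=> symB Bu YB oddn us0 vs0 ws0 c0 LN Lus LNvs cE.
pose S0 := us ++ vs ++ rev ws.
have S00 : all (fun v => qform B v != 0) S0 by rewrite !all_cat us0 vs0 all_rev.
have [os [os0 osE osQ]] := opposite_reflections YB.
have [zs [zs0 zsE zsQ zsd]] : exists zs,
    [/\ all (fun v => qform B v != 0) zs,
        reflections B zs = 1%:M \/ reflections B zs = - 1%:M,
        \prod_(v <- zs) qform B v = 1 & \det (reflections B (zs ++ S0)) = 1].
  have [dS|dS] := reflections_det symB Bu S00.
    exists [::]; rewrite big_nil; split=> //.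
    by left; rewrite /reflections big_nil.
  exists os; split=> //; first by right.
  rewrite reflections_cat det_mulmx dS osE -scaleN1r detZ det1 mulr1.
  by rewrite -signr_odd oddn expr1 mulrNN mulr1.
have all0 : all (fun v => qform B v != 0) (zs ++ S0) by rewrite all_cat zs0.
have wsK : reflections B (rev ws) *m reflections B ws = 1%:M.
  by apply: mulmx1C; apply: reflections_rev.
pose W := reflections B us *m reflections B vs.
have SE x : x *m reflections B (zs ++ S0) *m reflections B ws = x *m reflections B zs *m W.
  by rewrite /S0 !reflections_cat -!mulmxA wsK mulmx1 /W.
have LW x : L x <-> N (x *m W) by rewrite mulmxA -LNvs -Lus.
have Wu : W \in unitmx.
  by rewrite unitmx_mul (orthogonal_reflections symB us0).1 (orthogonal_reflections symB vs0).1.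
exists (reflections B (zs ++ S0)); split.
- by split; [apply: orthogonal_reflections|].
- exists (zs ++ S0), c^-1; split=> //; first by rewrite invr_eq0.
  rewrite !big_cat /= zsQ mul1r; have -> : \prod_(i <- rev ws) qform B i = \prod_(i <- ws) qform B i.
    by apply: perm_big; rewrite perm_rev.
  by rewrite [X in _ = _ * X]mulrA cE exprVn mulVf// expf_neq0.
move=> y; have yE : N y <-> L (y *m invmx W) by rewrite LW mulmxKV.
have Lz x : L x -> L (x *m reflections B zs).
  by case: zsE => ->; rewrite ?mulmx1// mulmxN mulmx1; apply: LN.
split=> [/yE Ly|[x Lx <-]]; last by rewrite SE -LW; apply: Lz.
exists (y *m invmx W *m reflections B zs); first exact: Lz.
rewrite SE; have -> : y *m invmx W *m reflections B zs *m reflections B zs = y *m invmx W.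
  by case: zsE => ->; rewrite ?mulmx1// !mulmxN !mulmx1 opprK.
by rewrite mulmxKV.
Qed.

(** The spinor norm of the local transport at [p] is a power of [p] times a unit,
    up to squares, and the power is trivial for almost all [p].  As the rationals
    have class number one, a single positive rational [b] has these valuations;
    it is a spinor norm of rational reflections [ws].  Composing with their
    inverse leaves a unit at each [p], the spinor norm of a local stabilizer. *)
Theorem same_spinor_genus_of_local n (B X Y : 'M[rat]_n) : B^T = B ->
  Y *m B *m Y^T = 1%:M -> X \in unitmx -> odd n -> (2 < n)%N ->
  (forall p (p_pr : prime p), let Bp := map_mx (padic_ratr p_pr) B in
     let Xp := map_mx (padic_ratr p_pr) X in
     exists vs, all (fun v => qform Bp v != 0) vs /\
       forall x, intv (@pint p p_pr) x <->
                 intv (@pint p p_pr) (x *m reflections Bp vs *m invmx Xp)) ->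
  (forall p (p_pr : prime p) u, punit u -> let Bp := map_mx (padic_ratr p_pr) B in
     exists v1 v2 c,
     [/\ qform Bp v1 != 0, qform Bp v2 != 0, c != 0,
       forall x, intv (@pint p p_pr) x <-> intv (@pint p p_pr) (x *m reflections Bp [:: v1; v2])
     & qform Bp v1 * qform Bp v2 = c ^+ 2 * u]) ->
  lattice_same_spinor_genus B 1%:M X.
Proof.
move=> symB YB Xu oddn n2 loc units.
have [Yu BYu] := mulmx1_unit (etrans (mulmxA _ _ _) YB).
have Bu : B \in unitmx by move: BYu; rewrite unitmx_mul => /andP[].
(* For primes not dividing [d] the two lattices coincide. *)
have [d d0 dP] := common_denominator
  (fun ij : bool * ('I_n * 'I_n) => (if ij.1 then X else invmx X) ij.2.1 ij.2.2).
have dn0 : (0 < `|d|)%N by rewrite absz_gt0 gt_eqF.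
pose good p (p_pr : prime p) m vs := let Bp := map_mx (padic_ratr p_pr) B in
  let Xp := map_mx (padic_ratr p_pr) X in
  [/\ all (fun v => qform Bp v != 0) vs,
    forall x, intv (@pint p p_pr) x <->
                 intv (@pint p p_pr) (x *m reflections Bp vs *m invmx Xp),
    p \notin primes `|d| -> m = 0%N &
    exists c u, [/\ c != 0, punit u & \prod_(v <- vs) qform Bp v = c ^+ 2 * p%:R ^+ m * u]].
have /boolp.choice[f fP] : forall p, exists m, forall p_pr : prime p, exists vs, good p p_pr m vs.
  move=> p; have [p_pr|np] := pselect (prime p); last first.
    by exists 0%N => p_pr; case: np.
  have [pd|pd] := boolP (p \in primes `|d|).
    have [vs [vs0 vsP]] := loc p p_pr.
    have nu0 : \prod_(v <- vs) qform (map_mx (padic_ratr p_pr) B) v != 0.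
      by rewrite prodf_seq_neq0; apply/allP => v /(allP vs0).
    have [m [u [uu mE]]] := padic_cases nu0; exists m => p_pr'.
    have -> : p_pr' = p_pr by [apply: bool_irrelevance]; exists vs; split=> //; first by rewrite pd.
    case: mE => ->; first by exists 1, u; rewrite oner_neq0 expr1n mul1r.
    have p0 := expf_neq0 m (padic_p_neq0 p_pr).
    exists (p%:R ^+ m)^-1, u; rewrite invr_eq0; split=> //.
    by rewrite expr2 mulrC; congr (_ * _); rewrite mulfVK.
  exists 0%N => p_pr'; have -> : p_pr' = p_pr by [apply: bool_irrelevance]; exists [::]; split=> //.
  - move=> x; rewrite /reflections big_nil mulmx1.
    have pd' : ~~ (p %| d)%Z by move: pd; rewrite mem_primes p_pr dn0 dvdzE.
    have ent c i j : pint (padic_ratr p_pr ((if c then X else invmx X) i j)).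
      have [m mE] := dP (c, (i, j)); exact: (pint_ratr p_pr pd' mE).
    have Xpu : map_mx (padic_ratr p_pr) X \in unitmx by rewrite map_unitmx.
    have V := padic_valuation_ring p_pr.
    split=> xI.
      apply: (intv_mul V) => // i j; rewrite -map_invmx mxE; exact: (ent false).
    rewrite -[x](mulmxKV Xpu); apply: (intv_mul V) => // i j; rewrite mxE; exact: (ent true).
  - by exists 1, 1; rewrite oner_neq0 big_nil expr1n expr0 !mulr1; split=> //; apply: punit1.
pose b := (\prod_(q <- primes `|d|) q ^ f q)%N.
have b0 : (0 < b)%N.
  rewrite /b big_seq; apply: (big_ind (fun x => (0 < x)%N)) => // [x y x0 y0|q].
    by rewrite muln_gt0 x0.
  by rewrite mem_primes => /and3P[q_pr _ _]; rewrite expn_gt0 prime_gt0.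
have [ws [c0 [ws0 c00 wsE]]] := spinor_norm_values symB YB n2 b0.
exists (reflections B ws); first exact: orthogonal_reflections.
move=> p p_pr; rewrite /=.
rewrite -[map_mx ratr B]/(map_mx (padic_ratr p_pr) B).
rewrite -[map_mx ratr (reflections B ws)]/(map_mx (padic_ratr p_pr) (reflections B ws)).
rewrite map_reflections.
have [vs [vs0 vsP fp [c [u [cn0 uu vsE]]]]] := fP p p_pr.
set Bp := map_mx (padic_ratr p_pr) B in vs0 vsP vsE *.
set Xp := map_mx (padic_ratr p_pr) X in vsP.
have symBp : Bp^T = Bp by rewrite matrix.map_trmx symB.
have Bpu : Bp \in unitmx by rewrite map_unitmx.
have [N pN bE] : exists2 N, ~~ (p %| N)%N & (b = p ^ f p * N)%N.
  apply: prod_prime_powers => //; first exact: primes_uniq.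
  by apply/allP => q; rewrite mem_primes => /and3P[].
have uN : punit (u * N%:R) by apply: punitM => //; apply: punit_nat.
have [v1 [v2 [c1 [v10 v20 c10 UP UE]]]] := units p p_pr _ uN.
rewrite -/Bp in v10 v20 UP UE.
pose wsp := map (map_mx (padic_ratr p_pr)) ws.
have wsp0 : all (fun v => qform Bp v != 0) wsp.
  apply/allP => _ /mapP[w /(allP ws0) w0 ->]; rewrite qform_map fmorph_eq0; exact: w0.
have wspE : \prod_(v <- wsp) qform Bp v = padic_ratr p_pr c0 ^+ 2 * (p%:R ^+ f p * N%:R).
  transitivity (padic_ratr p_pr (\prod_(v <- ws) qform B v)).
    by rewrite big_map rmorph_prod; apply: eq_bigr => w _; rewrite qform_map.
  by rewrite wsE bE rmorphM rmorphXn rmorph_nat natrM natrX.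
have c0p : padic_ratr p_pr c0 != 0 by rewrite fmorph_eq0.
have YBp : map_mx (padic_ratr p_pr) Y *m Bp *m (map_mx (padic_ratr p_pr) Y)^T = 1%:M.
  by rewrite matrix.map_trmx -!map_mxM YB map_mx1.
(* The unit [u N] cancels those of the transport and of [ws] up to squares. *)
have us0 : all (fun v => qform Bp v != 0) [:: v1; v2] := all_pair v10 v20.
have e0 : c1 * c * padic_ratr p_pr c0 * (u * N%:R) * p%:R ^+ f p != 0.
  exact: norm_neq0 c10 cn0 c0p (punit_neq0 uN) (expf_neq0 _ (padic_p_neq0 p_pr)).
have norms : \prod_(v <- [:: v1; v2]) qform Bp v * \prod_(v <- vs) qform Bp v *
    \prod_(v <- wsp) qform Bp v = (c1 * c * padic_ratr p_pr c0 * (u * N%:R) * p%:R ^+ f p) ^+ 2.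
  rewrite vsE wspE !big_cons big_nil mulr1 UE; exact: norm_ring.
have [S [SO Sn SN]] := special_transport symBp Bpu YBp oddn us0 vs0 wsp0 e0
  (@intvN p p_pr n) UP (N := fun y => intv (@pint p p_pr) (y *m invmx Xp)) vsP norms.
exists S; split=> //; apply/seteqP; split=> y.
  move=> /(lattice_atE y Xu)/SN[x xI xE]; exists x => //.
  by apply/lattice_atE; rewrite ?unitmx1// map_mx1 invmx1 mulmx1.
move=> [x /lattice_atE]; rewrite unitmx1 map_mx1 invmx1 mulmx1 => /(_ isT) xI <-.
by apply/lattice_atE => //; apply/SN; exists x.
Qed.

(** * Fields with equal discriminants *)

Section Realization.
Variables (K : splittingFieldType rat) (galK : galois 1 {:K}).
Local Notation OF := (ring_of_integers K).
Variables (m : nat) (b : 'I_m -> OF).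
Hypothesis bP : integral_basis b.

Definition int_coord (x : OF) : {ffun 'I_m -> int} := sval (cid (bP x)).

Lemma int_coordE x : x = \sum_i b i *~ int_coord x i.
Proof. by rewrite /int_coord; case: cid => c []. Qed.

Lemma int_coord_uniq x (c : {ffun 'I_m -> int}) : x = \sum_i b i *~ c i -> int_coord x = c.
Proof. by move=> xE; rewrite /int_coord; case: cid => d [? h]; apply: h. Qed.

Definition basis_map (X : 'M[rat]_m) (x : OF) : 'rV[rat]_m :=
  (\row_i (int_coord x i)%:~R) *m X.

Fact basis_map_additive X : zmod_morphism (basis_map X).
Proof.
move=> x y; rewrite /basis_map -mulmxBl; congr (_ *m _).
have -> : int_coord (x - y) = [ffun i => int_coord x i - int_coord y i].
  apply: int_coord_uniq; rewrite {1}(int_coordE x) {1}(int_coordE y) -sumrB.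
  by apply: eq_bigr => i _; rewrite ffunE mulrzBr.
by apply/rowP => i; rewrite !mxE ffunE rmorphB.
Qed.

HB.instance Definition _ X :=
  GRing.isZmodMorphism.Build OF 'rV[rat]_m (basis_map X) (basis_map_additive X).

Lemma val_coordE x : val x = \sum_i ((int_coord x i)%:~R : rat) *: val (b i).
Proof.
rewrite {1}(int_coordE x) OF_sumE; apply: eq_bigr => i _.
by rewrite -ratz_alg mulr_algl.
Qed.

(** Integral coordinates, multiplied by [X], are such an isometry. *)
Lemma trace_form_realizes (B X : 'M[rat]_m) : X \in unitmx ->
  X *m B *m X^T = trace_gram b -> realizes (@trace_form K) B X.
Proof.
move=> Xu XB; exists (basis_map X); split.
- move=> x y /(can_inj (mulmxK Xu)) /rowP e; rewrite (int_coordE x) (int_coordE y).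
  by apply: eq_bigr => i _; have := e i; rewrite !mxE => /trO_inj ->.
- apply/seteqP; split=> [_ [x _ <-]|_ [c _ <-]].
    by exists (\row_i int_coord x i) => //; congr (_ *m _); apply/rowP => i; rewrite !mxE.
  exists (\sum_i b i *~ c 0 i) => //; rewrite /= /basis_map; congr (_ *m _).
  rewrite (@int_coord_uniq _ [ffun i => c 0 i]); last by apply: eq_bigr => i _; rewrite ffunE.
  by apply/rowP => i; rewrite !mxE ffunE.
move=> x; rewrite -qform_pullback XB /qform bform_trace_gram// /trace_form expr2.
by rewrite (val_coordE x); congr (field_trace (_ * _)); apply: eq_bigr => i _; rewrite mxE.
Qed.

End Realization.

Section EqualDiscriminants.
Variables (K L : splittingFieldType rat).
Hypotheses (galK : galois 1 {:K}) (galL : galois 1 {:L}).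
Hypotheses (ramK : totally_ramified K) (ramL : totally_ramified L).
Hypotheses (tameK : tame K) (tameL : tame L).
Hypotheses (oddK : odd (\dim {:K})) (oddL : odd (\dim {:L})).
Variables (m : nat) (b : 'I_m -> ring_of_integers K) (c : 'I_m -> ring_of_integers L).
Hypotheses (bP : integral_basis b) (cP : integral_basis c).
Hypothesis disc_eq : disc K = disc L.

Lemma local_scale_disc p : local_scale galK p b = local_scale galL p c.
Proof.
have dK := discE galK bP; have dL := discE galL cP.
rewrite (trace_gramE galK) det_map_mx in dK; rewrite (trace_gramE galL) det_map_mx in dL.
by rewrite /local_scale (trO_inj (etrans (esym dK) (etrans disc_eq dL))).
Qed.

(** Both elements [1] have length the degree. *)
Lemma matching_isometry (e e' : 'I_m -> int) :
  1 = \sum_i b i *~ e i -> 1 = \sum_i c i *~ e' i ->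
  exists X, [/\ X \in unitmx, X *m trace_gram b *m X^T = trace_gram c &
    (\row_i (e' i)%:~R) *m X = \row_i (e i)%:~R].
Proof.
move=> eE eE'; have [YK YKE] := trace_form_orthonormal galK oddK bP.
have [YL YLE] := trace_form_orthonormal galL oddL cP.
have dKL : \dim {:K} = \dim {:L}.
  by rewrite -(integral_basis_size bP) -(integral_basis_size cP).
have val1 (F : splittingFieldType rat) (d : 'I_m -> ring_of_integers F) (f : 'I_m -> int) :
    galois 1 {:F} -> 1 = \sum_i d i *~ f i ->
    qform (trace_gram d) (\row_i (f i)%:~R) = (\dim {:F})%:R.
  move=> galF fE; rewrite /qform bform_trace_gram//.
  have -> : \sum_i ((\row_j (f j)%:~R) : 'rV[rat]_m) 0 i *: val (d i) = val (1 : ring_of_integers F).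
    rewrite fE OF_sumE; apply: eq_bigr => i _.
    by rewrite mxE -ratz_alg mulr_algl.
  by rewrite -OF_valM mulr1 -(trOE galF) trO1.
apply: (isometry_matching_vectors (trace_gram_sym b) YKE YLE).
by rewrite (val1 _ _ _ galK eE) (val1 _ _ _ galL eE') dKL.
Qed.

(** The change of basis is [1] or [-1]. *)
Lemma rank_one_lattices (B X : 'M[rat]_1) : B \in unitmx -> \det (X *m B *m X^T) = \det B ->
  lattice_same_spinor_genus B 1%:M X.
Proof.
move=> Bu dX; have d0 : \det B != 0 by rewrite -unitfE -unitmxE.
have X2 : X 0 0 ^+ 2 = 1.
  apply: (mulfI d0); rewrite mulr1 -[RHS]dX !det_mulmx det_tr det_mx11.
  by rewrite expr2; ring.
have x1 : X 0 0 = 1 \/ X 0 0 = -1 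
  by have /eqP := X2; rewrite sqrf_eq1 => /orP[/eqP|/eqP]; [left|right].
have Xu : X \in unitmx.
  by rewrite unitmxE det_mx11 unitfE; case: x1 => ->; rewrite ?oppr_eq0 oner_neq0.
exists 1%:M; first by split=> [|x y]; rewrite ?unitmx1// !mulmx1.
move=> p p_pr; exists 1%:M; split.
- by split; [split=> [|x y]; rewrite ?unitmx1// !mulmx1|rewrite det1].
- by exists [::], 1; rewrite /= oner_neq0 !big_nil expr1n mulr1.
have XE : X = 1%:M \/ X = - 1%:M.
  rewrite [X]mx11_scalar; case: x1 => ->; [by left|right].
  by rewrite -scaleN1r scalemx1.
pose phi := padic_ratr p_pr.
have yE y : intv (@pint p p_pr) (y *m invmx (map_mx phi X)) <-> intv (@pint p p_pr) y.
  case: XE => ->; first by rewrite map_mx1 invmx1 mulmx1.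
  have Xpu : map_mx phi (- 1%:M : 'M[rat]_1) \in unitmx.
    by rewrite map_mxN map_mx1 -scaleN1r unitmxZ ?unitmx1// unitrN1.
  have -> : y *m invmx (map_mx phi (- 1%:M : 'M[rat]_1)) = - y.
    rewrite -[RHS](mulmxK Xpu); congr (_ *m _).
    by rewrite map_mxN map_mx1 mulNmx mulmxN mulmx1 opprK.
  by split=> h; [rewrite -[y]opprK|]; apply: intvN.
have y1 y : lattice_at p_pr 1%:M y <-> intv (@pint p p_pr) y.
  by rewrite lattice_atE ?unitmx1// map_mx1 invmx1 mulmx1.
rewrite -[map_mx ratr 1%:M]/(map_mx phi 1%:M) map_mx1.
apply/seteqP; split=> y.
  by move=> /(lattice_atE y Xu)/yE yI; exists y; rewrite ?mulmx1//; apply/y1.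
by move=> [x /y1 xI]; rewrite !mulmx1 => <-; apply/lattice_atE => //; apply/yE.
Qed.

(** An isometry that identifies the elements [1] makes the local models at each
    prime have the same parameters. *)
Theorem trace_lattices_same_spinor_genus :
  same_spinor_genus (@trace_form K) (@trace_form L).
Proof.
have [e [eE _]] := bP 1; have [e' [eE' _]] := cP 1.
have [X [Xu XA eX]] := matching_isometry eE eE'.
have symA := trace_gram_sym b.
have dKL : \dim {:K} = \dim {:L}.
  by rewrite -(integral_basis_size bP) -(integral_basis_size cP).
have [Y YA] := trace_form_orthonormal galK oddK bP.
have [Yu AYu] := mulmx1_unit (etrans (mulmxA _ _ _) YA).
have Au : trace_gram b \in unitmx by move: AYu; rewrite unitmx_mul => /andP[].
exists m, (trace_gram b), 1%:M, X; split.
- by split.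
- by rewrite unitmx1.
- by apply: (trace_form_realizes galK bP); rewrite ?unitmx1// trmx1 mulmx1 mul1mx.
- exact: (trace_form_realizes galL cP).
have [m1|m1] := eqVneq m 1%N.
  have detX : \det (X *m trace_gram b *m X^T) = \det (trace_gram b).
    by rewrite XA -(discE galL cP) -(discE galK bP).
  by clear - m1 Au detX; subst m; apply: rank_one_lattices.
have oddm : odd m by rewrite (integral_basis_size bP).
have m2 : (2 < m)%N by case: (m) m1 oddm => [|[|[|]]].
have model_at p (p_pr : prime p) : exists mu lam e0 t0 e1 t1, [/\ mu != 0, lam != 0,
    good_model (@pint p p_pr) mu lam (map_mx (padic_ratr p_pr) (trace_gram b)) e0 t0,
    good_model (@pint p p_pr) mu lam (map_mx (padic_ratr p_pr) (trace_gram c)) e1 t1 &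
    e1 *m map_mx (padic_ratr p_pr) X = e0].
  have [pn|pn] := boolP (p %| \dim {:K})%N.
    exists 1, 1, 0, 0, 0, 0; rewrite oner_neq0 mul0mx; split=> //.
      exact: (trace_form_model_degree galK).
    by apply: (trace_form_model_degree galL); rewrite -?dKL.
  exists (\dim {:K})%:R, (local_scale galK p b)%:R.
  exists (int_row p_pr e), (int_row p_pr (fun i => trO galK (b i))).
  exists (int_row p_pr e'), (int_row p_pr (fun i => trO galL (c i))); split.
  - by apply: natk_neq0; rewrite adim_gt0.
  - by apply: natk_neq0; apply: local_scale_gt0.
  - exact: (trace_form_model galK bP eE).
  - rewrite local_scale_disc dKL; apply: (trace_form_model galL cP eE') => //.
    by rewrite -dKL.
  have := congr1 (map_mx (padic_ratr p_pr)) eX; rewrite map_mxM.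
  have rowE (f : 'I_m -> int) :
      map_mx (padic_ratr p_pr) (\row_i (f i)%:~R) = int_row p_pr f.
    by apply/rowP => i; rewrite !mxE rmorph_int.
  by rewrite !rowE.
apply: (same_spinor_genus_of_local symA YA Xu oddm m2) => [p p_pr|p p_pr u uu] Bp.
  move=> Xp; have [mu [lam [e0 [t0 [e1 [t1 [mu0 lam0 g0 g1 eXp]]]]]]] := model_at p p_pr.
  apply: (model_transport (padic_valuation_ring p_pr) mu0 lam0 _ _ _ eXp g0 g1).
  - by rewrite matrix.map_trmx symA.
  - by rewrite map_unitmx.
  - by rewrite matrix.map_trmx -!map_mxM XA.
have [mu [lam [e0 [t0 [e1 [t1 [mu0 lam0 g0 g1 eXp]]]]]]] := model_at p p_pr.
apply: (model_units (padic_valuation_ring p_pr) mu0 lam0 _ g0) => //.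
  by rewrite matrix.map_trmx symA.
by split; [apply: punit_int|apply: punit_pintV|apply: punit_neq0].
Qed.

End EqualDiscriminants.

(** * The discriminant of a spinor genus *)

Section RealizedDiscriminant.
Variables (K : splittingFieldType rat) (galK : galois 1 {:K}).
Local Notation OF := (ring_of_integers K).

(** The preimages of the rows of [M] form an integral basis, and the quadratic
    form determines the bilinear one. *)
Lemma realizes_disc n (B M : 'M[rat]_n) : quadratic_space B -> M \in unitmx ->
  realizes (@trace_form K) B M -> disc K = \det (M *m B *m M^T).
Proof.
move=> [symB Bu] Mu [f [finj frange fq]].
have /boolp.choice[b bE] : forall i, exists x : OF, f x = row i M.
  move=> i; have : lattice M (row i M).
    by exists (delta_mx 0 i) => //; rewrite map_delta_mx -rowE.
  by rewrite -frange => -[x _ xE]; exists x.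
have fsum (c : 'I_n -> int) : f (\sum_i b i *~ c i) = (\row_i (c i)%:~R) *m M.
  rewrite raddf_sum mulmx_sum_row; apply: eq_bigr => i _.
  by rewrite raddfMz bE mxE scaler_int.
have bP : integral_basis b.
  move=> x; have : lattice M (f x) by rewrite -frange; exists x.
  move=> [c _ cE]; exists [ffun i => c 0 i]; split.
    apply: finj; rewrite fsum -cE; congr (_ *m _).
    by apply/rowP => i; rewrite !mxE ffunE.
  move=> d dE; have := congr1 f dE; rewrite fsum -cE => /(can_inj (mulmxK Mu))/rowP e.
  by apply/ffunP => i; have := e i; rewrite ffunE !mxE => /trO_inj.
have fB x y : bform B (f x) (f y) = field_trace (val x * val y).
  have two0 : (2 : rat) != 0 by [].
  apply: (mulfI two0).
  have := fq (x + y); rewrite raddfD qformD// !fq /trace_form.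
  rewrite OF_valD sqrrD mulr2n !(field_traceD galK) => e.
  apply: (addrI (field_trace (val x ^+ 2))); apply: (addIr (field_trace (val y ^+ 2))).
  by rewrite e; ring.
rewrite (discE galK bP); congr (\det _); apply/matrixP => i j.
by rewrite bform_mx mxE -fB !bE.
Qed.

End RealizedDiscriminant.

Lemma pint_denq p (p_pr : prime p) (q : rat) : pint (padic_ratr p_pr q) -> ~~ (p %| denq q)%Z.
Proof.
move=> qI; apply/negP => /dvdzP[d dE].
have pn : ~~ (p %| numq q)%Z.
  apply/negP => pn; have := coprime_num_den q.
  rewrite /coprime => /eqP g1.
  have : (p %| gcdn `|numq q| `|denq q|)%N.
    by rewrite dvdn_gcd; move: pn; rewrite dvdzE => -> ; rewrite dE abszM dvdn_mull.
  by rewrite g1 dvdn1; have := prime_gt1 p_pr; lia.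
have uq := punit_intr p_pr pn; apply: (@not_pint_pV p p_pr).
have p0 := padic_p_neq0 p_pr.
have E : padic_ratr p_pr q * d%:~R * p%:R = (numq q)%:~R.
  have := congr1 (padic_ratr p_pr) (numqE q); rewrite rmorph_int dE !rmorphM.
  by rewrite !rmorph_int mulrA.
have -> : p%:R^-1 = (numq q)%:~R^-1 * (padic_ratr p_pr q * d%:~R).
  apply: (mulIf p0); rewrite mulVf// -mulrA E mulVf//; exact: punit_neq0.
apply: pintM; first exact: punit_pintV.
by apply: pintM => //; apply: pint_int.
Qed.

Lemma rat_int_of_pint (q : rat) : (forall p (p_pr : prime p), pint (padic_ratr p_pr q)) ->
  denq q = 1.
Proof.
move=> qI; have d0 := denq_gt0 q.
have [d1|d1] := leqP `|denq q| 1; first by lia.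
have pp := pdiv_prime d1; have := pint_denq (qI _ pp).
by rewrite dvdzE pdiv_dvd.
Qed.

(** Such a rational number is [1] or [-1]. *)
Lemma rat_unit_square (q : rat) : q != 0 ->
  (forall p (p_pr : prime p), pint (padic_ratr p_pr q)) ->
  (forall p (p_pr : prime p), pint (padic_ratr p_pr q^-1)) -> q ^+ 2 = 1.
Proof.
move=> q0 /rat_int_of_pint qd /rat_int_of_pint qd'.
have e : (numq q * numq q^-1)%:~R = 1 :> rat.
  by rewrite rmorphM /= !numqE qd qd' !mulr1 mulfV.
have qE : q = (numq q)%:~R by rewrite numqE qd mulr1.
have e' : numq q * numq q^-1 = 1 by apply: trO_inj; rewrite e.
have : `|numq q|%N = 1%N.
  by apply/eqP; rewrite -dvdn1; apply/dvdnP; exists `|numq q^-1|%N; rewrite -abszM mulrC e'.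
move=> h; rewrite qE -rmorphXn /=.
by have [->|->] : numq q = 1 \/ numq q = -1 by move: (numq q) h => z h; lia.
Qed.

(** The change of basis from the image of the first lattice to the second one is
    integral. *)
Lemma lattice_image_det p (p_pr : prime p) n (A C : 'M[rat]_n) (T : 'M[padic p_pr]_n) :
  C \in unitmx -> (forall x, lattice_at p_pr A x -> lattice_at p_pr C (x *m T)) ->
  pint (padic_ratr p_pr (\det A) * \det T / padic_ratr p_pr (\det C)).
Proof.
move=> Cu sub; set phi := padic_ratr p_pr.
have Cpu : map_mx phi C \in unitmx by rewrite map_unitmx.
have W i j : pint ((map_mx phi A *m T *m invmx (map_mx phi C)) i j).
  have h : lattice_at p_pr A (row i (map_mx phi A)).
    exists (delta_mx 0 i) => //; rewrite -[map_mx ratr A]/(map_mx phi A) rowE; congr (_ *m _).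
    by apply/rowP => l; rewrite !mxE rmorph_nat.
  by have /(lattice_atE _ Cu)/(_ j) := sub _ h; rewrite -!row_mul mxE.
have V := padic_valuation_ring p_pr.
have := intmx_det V W; rewrite !det_mulmx det_map_mx.
have -> : \det (invmx (map_mx phi C)) = (phi (\det C))^-1 by rewrite det_inv det_map_mx.
by [].
Qed.

(** At every prime the base change between the lattices has determinant a unit,
    since the local and global isometries have determinant [1] or [-1]; so its
    determinant over the rationals is [1] or [-1], and the discriminants differ
    by its square. *)
Theorem same_spinor_genus_disc (K L : splittingFieldType rat) :
  galois 1 {:K} -> galois 1 {:L} ->
  same_spinor_genus (@trace_form K) (@trace_form L) -> disc K = disc L.
Proof.
move=> galK galL [n [B [M [N [qB [Mu Nu] rK rL [s sO sP]]]]]].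
rewrite (realizes_disc galK qB Mu rK) (realizes_disc galL qB Nu rL) !det_mulmx !det_tr.
have dM0 : \det M != 0 by rewrite -unitfE -unitmxE.
have dN0 : \det N != 0 by rewrite -unitfE -unitmxE.
have signs : \det s = 1 \/ \det s = -1 by apply: (orthogonal_det qB.2 sO).
have su := sO.1.
have sgn p (p_pr : prime p) a : pint (a * padic_ratr p_pr (\det s)) -> pint a.
  case: signs => ->; rewrite ?rmorph1 ?mulr1// rmorphN1 mulrN1 => /pintN.
  by rewrite opprK.
have q1 : (\det N / \det M) ^+ 2 = 1.
  apply: rat_unit_square; first by rewrite mulf_neq0 ?invr_eq0.
    move=> p p_pr; have [S [[SO S1] _ lat]] := sP p p_pr.
    have Su := SO.1.
    pose T := S *m map_mx (padic_ratr p_pr) s.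
    have Tu : T \in unitmx by rewrite unitmx_mul Su map_unitmx.
    apply: (sgn p p_pr); rewrite fmorph_div.
    have sub x : lattice_at p_pr N x -> lattice_at p_pr M (x *m invmx T).
      by rewrite lat => -[y yM <-]; rewrite -(mulmxA y) (mulmxK Tu).
    have := lattice_image_det Mu sub.
    rewrite det_inv /T det_mulmx S1 mul1r det_map_mx.
    by case: signs => ->; rewrite ?rmorph1 ?rmorphN1 ?invrN1 ?invr1 mulrAC.
  move=> p p_pr; have [S [[SO S1] _ lat]] := sP p p_pr.
  pose T := S *m map_mx (padic_ratr p_pr) s.
  apply: (sgn p p_pr); rewrite invf_div fmorph_div.
  have sub x : lattice_at p_pr M x -> lattice_at p_pr N (x *m T).
    by move=> xM; rewrite lat; exists x => //; rewrite mulmxA.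
  have := lattice_image_det Nu sub.
  by rewrite /T det_mulmx S1 mul1r det_map_mx mulrAC.
move: q1; rewrite expr_div_n => /(canRL (mulfVK _)); rewrite mul1r => e.
have {}e : \det N ^+ 2 = \det M ^+ 2 by apply: e; rewrite expf_neq0.
by rewrite mulrAC -expr2 -e expr2 mulrAC.
Qed.

Theorem theorem2p11 (K L : splittingFieldType rat)
    (galK : galois 1%VS {:K}) (galL : galois 1%VS {:L})
    (ramK : totally_ramified K) (ramL : totally_ramified L)
    (tameK : tame K) (tameL : tame L)
    (oddK : odd (\dim {:K})) (oddL : odd (\dim {:L})) :
  same_spinor_genus (@trace_form K) (@trace_form L) <-> disc K = disc L.
Proof.
split=> [|dKL]; first exact: same_spinor_genus_disc.
have [b bP] := integral_basis_exists galK.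
have [c cP] : exists c : 'I_(\dim {:K}) -> ring_of_integers L, integral_basis c.
  rewrite (dim_of_disc galK galL oddK oddL ramK ramL tameK tameL dKL).
  exact: integral_basis_exists galL.
exact: (trace_lattices_same_spinor_genus galK galL ramK ramL tameK tameL oddK oddL bP cP dKL).
Qed.
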